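(* Assume the standing setting described in the context. Suppose that $L:=\{i\in I:C(A_i)=\infty\}$ consists of a single index $\ell$, that $\ell\in I^-$, and that $A_i\cap A_\ell=\varnothing$ for all $i\ne\ell$. For an admissible vector $\boldsymbol a$ (see context), let $\tilde{\boldsymbol\lambda}=(\tilde\lambda^i)_{i\in I}$ be any solution of the $(\boldsymbol A,\boldsymbol a,g,\chi,I\setminus\{\ell\})$-problem. Then the Gauss variational problem (the $(\boldsymbol A,\boldsymbol a,g,\chi,I)$-problem) is solvable if and only if $$a_\ell\le\int g\,d\tilde\lambda^\ell,$$ or, equivalently, $$a_\ell\le\int g\,d\Bigl[P_{A_\ell}\Bigl(\chi+\sum_{i\ne\ell}\alpha_i\tilde\lambda^i\Bigr)\Bigr].$$ In other words, the set $\mathcal S_\kappa(\boldsymbol A,g,\chi)$ of all admissible $\boldsymbol a$ for which the Gauss variational problem is solvable consists exactly of those $\boldsymbol a$ satisfying these inequalities.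
   Context: Standing setting. $\mathrm X$ is a noncompact locally compact Hausdorff space; $\mathfrak M$ the real Radon measures on $\mathrm X$ with the vague topology; $S(\nu)$ the support. Kernel $\kappa:\mathrm X\times\mathrm X\to[0,\infty]$, lower semicontinuous, symmetric; $\kappa(\nu,\nu_1)=\int\kappa\,d(\nu\otimes\nu_1)$, $\kappa(x,\nu)=\int\kappa(x,y)d\nu(y)$; $\mathcal E$ = measures with $\kappa(\nu,\nu)$ well defined and finite. Assumed: (a) strictly positive definite ($\|\nu\|:=\kappa(\nu,\nu)^{1/2}$ is a norm on the pre-Hilbert space $\mathcal E$; ''strong'' refers to it); (b) consistent: every strong Cauchy net in $\mathcal E^+=\{\nu\in\mathcal E:\nu\ge0\}$ converges strongly to each of its vague cluster points; (c) $\kappa(x,y)$ finite and continuous for $x\ne y$; (d) for each $\varepsilon>0$ and compact $K$ there is compact $K'$ with $\kappa(x,y)<\varepsilon$ for $x\in K,y\notin K'$; (e) generalized maximum principle with constant $h\ge1$ (for compactly supported $\nu\ge0$ with $M=\sup_{S(\nu)}\kappa(\cdot,\nu)<\infty$, $\kappa(\cdot,\nu)\le hM$ everywhere). $\mathcal E^+_E$: elements of $\mathcal E^+$ concentrated on $E$. Interior capacity $C(E)=1/\inf\{\kappa(\nu,\nu):\nu\in\mathcal E^+_E,\nu(E)=1\}$; ''n.e.'' = outside a set of interior capacity zero. For closed $F$ with $C(F)>0$ and $\nu\in\mathcal E$, $P_F\nu$ is the unique $\omega\in\mathcal E^+_F$ minimizing $\|\nu-\omega\|$ (orthogonal projection onto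 the convex cone $\mathcal E^+_F$). Condenser: disjoint countable index sets $I^+,I^-$, $I=I^+\cup I^-$; nonempty closed $A_i$, locally finite family, $A_i\cap A_j=\varnothing$ for $i\in I^+,j\in I^-$; $\alpha_i=\pm1$ for $i\in I^\pm$; $A^\pm=\bigcup_{I^\pm}A_i$, $A=\bigcup_IA_i$; $\sup_{A^+\times A^-}\kappa<\infty$. Vector measures $\boldsymbol\mu=(\mu^i)$, $\mu^i\ge0$ concentrated on $A_i$; $R\boldsymbol\mu=\sum\alpha_i\mu^i$; $\mathcal E^+(\boldsymbol A)$ those with finite energy $\sum_{i,j}\alpha_i\alpha_j\kappa(\mu^i,\mu^j)$. External field: bounded signed $\chi\in\mathcal E$ with $S(\chi^+)\cap A^-=\varnothing$, $S(\chi^-)\cap A^+=\varnothing$; $G_\chi(\boldsymbol\mu)=\|R\boldsymbol\mu\|^2+2\kappa(\chi,R\boldsymbol\mu)$. $g$ continuous on $A$ with $\inf_Ag>0$, and for each $i$ either $g|_{A_i}$ bounded or $g^{r_i}\le\kappa(\cdot,\nu_i)$ n.e. on $A_i$ for some $r_i>1$, $\nu_i\in\mathcal E$. An admissible vector is $\boldsymbol a=(a_i)_{i\in I}$ with $a_i>0$, $\sum_ia_i<\infty$ and $G_\chi(\boldsymbol A,\boldsymbol a,g)<\infty$. For $I^+\subseteq J\subseteq I$: $\mathcal E^+(\boldsymbol A,\boldsymbol a,g,J)=\{\boldsymbol\mu\in\mathcal E^+(\boldsymbol A):\int g\,d\mu^i=a_i\ \forall i\in J\}$, $G_\chi(\boldsymbol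 A,\boldsymbol a,g,J)$ = infimum of $G_\chi$ over it; the $(\boldsymbol A,\boldsymbol a,g,\chi,J)$-problem asks for a minimizer in this class; for $J=I$ it is the Gauss variational problem and $J$ is dropped from notation. *)

(* Defs.v *)
From HB Require Import structures.
From mathcomp Require Import all_boot all_order all_algebra.
From mathcomp Require Import all_classical all_reals all_analysis.

Set Implicit Arguments.
Unset Strict Implicit.
Unset Printing Implicit Defensive.

Import Order.TTheory GRing.Theory Num.Theory.
Import numFieldNormedType.Exports.

Local Open Scope classical_set_scope.
Local Open Scope ring_scope.

Definition borel (X : ptopologicalType) := g_sigma_algebraType (@open X).

Notation meas X R := {measure set (borel X) -> \bar R}.

Section potential_theory.
Context {R : realType} {X : ptopologicalType}.
Local Open Scope ereal_scope.

Definition bmeasurable (B : set X) : Prop := @measurable _ (borel X) B.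

Definition radon (mu : meas X R) : Prop :=
  [/\ (forall K : set X, compact K -> mu K < +oo),
      (forall U : set X, open U ->
          mu U = ereal_sup [set mu K | K in [set K : set X | compact K /\ K `<=` U]])
    & (forall B : set X, bmeasurable B ->
          mu B = ereal_inf [set mu U | U in [set U : set X | open U /\ B `<=` U]])].

Definition support (mu : meas X R) : set X :=
  [set x | forall U : set X, open U -> U x -> 0 < mu U].

Definition concentrated (mu : meas X R) (E : set X) : Prop :=
  exists B : set X, [/\ bmeasurable B, B `<=` E & mu (~` B) = 0].

Definition Cc (f : X -> R) : Prop :=
  continuous f /\ compact (closure [set x | f x != 0%R]).

Definition mint (mu : meas X R) (f : X -> R) : \bar R := \int[mu]_x (f x)%:E.

Variable kappa : X -> X -> \bar R.

Definition kpot (x : X) (mu : meas X R) : \bar R := \int[mu]_y kappa x y.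
Definition kap (mu nu : meas X R) : \bar R := \int[mu]_x \int[nu]_y kappa x y.

Definition Eplus (mu : meas X R) : Prop := radon mu /\ kap mu mu < +oo.

Definition dist2 (mu nu : meas X R) : \bar R :=
  kap mu mu + kap nu nu - 2%:E * kap mu nu.

(** A signed measure nu = p - n (p, n positive Radon) belongs to E. *)
Definition inE (p n : meas X R) : Prop :=
  [/\ Eplus p, Eplus n & kap p n < +oo].

(** interior capacity C(E) = 1 / inf { kappa(nu,nu) : nu in E^+_E, nu(E) = 1 }
    (with 1/0 = +oo and 1/(+oo) = 0). *)
Definition capacity (E : set X) : \bar R :=
  (ereal_inf [set kap nu nu | nu in
     [set nu : meas X R | [/\ Eplus nu, concentrated nu E & nu setT = 1]]])^-1.

Definition nearly_everywhere (E : set X) (P : X -> Prop) : Prop :=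
  capacity [set x | E x /\ ~ P x] = 0.

(** Energy pairing of two "signed families" of positive measures:
    a signed family (J, s, m) stands for sum_j (if s j then 1 else -1) m j.
    kappa(F1, F2) = sum_{j,k} sign1(j) sign2(k) kappa(m1 j, m2 k),
    split into the sums of its positive and its negative terms. *)
Definition kpair_pos (J1 J2 : choiceType) (s1 : J1 -> bool) (m1 : J1 -> meas X R)
    (s2 : J2 -> bool) (m2 : J2 -> meas X R) : \bar R :=
  \esum_(jk in [set jk : J1 * J2 | s1 jk.1 = s2 jk.2]) kap (m1 jk.1) (m2 jk.2).
Definition kpair_neg (J1 J2 : choiceType) (s1 : J1 -> bool) (m1 : J1 -> meas X R)
    (s2 : J2 -> bool) (m2 : J2 -> meas X R) : \bar R :=
  \esum_(jk in [set jk : J1 * J2 | s1 jk.1 <> s2 jk.2]) kap (m1 jk.1) (m2 jk.2).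
Definition kpair (J1 J2 : choiceType) (s1 : J1 -> bool) (m1 : J1 -> meas X R)
    (s2 : J2 -> bool) (m2 : J2 -> meas X R) : \bar R :=
  kpair_pos s1 m1 s2 m2 - kpair_neg s1 m1 s2 m2.
Definition fam_finite_energy (J : choiceType) (s : J -> bool) (m : J -> meas X R) :=
  kpair_pos s m s m < +oo /\ kpair_neg s m s m < +oo.

Definition strictly_pos_def : Prop :=
  forall p n : meas X R, inE p n ->
    0 <= kap p p + kap n n - 2%:E * kap p n /\
    (kap p p + kap n n - 2%:E * kap p n = 0 ->
       forall B : set X, bmeasurable B -> p B = n B).

Definition directed (D : Type) (le : D -> D -> Prop) : Prop :=
  [/\ inhabited D, (forall a, le a a),
      (forall a b c, le a b -> le b c -> le a c)
    & (forall a b, exists c, le a c /\ le b c)].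

Definition vague_cluster (D : Type) (le : D -> D -> Prop) (mu : D -> meas X R)
    (mu0 : meas X R) : Prop :=
  forall (n : nat) (f : 'I_n -> X -> R) (e : R) (d0 : D),
    (forall k, Cc (f k)) -> (0 < e)%R ->
    exists d, le d0 d /\
      forall k, `| mint (mu d) (f k) - mint mu0 (f k) | < e%:E.

Definition consistent : Prop :=
  forall (D : Type) (le : D -> D -> Prop) (mu : D -> meas X R),
    directed le -> (forall d, Eplus (mu d)) ->
    (forall e : R, (0 < e)%R -> exists d0, forall a b, le d0 a -> le d0 b ->
        dist2 (mu a) (mu b) < e%:E) ->
    forall mu0 : meas X R, radon mu0 -> vague_cluster le mu mu0 ->
      Eplus mu0 /\
      (forall e : R, (0 < e)%R -> exists d0, forall a, le d0 a ->
          dist2 (mu a) mu0 < e%:E).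

Definition finite_continuous_offdiag : Prop :=
  forall x y : X, x <> y ->
    kappa x y < +oo /\ {for (x, y), continuous (fun z : X * X => kappa z.1 z.2)}.

Definition vanishing_at_infinity : Prop :=
  forall e : R, (0 < e)%R -> forall K : set X, compact K ->
    exists K' : set X, compact K' /\
      forall x y, K x -> ~ K' y -> kappa x y < e%:E.

Definition gen_max_principle (h : R) : Prop :=
  forall nu : meas X R, radon nu -> compact (support nu) ->
    forall M : R, (0 <= M)%R ->
      (forall x, support nu x -> kpot x nu <= M%:E) ->
      forall x, kpot x nu <= (h * M)%:E.

Definition standing_kernel (h : R) : Prop :=
  [/\ (forall x y, 0 <= kappa x y),
      lower_semicontinuous (fun z : X * X => kappa z.1 z.2),
      (forall x y, kappa x y = kappa y x),
      [/\ strictly_pos_def, consistent,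
         finite_continuous_offdiag & vanishing_at_infinity]
    & (1 <= h)%R /\ gen_max_principle h].

Section condenser.
Variables (I : countType) (sg : I -> bool) (A : I -> set X).
(* sg i = true iff i \in I^+ ; alpha_i = if sg i then 1 else -1 *)

Definition Aplus : set X := \bigcup_(i in [set i | sg i]) A i.
Definition Aminus : set X := \bigcup_(i in [set i | ~~ sg i]) A i.
Definition Aall : set X := \bigcup_(i in [set: I]) A i.

Definition condenser : Prop :=
  [/\ (forall i, closed (A i) /\ A i !=set0),
      (forall x : X, exists2 U, nbhs x U & finite_set [set i | A i `&` U !=set0]),
      (forall i j, sg i -> ~~ sg j -> A i `&` A j = set0)
    & exists M : R, forall x y, Aplus x -> Aminus y -> kappa x y <= M%:E].

Definition EplusA (mu : I -> meas X R) : Prop :=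
  (forall i, radon (mu i) /\ concentrated (mu i) (A i)) /\
  fam_finite_energy sg mu.

(** external field chi = cp - cn (Jordan decomposition) *)
Definition chi_sign (b : bool) := b.
Definition chi_fam (cp cn : meas X R) (b : bool) : meas X R := if b then cp else cn.

Definition external_field (cp cn : meas X R) : Prop :=
  [/\ inE cp cn, cp setT < +oo /\ cn setT < +oo,
      (exists S : set X, [/\ bmeasurable S, cp (~` S) = 0 & cn S = 0]),
      support cp `&` Aminus = set0
    & support cn `&` Aplus = set0].

Definition Gchi (cp cn : meas X R) (mu : I -> meas X R) : \bar R :=
  kpair sg mu sg mu + 2%:E * kpair chi_sign (chi_fam cp cn) sg mu.

Definition g_condition (g : X -> R) : Prop :=
  [/\ {within Aall, continuous g},
      (exists c : R, (0 < c)%R /\ forall x, Aall x -> (c <= g x)%R)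
    & forall i, (exists M : R, forall x, A i x -> (`|g x| <= M)%R) \/
        exists r : R, (1 < r)%R /\ exists p n : meas X R, inE p n /\
          nearly_everywhere (A i) (fun x => ((g x) `^ r)%:E <= kpot x p - kpot x n)].

Definition EplusAag (g : X -> R) (a : I -> R) (J : set I) : set (I -> meas X R) :=
  [set mu | EplusA mu /\
     forall i, J i -> \int[mu i]_(x in A i) (g x)%:E = (a i)%:E].

Definition Ginf (cp cn : meas X R) (g : X -> R) (a : I -> R) (J : set I) : \bar R :=
  ereal_inf [set Gchi cp cn mu | mu in EplusAag g a J].

Definition solves (cp cn : meas X R) (g : X -> R) (a : I -> R) (J : set I)
    (lam : I -> meas X R) : Prop :=
  EplusAag g a J lam /\
  forall mu, EplusAag g a J mu -> Gchi cp cn lam <= Gchi cp cn mu.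

Definition Gauss_solvable (cp cn : meas X R) (g : X -> R) (a : I -> R) : Prop :=
  exists lam, solves cp cn g a setT lam.

Definition admissible (cp cn : meas X R) (g : X -> R) (a : I -> R) : Prop :=
  [/\ (forall i, (0 < a i)%R),
      \esum_(i in [set: I]) (a i)%:E < +oo
    & Ginf cp cn g a setT < +oo].

(** The signed measure nu = chi + sum_{i <> l} alpha_i lam^i as a signed family
    indexed by bool + I, and nu - omega as a signed family indexed by
    option (bool + I). *)
Definition nu_sign (s : (bool + I)%type) : bool :=
  match s with inl b => b | inr i => sg i end.
Definition nu_meas (cp cn : meas X R) (l : I) (lam : I -> meas X R)
    (s : (bool + I)%type) : meas X R :=
  match s with
  | inl b => chi_fam cp cn b
  | inr i => if i == l then (@mzero _ (borel X) R : meas X R) else lam i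
  end.
Definition numin_sign (s : option (bool + I)%type) : bool :=
  match s with None => false | Some s => nu_sign s end.
Definition numin_meas (cp cn : meas X R) (l : I) (lam : I -> meas X R)
    (omega : meas X R) (s : option (bool + I)%type) : meas X R :=
  match s with None => omega | Some s => nu_meas cp cn l lam s end.

(** omega = P_F (chi + sum_{i <> l} alpha_i lam^i): the element of E^+_F
    minimizing || nu - omega || (equivalently its square). *)
Definition is_projection (F : set X) (cp cn : meas X R) (l : I)
    (lam : I -> meas X R) (omega : meas X R) : Prop :=
  [/\ Eplus omega, concentrated omega F &
    forall omega' : meas X R, Eplus omega' -> concentrated omega' F ->
      kpair numin_sign (numin_meas cp cn l lam omega)
            numin_sign (numin_meas cp cn l lam omega)
      <= kpair numin_sign (numin_meas cp cn l lam omega')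
               numin_sign (numin_meas cp cn l lam omega')].

End condenser.

End potential_theory.

(* Main.v *)
(** Up to the constant ||chi||^2, G_chi is the squared distance ||R mu + chi||^2,
    so by the parallelogram law two solutions of the problem without constraint
    on the index l define the same charge; as A_l is disjoint from the other
    plates, they have the same l-th component, and so the same g-mass b on A_l.

    Since C(A_l) = +oo, there are measures on A_l with prescribed g-mass and
    arbitrarily small energy: if b < a_l, the missing mass costs nothing, and a
    Gauss solution would also solve the unconstrained problem, contradicting
    uniqueness.  Conversely G_chi attains its minimum under the relaxed constraint
    "g-mass at most a_l".  Among almost minimizers one selects those for which the
    energies of the positive and the negative parts are almost minimal too; then
    both parts are strong Cauchy sequences, consistency makes them converge to
    their vague limits, and the g-masses on the A_i with i <> l are preserved
    because C(A_i \ K) tends to 0 along the compact sets K.  If that minimizer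
    has g-mass less than a_l, convexity shows that it solves the unconstrained
    problem, so that b < a_l. *)

Require Import Defs.
From HB Require Import structures.
From mathcomp Require Import all_boot all_order all_algebra.
From mathcomp Require Import all_classical all_reals all_analysis.
From mathcomp Require Import finmap measurable_realfun ring lra.

Set Implicit Arguments.
Unset Strict Implicit.
Unset Printing Implicit Defensive.

Import Order.TTheory GRing.Theory Num.Theory.
Import numFieldNormedType.Exports.

Local Open Scope classical_set_scope.
Local Open Scope ring_scope.

(** * Layer sums *)

(** Consistency speaks of positive measures, whereas almost minimizing [field_energy] makes only the
    charges R mu Cauchy; this is why a second minimization is needed for the two parts. Their
    energies are bounded because their mutual energy is at most the sup of kappa on A+ x A- times
    the product of their masses, and inf g > 0 bounds the masses. The relaxed constraint on l is
    what bounds the mass there: without any constraint the l-th component may have infinite mass.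

    X need be neither metrizable nor sigma-compact. Vague limits are therefore taken along an
    ultrafilter, and tails of capacity along a net indexed by compact sets. Lower semicontinuity is
    exploited through strict superlevel sets, which are open and can be approximated by compact
    sets; these layers replace continuous test functions.

    Positive definiteness is stated for pairs with finite mutual energy. For two positive measures
    of finite energy this finiteness has to be derived first, and it is the maximum principle that
    gives it. *)

Lemma ge0_lee_ltP (R : realType) (x y : \bar R) : (0 <= y)%E ->
  (forall r : R, 0 <= r -> (r%:E < x)%E -> (r%:E <= y)%E) -> (x <= y)%E.
Proof.
case: y => [y| |//]; last by move=> _ _; rewrite leey.
rewrite lee_fin => y0 H; rewrite leNgt; apply/negP => yx.
case: x H yx => [x| |//] H.
  rewrite lte_fin => yx.
  have : (((y + x) / 2)%:E <= y%:E)%E by apply: H; rewrite ?lte_fin; lra.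
  by rewrite lee_fin; lra.
by move=> _; have := H (y + 1); rewrite ltry !lee_fin; lra.
Qed.

Lemma ge0_lt_dense (R : realType) (x y : \bar R) : (0 <= x)%E -> (x < y)%E ->
  exists2 r : R, 0 <= r & (x < r%:E < y)%E.
Proof.
case: x => [x| |//] x0; last by rewrite ltNge leey.
case: y => [y| |//] xy.
  by exists ((x + y) / 2); move: x0 xy; rewrite ?lee_fin ?lte_fin => x0 xy; lra.
by exists (x + 1); rewrite ?ltry ?lte_fin; move: x0; rewrite lee_fin => x0; lra.
Qed.

Section layer_sums.
Context d (T : measurableType d) (R : realType).
Implicit Types (f : T -> \bar R) (e : R) (N : nat).
Local Open Scope ereal_scope.

Definition level f r := [set y : T | r%:E < f y].

(** A step function below [f] made of strict superlevel sets, which are open when [f] is lower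
    semicontinuous: integrals reduce to measures of open sets, which regularity exchanges for
    compact ones. *)
Definition lsum e N f (x : T) : \bar R :=
  \sum_(k < N) (e * \1_(level f (e * k.+1%:R)) x)%:E.

Lemma lsum_ge0 e N f x : (0 <= e)%R -> 0 <= lsum e N f x.
Proof. by move=> e0; apply: sume_ge0 => k _; rewrite lee_fin mulr_ge0. Qed.

Lemma measurable_level e f : measurable_fun setT f ->
  measurable (level f e).
Proof.
by move=> mf; rewrite -[X in measurable X]setTI; exact: emeasurable_fun_o_infty.
Qed.

Lemma measurable_lsum e N f : measurable_fun setT f ->
  measurable_fun setT (lsum e N f).
Proof.
move=> mf; apply: emeasurable_sum => k.
apply/measurable_EFinP/measurable_funM => //.
exact/measurable_indic/measurable_level.
Qed.

Lemma lsum_le e N f x : (0 <= e)%R -> 0 <= f x -> lsum e N f x <= f x.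
Proof.
move=> e0 f0; elim: N => [|N IH]; first by rewrite /lsum big_ord0.
have [fN|fN] := ltP (e * N.+1%:R)%:E (f x).
  apply: le_trans (ltW fN); rewrite /lsum sumEFin lee_fin.
  rewrite [leLHS](_ : _ = \sum_(k < N.+1) e)%R.
    by rewrite sumr_const card_ord mulr_natr.
  apply: eq_bigr => k _; rewrite indicE mem_set ?mulr1//=.
  apply: le_lt_trans fN; rewrite lee_fin ler_wpM2l// ler_nat.
  by have := ltn_ord k; rewrite ltnS.
rewrite /lsum big_ord_recr/= indicE memNset ?mulr0 ?adde0//=.
by apply/negP; rewrite -leNgt.
Qed.

(** Only levels with [e * k.+1 < f x] count, so the highest layer reached is still strictly below
    [f x]. The strictness leaves room for [kernel_tube] in [kap_rect]. *)
Lemma lsum_lt e N f x : (0 <= e)%R -> 0 < f x -> lsum e N f x < f x.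
Proof.
move=> e0 f0; elim: N => [|N IH]; first by rewrite /lsum big_ord0.
have [fN|fN] := ltP (e * N.+1%:R)%:E (f x).
  apply: le_lt_trans fN; rewrite /lsum sumEFin lee_fin.
  rewrite [leRHS](_ : _ = \sum_(k < N.+1) e)%R; last first.
    by rewrite sumr_const card_ord mulr_natr.
  by apply: ler_sum => k _; rewrite ler_piMr// indicE; case: (_ \in _).
rewrite /lsum big_ord_recr/= indicE memNset ?mulr0 ?adde0//=.
by apply/negP; rewrite -leNgt.
Qed.

Lemma lsum_ge e N m f x : (0 <= e)%R -> (m <= N)%N ->
  (e * m%:R)%:E < f x -> (e * m%:R)%:E <= lsum e N f x.
Proof.
move=> e0; elim: N => [|N IH]; first by rewrite leqn0 => /eqP -> _; rewrite mulr0 lsum_ge0.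
rewrite leq_eqVlt => /orP[/eqP-> em|]; last first.
  rewrite ltnS => mN em; apply: le_trans (IH mN em) _.
  by rewrite /lsum big_ord_recr/= leeDl// lee_fin mulr_ge0.
rewrite /lsum sumEFin lee_fin.
rewrite [leRHS](_ : _ = \sum_(k < N.+1) e)%R.
  by rewrite sumr_const card_ord mulr_natr.
apply: eq_bigr => k _; rewrite indicE mem_set ?mulr1//=.
by apply: le_lt_trans em; rewrite lee_fin ler_wpM2l// ler_nat.
Qed.

Lemma integral_lsum (mu : {measure set T -> \bar R}) e N f :
  (0 <= e)%R -> measurable_fun setT f ->
  \int[mu]_x lsum e N f x =
  \sum_(k < N) e%:E * mu (level f (e * k.+1%:R)).
Proof.
move=> e0 mf; rewrite /lsum ge0_integral_sum//=.
- apply: eq_bigr => k _.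
  under eq_integral do rewrite EFinM.
  rewrite ge0_integralZl_EFin//=.
  + by rewrite integral_indic ?setIT//; exact: measurable_level.
  + exact/measurable_EFinP/measurable_indic/measurable_level.
- move=> k; apply/measurable_EFinP/measurable_funM => //.
  exact/measurable_indic/measurable_level.
- by move=> k x _; rewrite lee_fin mulr_ge0.
Qed.

Lemma le_limn_einf (u : (\bar R)^nat) (r : \bar R) N :
  (forall n, (N <= n)%N -> r <= u n) -> r <= limn_einf u.
Proof.
move=> ru; rewrite limn_einf_lim (cvg_lim _ (@cvg_einfs_sup _ u))//.
apply: le_trans (ereal_sup_ubound _); last by exists N.
by apply: le_ereal_inf_tmp => _ [n /= Nn <-]; exact: ru.
Qed.

Lemma limn_einf_le (u : (\bar R)^nat) (r : \bar R) :
  (forall n, u n <= r) -> limn_einf u <= r.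
Proof.
move=> ur; rewrite limn_einf_lim (cvg_lim _ (@cvg_einfs_sup _ u))//.
apply: ge_ereal_sup => _ [n _ <-].
by apply: le_trans (ur n); apply: ereal_inf_lbound; exists n => /=.
Qed.

(** Mesh [1 / (n + 1)] and [(n + 1) ^ 2] layers reach height [n + 1], so infinite values are covered
    as well. The sums are not monotone in [n], hence the lower limit. *)
Lemma lsum_limn_einf f x : 0 <= f x ->
  f x <= limn_einf (fun n => lsum n.+1%:R^-1 (n.+1 ^ 2) f x).
Proof.
move=> f0; apply: ge0_lee_ltP => [|r r0 rf].
  by apply: (@le_limn_einf _ _ 0) => n _; rewrite lsum_ge0// invr_ge0.
have [s s0 /andP[]] := ge0_lt_dense (r0 : 0 <= r%:E) rf.
rewrite lte_fin => rs sf.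
(* Beyond [N] the layers reach above [s], and the mesh is finer than [s - r], so that rounding [s]
   down to the mesh stays above [r]. *)
pose N := maxn (Num.truncn (s - r)^-1) (Num.truncn s).
apply: (@le_limn_einf _ _ N) => n; rewrite geq_max => /andP[n1 n2].
have n0 : (0 < n.+1%:R :> R)%R by rewrite ltr0n.
have sn : (s < n.+1%:R)%R.
  by rewrite -truncn_lt_nat// ltnS.
have rn : (n.+1%:R^-1 < s - r)%R.
  rewrite -[ltRHS]invrK ltf_pV2 ?posrE ?invr_gt0 ?subr_gt0//.
  by rewrite -truncn_lt_nat ?ltnS// invr_ge0 subr_ge0 ltW.
pose m := Num.truncn (s * n.+1%:R).
have /andP[m1 m2] : (m%:R <= s * n.+1%:R < m.+1%:R)%R.
  by apply: truncn_itv; rewrite mulr_ge0.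
have ms : (n.+1%:R^-1 * m%:R <= s)%R by rewrite mulrC ler_pdivrMr.
apply: (@le_trans _ _ (n.+1%:R^-1 * m%:R)%:E); last first.
  apply: lsum_ge; first by rewrite invr_ge0.
    rewrite -(ler_nat R) natrX (le_trans m1)// expr2 ler_wpM2r//; exact: ltW.
  by apply: le_lt_trans sf; rewrite lee_fin.
rewrite lee_fin; move: m2; rewrite -ltr_pdivlMr// -natr1 mulrDl mul1r [(m%:R / _)%R]mulrC.
move: rn; set u := (_^-1)%R; move: (_ * _)%R => w rn m2.
clear -rn m2; lra.
Qed.

(** Fatou's lemma takes the place of monotone convergence. *)
Lemma lt_integral_lsum (mu : {measure set T -> \bar R}) f t :
  measurable_fun setT f -> (forall x, 0 <= f x) -> t < \int[mu]_x f x ->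
  exists e N, (0 < e)%R /\
    t < \sum_(k < N) e%:E * mu (level f (e * k.+1%:R)).
Proof.
move=> mf f0 tf; apply: contrapT => H; move: tf; apply/negP; rewrite -leNgt.
pose F n x := lsum n.+1%:R^-1 (n.+1 ^ 2) f x.
have n0 n : (0 <= n.+1%:R^-1 :> R)%R by rewrite invr_ge0.
apply: (@le_trans _ _ (\int[mu]_x limn_einf (F^~ x))).
  apply: ge0_le_integral => //.
  - rewrite /limn_einf; apply: measurableT_comp => //.
    apply: measurable_fun_limn_esup => n.
    by apply: measurableT_comp => //; exact: measurable_lsum.
  - by move=> x _; exact: lsum_limn_einf.
apply: (le_trans (fatou _ _ _ _)) => //.
- by move=> n; exact: measurable_lsum.
- by move=> n x _; exact: lsum_ge0.
apply: limn_einf_le => n; rewrite integral_lsum//.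
rewrite leNgt; apply/negP => tn; apply: H.
by exists n.+1%:R^-1%R, (n.+1 ^ 2)%N; split => //; rewrite invr_gt0.
Qed.

Lemma lsum_integral_le (mu : {measure set T -> \bar R}) e N f :
  (0 <= e)%R -> measurable_fun setT f -> (forall x, 0 <= f x) ->
  \sum_(k < N) e%:E * mu (level f (e * k.+1%:R)) <= \int[mu]_x f x.
Proof.
move=> e0 mf f0; rewrite -integral_lsum//; apply: ge0_le_integral => //.
- by move=> x _; exact: lsum_ge0.
- exact: measurable_lsum.
- by move=> x _; exact: lsum_le.
Qed.

End layer_sums.

(** * Radon measures *)

Section compact_sets.
Context {X : ptopologicalType}.
Implicit Types (K L U V : set X).

(** Compactness as an induction principle, which hides the finite subcover; [kap_rect] also uses it
    to glue functions along a cover. *)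
Lemma compact_open_ind K (P : set X -> Prop) : compact K -> P set0 ->
  (forall U V, P U -> P V -> P (U `|` V)) ->
  (forall x, K x -> exists U, [/\ open U, U x & P U]) ->
  exists U, [/\ open U, K `<=` U & P U].
Proof.
rewrite compact_cover => cK P0 PU H.
have /choice[f fP] : forall x, exists U, K x -> [/\ open U, U x & P U].
  by move=> x; have [/H[U HU]|nK] := pselect (K x); [exists U|exists set0].
have [|x Kx|D DK KD] := cK X K f; first by move=> x /fP[].
  by exists x => //; have [] := fP x Kx.
exists (cover [set` D] f); split => //.
  by apply: bigcup_open => x /= /DK/set_mem/fP[].
rewrite /cover bigcup_fset big_seq; elim/big_ind : _ => // x xD.
by have /set_mem/fP[] := DK _ xD.
Qed.

Lemma separate_point_compact L x : hausdorff_space X -> compact L -> ~ L x ->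
  exists U V, [/\ open U, open V, U x, L `<=` V & U `&` V = set0].
Proof.
rewrite open_hausdorff => hX cL Lx.
pose P V := exists U, [/\ open U, U x & U `&` V = set0].
have [||y Ly|V [oV LV [U [oU Ux UV]]]] := @compact_open_ind L P cL.
- by exists setT; rewrite setI0; split => //; exact: openT.
- move=> V W [U1 [oU1 U1x U1V]] [U2 [oU2 U2x U2W]].
  exists (U1 `&` U2); split => //; first exact: openI.
  rewrite setIUr -setIA (setIC U2) setIA U1V set0I set0U.
  by rewrite -setIA U2W setI0.
- have xy : x != y by apply: contra_notN Lx => /eqP ->.
  have [[U V]] := hX _ _ xy; move=> /= [/set_mem Ux /set_mem Vy] [oU oV /eqP UV].
  by exists V; split => //; exists U.
by exists U, V.
Qed.

Lemma separate_compact K L : hausdorff_space X -> compact K -> compact L ->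
  K `&` L = set0 ->
  exists U V, [/\ open U, open V, K `<=` U, L `<=` V & U `&` V = set0].
Proof.
move=> hX cK cL KL0.
pose P U := exists V, [/\ open V, L `<=` V & U `&` V = set0].
have [||x Kx|U [oU KU [V [oV LV UV]]]] := @compact_open_ind K P cK.
- by exists setT; rewrite set0I; split => //; exact: openT.
- move=> U1 U2 [V1 [oV1 LV1 UV1]] [V2 [oV2 LV2 UV2]].
  exists (V1 `&` V2); split => //; first exact: openI.
    by move=> y Ly; split; [exact: LV1|exact: LV2].
  rewrite setIUl setIA UV1 set0I set0U.
  by rewrite (setIC V1) setIA UV2 set0I.
- have [Lx|U [V [oU oV Ux LV UV]]] := separate_point_compact hX cL (x := x).
    have : (K `&` L) x by [].
    by rewrite KL0.
  by exists U; split => //; exists V.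
by exists U, V.
Qed.

(** K \ U and K \ V are disjoint compact sets; removing from K disjoint open neighbourhoods of them
    leaves two compact pieces that still cover K. *)
Lemma compact_split K U V : hausdorff_space X -> compact K ->
  open U -> open V -> K `<=` U `|` V ->
  exists K1 K2, [/\ compact K1, compact K2, K1 `<=` U, K2 `<=` V & K = K1 `|` K2].
Proof.
move=> hX cK oU oV KUV.
have cD W : open W -> compact (K `\` W).
  by move=> oW; apply: compact_closedI => //; exact: open_closedC.
have [|G1 [G2 [oO1 oO2 KO1 KO2 O12]]] :=
    separate_compact hX (cD _ oU) (cD _ oV).
  by apply/seteqP; split => // x [[Kx Ux] [_ Vx]]; have [] := KUV x Kx.
exists (K `\` G1), (K `\` G2); split; [exact: cD|exact: cD| | |].
- by move=> x [Kx Ox]; apply: contrapT => Ux; apply: Ox; apply: KO1.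
- by move=> x [Kx Ox]; apply: contrapT => Vx; apply: Ox; apply: KO2.
apply/seteqP; split => [x Kx|x [|] [] //].
have [G1x|] := pselect (G1 x); last by left.
right; split => // G2x.
have : (G1 `&` G2) x by [].
by rewrite O12.
Qed.

Lemma compact_bigcup_open K (U : (set X)^nat) : compact K ->
  (forall n, open (U n)) -> K `<=` \bigcup_n U n ->
  exists N, K `<=` \big[setU/set0]_(n < N) U n.
Proof.
move=> cK oU KU.
pose P V := exists N, V `<=` \big[setU/set0]_(n < N) U n.
have [||x /KU[n _ Unx]|V [oV KV [N VN]]] := @compact_open_ind K P cK.
- by exists 0%N.
- move=> V W [N VN] [M WM]; exists (maxn N M) => x [/VN|/WM].
    by apply: subset_bigsetU; exact: leq_maxl.
  by apply: subset_bigsetU; exact: leq_maxr.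
- exists (U n); split => //; exists n.+1.
  by rewrite big_ord_recr/=; exact: subsetUr.
by exists N; exact: subset_trans VN.
Qed.

End compact_sets.

Section borel_sets.
Context {X : ptopologicalType}.
Implicit Types (A U K : set (borel X)).

Lemma open_bmeasurable U : @open X U -> measurable U.
Proof. by move=> oU; exact: sub_sigma_algebra. Qed.

Lemma closed_bmeasurable A : @closed X A -> measurable A.
Proof.
by move=> cA; rewrite -[A]setCK; apply: measurableC; apply: open_bmeasurable; exact: closed_openC.
Qed.

Lemma compact_bmeasurable K : hausdorff_space X -> @compact X K -> measurable K.
Proof. by move=> hX cK; apply: closed_bmeasurable; exact: compact_closed. Qed.

Lemma lsc_measurable (R : realType) (f : X -> \bar R) :
  lower_semicontinuous f -> measurable_fun [set: borel X] (f : borel X -> \bar R).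
Proof.
move=> /lower_semicontinuousP lf.
apply: (measurability _ (ErealGenOInfty.measurableE R)).
move=> /= _ [_ [r ->]] <-; apply: measurableI => //; apply: open_bmeasurable.
by rewrite preimage_itvoy; exact: lf.
Qed.

End borel_sets.

Lemma lt_adde_split (R : realType) (x y t : \bar R) : (0 <= x)%E -> (0 <= y)%E ->
  (t < x + y)%E ->
  exists s1 s2 : R, [/\ s1%:E < x, s2%:E < y & t <= (s1 + s2)%:E]%E.
Proof.
case: t => [t| |]; last 2 first.
- by move=> ? ?; rewrite ltNge leey.
- move=> x0 y0 _; exists (-1), (-1).
  split; [apply: lt_le_trans x0|apply: lt_le_trans y0|exact: leNye];
  by rewrite lte_fin; lra.
case: x => [x| |//]; case: y => [y| |//]; rewrite ?lee_fin => x0 y0 txy.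
- exists (x - (x + y - t) / 2), (y - (x + y - t) / 2).
  by move: txy; rewrite -EFinD !lte_fin lee_fin => txy; split; lra.
- by exists (x - 1), (t - x + 1); rewrite ltry lte_fin lee_fin; split => //; lra.
- by exists (t - y + 1), (y - 1); rewrite ltry lte_fin lee_fin; split => //; lra.
- by exists t, 0; rewrite !ltry addr0.
Qed.

Lemma gt_adde_split (R : realType) (x y t : \bar R) : (0 <= x)%E -> (0 <= y)%E ->
  (x + y < t)%E ->
  exists s1 s2 : R, [/\ x < s1%:E, y < s2%:E & (s1 + s2)%:E <= t]%E.
Proof.
case: x => [x| |//]; case: y => [y| |//]; rewrite ?lee_fin => x0 y0; last 3 first.
- by rewrite ltNge leey.
- by rewrite ltNge leey.
- by rewrite ltNge leey.
case: t => [t| |//] txy; last first.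
  by exists (x + 1), (y + 1); rewrite leey !lte_fin; split => //; lra.
exists (x + (t - x - y) / 2), (y + (t - x - y) / 2).
by move: txy; rewrite -EFinD !lte_fin lee_fin => txy; split; lra.
Qed.

Section radon_measures.
Context {R : realType} {X : ptopologicalType}.
Implicit Types (m : meas X R) (B K U : set X) (t : \bar R).
Local Open Scope ereal_scope.

Lemma le_bmeasure m A B : bmeasurable A -> bmeasurable B -> A `<=` B -> m A <= m B.
Proof. by move=> mA mB AB; apply: (@le_measure _ _ _ m) => //; exact/mem_set. Qed.

Lemma bmeasureD m A B : bmeasurable A -> bmeasurable B -> B `<=` A ->
  m A < +oo -> m (A `\` B) = m A - m B.
Proof.
by move=> mA mB BA Aoo; rewrite -{2}(setIidr BA); exact: measureD.
Qed.

Lemma le_bmeasureU m A B : bmeasurable A -> bmeasurable B ->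
  m (A `|` B) <= m A + m B.
Proof. by move=> mA mB; exact: measureU2. Qed.

(** Monotonicity gives the other halves of the two regularity identities. *)
Lemma radonI m :
  (forall K, compact K -> m K < +oo) ->
  (forall U t, open U -> t < m U -> exists K, [/\ compact K, K `<=` U & t < m K]) ->
  (forall B t, bmeasurable B -> m B < t ->
     exists U, [/\ open U, B `<=` U & m U <= t]) ->
  hausdorff_space X -> radon m.
Proof.
move=> mK mU mB hX; split => // [U oU|B mmB]; apply/eqP; rewrite eq_le; apply/andP; split.
- rewrite leNgt; apply/negP => /(mU _ _ oU)[K [cK KU]]; apply/negP; rewrite -leNgt.
  by apply: ereal_sup_ubound; exists K.
- apply: ge_ereal_sup => _ [K [cK KU] <-]; apply: le_bmeasure => //.
    exact: compact_bmeasurable.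
  exact: open_bmeasurable.
- apply: le_ereal_inf_tmp => _ [U [oU BU] <-]; apply: le_bmeasure => //.
  exact: open_bmeasurable.
- rewrite leNgt; apply/negP => mBi.
  have [s sB si] : exists2 s, m B < s & s < ereal_inf [set m U | U in [set U | open U /\ B `<=` U]].
    have [r r0 /andP[r1 r2]] := ge0_lt_dense (measure_ge0 m B) mBi.
    by exists r%:E.
  have [U [oU BU Us]] := mB _ _ mmB sB.
  move: si; apply/negP; rewrite -leNgt; apply: le_trans Us.
  by apply: ereal_inf_lbound; exists U.
Qed.

Lemma radon_fin m K : radon m -> compact K -> m K < +oo.
Proof. by case=> + _ _; exact. Qed.

Lemma radon_open m U t : radon m -> open U -> t < m U ->
  exists K, [/\ compact K, K `<=` U & t < m K].
Proof.
move=> [_ + _] oU => ->// /ereal_sup_gt[_ [K [cK KU] <-] tK].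
by exists K.
Qed.

Lemma radon_outer m B t : radon m -> bmeasurable B -> m B < t ->
  exists U, [/\ open U, B `<=` U & m U < t].
Proof.
move=> [_ _ +] mB => ->// /ereal_inf_lt[_ [U [oU BU] <-] tU].
by exists U.
Qed.

(** [radon] grants inner regularity on open sets. Take an open U around B and a compact K in U; the
    excess of U over B fits in a small open V, and K minus V lies in B. *)
Lemma radon_inner m B t : hausdorff_space X -> radon m -> bmeasurable B ->
  m B < +oo -> t < m B -> exists K, [/\ compact K, K `<=` B & t < m K].
Proof.
move=> hX rm mB; have mB0 := measure_ge0 m B.
case: t => [t| |]; last 2 first.
- by move=> _; rewrite ltNge leey.
- by move=> _ _; exists set0; split => //; [exact: compact0|rewrite measure0].
case bE : (m B) mB0 => [b| |//] b0; last by rewrite ltxx.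
move=> _ tb.
(* A third of the gap: the mass of K falls short of that of B by less than [e], and V takes away
   less than [e]. *)
pose e : R := ((b - t) / 3)%R.
have e0 : (0 < e)%R by rewrite divr_gt0 ?subr_gt0.
have eE : (e * 3 = b - t)%R by rewrite /e divfK.
clearbody e.
have [|U [oU BU Ue]] := @radon_outer m B (b + e)%:E rm mB.
  by rewrite bE lte_fin ltrDl.
have mU : bmeasurable U by exact: open_bmeasurable.
have UBe : m (U `\` B) < e%:E.
  rewrite bmeasureD//; last exact: lt_trans Ue (ltry _).
  rewrite bE; case: (m U) Ue => [u| |].
  - by rewrite -EFinB !lte_fin; lra.
  - by rewrite ltNge leey.
  - by move=> _; rewrite addNye ltNyr.
have [|V [oV UBV Ve]] := radon_outer rm _ UBe; first exact: measurableD.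
have [|K [cK KU Ke]] := @radon_open m U (b - e)%:E rm oU.
  apply: (@lt_le_trans _ _ b%:E); first by rewrite lte_fin ltrBlDr ltrDl.
  by rewrite -bE; apply: le_bmeasure.
have mV : bmeasurable V by exact: open_bmeasurable.
have mK : bmeasurable K by exact: compact_bmeasurable.
have mKV : bmeasurable (K `\` V) by exact: measurableD.
exists (K `\` V); split.
- by apply: compact_closedI => //; exact: open_closedC.
- by move=> x [Kx Vx]; apply: contrapT => Bx; apply: Vx; apply: UBV; split => //; exact: KU.
have : m K <= m (K `\` V) + m V.
  apply: le_trans (le_bmeasureU _ mKV mV).
  apply: le_bmeasure => //; first exact: measurableU.
  by move=> x Kx; have [Vx|Vx] := pselect (V x); [right|left].
move=> /(lt_le_trans Ke).
have : m (K `\` V) < +oo.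
  apply: le_lt_trans (radon_fin rm cK); exact: le_bmeasure.
have := measure_ge0 m V; have := measure_ge0 m (K `\` V).
case: (m V) Ve => [v| |]//;
case: (m (K `\` V)) => [k| |]// ve; rewrite -EFinD !lte_fin.
move: ve; rewrite lte_fin => ve k0 v0 _ ?; lra.
Qed.

Lemma radon_mzero : hausdorff_space X -> radon (mzero : meas X R).
Proof.
move=> hX; apply: radonI => // [K _|U t oU t0|B t mB t0]; first exact: ltry.
- by exists set0; split => //; exact: compact0.
- by exists setT; split => //; [exact: openT|exact: (ltW t0)].
Qed.

Lemma eq_radon m1 m2 : (forall B, bmeasurable B -> m1 B = m2 B) ->
  hausdorff_space X -> radon m1 -> radon m2.
Proof.
move=> m12 hX rm; apply: radonI => //.
- by move=> K cK; rewrite -m12 ?radon_fin//; exact: compact_bmeasurable.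
- move=> U t oU; rewrite -m12; last exact: open_bmeasurable.
  move=> /(radon_open rm oU)[K [cK KU tK]]; exists K; split => //.
  by rewrite -m12//; exact: compact_bmeasurable.
- move=> B t mB; rewrite -m12// => /(radon_outer rm mB)[U [oU BU tU]]; exists U; split => //.
  by rewrite -m12 ?ltW//; exact: open_bmeasurable.
Qed.

Definition addm m1 m2 : meas X R := measure_add m1 m2.

Lemma addmE m1 m2 B : addm m1 m2 B = m1 B + m2 B.
Proof. exact: measure_addE. Qed.

Lemma radon_addm m1 m2 : hausdorff_space X -> radon m1 -> radon m2 ->
  radon (addm m1 m2).
Proof.
move=> hX r1 r2; apply: radonI => //.
- by move=> K cK; rewrite addmE lte_add_pinfty// radon_fin.
- move=> U t oU; rewrite addmE => /lt_adde_split[//|//|s1 [s2 [s1U s2U ts]]].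
  have [K1 [cK1 KU1 sK1]] := radon_open r1 oU s1U.
  have [K2 [cK2 KU2 sK2]] := radon_open r2 oU s2U.
  exists (K1 `|` K2); split; [exact: compactU|by rewrite subUset|].
  rewrite addmE; apply: le_lt_trans ts _; rewrite EFinD lteD//.
    apply: lt_le_trans sK1 _; apply: le_bmeasure; last exact: subsetUl.
      exact: compact_bmeasurable.
    by apply: compact_bmeasurable => //; exact: compactU.
  apply: lt_le_trans sK2 _; apply: le_bmeasure; last exact: subsetUr.
    exact: compact_bmeasurable.
  by apply: compact_bmeasurable => //; exact: compactU.
- move=> B t mB; rewrite addmE => /gt_adde_split[//|//|s1 [s2 [s1B s2B ts]]].
  have [U1 [oU1 BU1 sU1]] := radon_outer r1 mB s1B.
  have [U2 [oU2 BU2 sU2]] := radon_outer r2 mB s2B.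
  exists (U1 `&` U2); split; [exact: openI|by rewrite subsetI|].
  rewrite addmE; apply: le_trans ts; rewrite EFinD leeD//.
    apply: le_trans (ltW sU1); apply: measureIl; exact: open_bmeasurable.
  apply: le_trans (ltW sU2); apply: measureIr; exact: open_bmeasurable.
Qed.

Definition scalem (r : {nonneg R}) m : meas X R := mscale r m.

Lemma scalemE r m B : scalem r m B = r%:num%:E * m B.
Proof. by []. Qed.

Lemma radon_scalem r m : hausdorff_space X -> radon m -> radon (scalem r m).
Proof.
move=> hX rm; have [r0|r0] := eqVneq r%:num 0%R.
  apply: (@eq_radon mzero) => //; last exact: radon_mzero.
  by move=> B mB; rewrite scalemE r0 mul0e.
have {}r0 : (0 < r%:num)%R by rewrite lt_neqAle eq_sym r0/=.
apply: radonI => //.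
- by move=> K cK; rewrite scalemE lte_mul_pinfty// ?radon_fin.
- move=> U t oU; rewrite scalemE muleC -lte_pdivrMr// => /(radon_open rm oU)[K [cK KU tK]].
  by exists K; split => //; rewrite scalemE muleC -lte_pdivrMr.
- move=> B t mB; rewrite scalemE muleC -lte_pdivlMr// => /(radon_outer rm mB)[U [oU BU tU]].
  by exists U; split => //; rewrite scalemE muleC -lee_pdivlMr// ltW.
Qed.

End radon_measures.

Section restricted_measures.
Context {R : realType} {X : ptopologicalType}.
Implicit Types (m : meas X R) (B K U : set X) (t : \bar R).
Local Open Scope ereal_scope.

(** Total in [K], so that terms carry no measurability proof; the zero measure for non-Borel [K] is
    a default value. *)
Definition restrm K m : meas X R :=
  match pselect (bmeasurable K) with
  | left mK => mrestr m mK
  | right _ => mzero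
  end.

Lemma restrmE K m B : bmeasurable K -> restrm K m B = m (B `&` K).
Proof. by rewrite /restrm; case: pselect. Qed.

Lemma radon_restrm K m : hausdorff_space X -> compact K -> radon m ->
  radon (restrm K m).
Proof.
move=> hX cK rm; have mK : bmeasurable K by exact: compact_bmeasurable.
have KU U : open U -> bmeasurable (U `&` K).
  by move=> oU; apply: measurableI => //; exact: open_bmeasurable.
apply: radonI => //.
- move=> L cL; rewrite restrmE//; apply: le_lt_trans (radon_fin rm cL).
  have mL : bmeasurable L by exact: compact_bmeasurable.
  by apply: le_bmeasure => //; exact: measurableI.
- move=> U t oU; rewrite restrmE// => tU.
  have [||L [cL LUK tL]] := radon_inner hX rm _ _ tU; first exact: KU.
    by apply: le_lt_trans (radon_fin rm cK); apply: le_bmeasure => //; exact: KU.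
  exists L; split => //; first by move=> x /LUK[].
  rewrite restrmE// (_ : L `&` K = L)//.
  by apply/setIidl => x /LUK[].
- move=> B t mB; rewrite restrmE// => Bt.
  have mBK : bmeasurable (B `&` K) by exact: measurableI.
  have [U [oU BKU Ut]] := radon_outer rm mBK Bt.
  (* The complement of [K] is open and invisible to the restriction; adding it makes the
     neighbourhood cover all of [B]. *)
  have oUK : open (U `|` ~` K).
    by apply: openU => //; apply: closed_openC; exact: compact_closed.
  exists (U `|` ~` K); split => //.
    by move=> x Bx; have [Kx|Kx] := pselect (K x); [left; apply: BKU|right].
  rewrite restrmE//; apply: le_trans (ltW Ut); apply: le_bmeasure.
  + by apply: measurableI => //; exact: open_bmeasurable.
  + exact: open_bmeasurable.
  + by move=> x [[]].
Qed.

Lemma ge0_integral_restrm K m (f : X -> \bar R) : bmeasurable K ->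
  measurable_fun [set: borel X] (f : borel X -> \bar R) -> (forall x, 0 <= f x) ->
  \int[restrm K m]_x f x = \int[m]_(x in K) f x.
Proof.
move=> mK mf f0.
rewrite (@ge0_negligible_integral _ _ _ _ _ (~` K : set (borel X)))//; last 2 first.
- exact: measurableC.
- by rewrite restrmE// setICl measure0.
rewrite setTD setCK; apply: eq_measure_integral => A mA AK.
by rewrite restrmE// (setIidl AK).
Qed.

Definition seriesm (u : nat -> meas X R) : meas X R := mseries u 0.

Lemma seriesmE u B : seriesm u B = \sum_(0 <= k <oo) u k B.
Proof. by []. Qed.

(** Finite partial sums are Radon and the tails have uniformly small mass. Finiteness is asked from
    [n] on, so that finitely many terms may have infinite mass. *)
Lemma radon_seriesm (u : nat -> meas X R) n : hausdorff_space X ->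
  (forall k, radon (u k)) -> \sum_(n <= k <oo) u k setT < +oo ->
  radon (seriesm u).
Proof.
move=> hX ru uoo.
have mE k B : seriesm u B = \sum_(i < k) u i B + \sum_(k <= i <oo) u i B.
  by rewrite seriesmE (nneseries_split 0 k)// add0n big_mkord.
have rsum k : radon (msum u k : meas X R).
  elim: k => [|k IH].
    apply: (@eq_radon _ _ mzero) => //; last exact: radon_mzero.
    by move=> B _; rewrite /= msum_mzero.
  apply: (@eq_radon _ _ (addm (msum u k : meas X R) (u k))) => //.
    by move=> B _; rewrite addmE /= /msum big_ord_recr.
  exact: radon_addm.
have tailT k B : bmeasurable B -> (n <= k)%N -> \sum_(k <= i <oo) u i B <= \sum_(k <= i <oo) u i setT.
  move=> mB nk; apply: lee_nneseries => // i _; apply: le_bmeasure => //; exact: measurableT.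
apply: radonI => //.
- move=> K cK; rewrite (mE n) lte_add_pinfty//.
    by apply/lte_sum_pinfty => i _; exact: radon_fin.
  by apply: le_lt_trans uoo; apply: tailT => //; exact: compact_bmeasurable.
- move=> U t oU; rewrite seriesmE => tU.
  have [k tk] : exists k, t < \sum_(i < k) u i U.
    apply: contrapT => H; move: tU; apply/negP; rewrite -leNgt.
    apply: lime_le; first exact: is_cvg_nneseries.
    apply: nearW => k; rewrite big_mkord leNgt; apply/negP => tk.
    by apply: H; exists k.
  have [K [cK KU tK]] := radon_open (rsum k) oU tk.
  exists K; split => //; rewrite (mE k).
  apply: lt_le_trans tK _; rewrite leeDl// nneseries_ge0//.
- move=> B t mB Bt.
  have Bt0 : seriesm u B + 0 < t by rewrite adde0.
  have [s1 [s2 [Bs1 s20 st]]] :=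
    @gt_adde_split _ (seriesm u B) 0 t (measure_ge0 _ _) (lexx 0) Bt0.
  pose f i := u (i + n)%N setT.
  have foo : \sum_(0 <= i <oo) f i < +oo.
    by rewrite /f (@nneseries_addn _ (fun i => u i setT)).
  have := @nneseries_tail_cvg _ f xpredT foo (fun _ _ => measure_ge0 _ _).
  move=> /fine_cvgP[fin /cvgrPdist_lt /(_ s2)].
  move: s20; rewrite lte_fin => s20 /(_ s20) fs2.
  have [k [nk ks2]] : exists k, (n <= k)%N /\ \sum_(k <= i <oo) u i setT < s2%:E.
    near \oo => N; exists (N + n)%N; split; first exact: leq_addl.
    have -> : \sum_(N + n <= i <oo) u i setT = \sum_(N <= i <oo) f i.
      rewrite -(@nneseries_addn _ (fun i => u i setT))// -[RHS]nneseries_addn//.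
      by apply: eq_eseriesr => i _; rewrite /f addnA.
    have kfin : \sum_(N <= i <oo) f i \is a fin_num by near: N.
    rewrite -(fineK kfin) lte_fin.
    have : (`|0 - fine (\sum_(N <= i <oo) f i)| < s2)%R by near: N.
    by rewrite sub0r normrN ger0_norm// fine_ge0// nneseries_ge0.
  have Bs : (msum u k : meas X R) B < s1%:E.
    by apply: le_lt_trans Bs1; rewrite (mE k) leeDl// nneseries_ge0.
  have [U [oU BU Us1]] := radon_outer (rsum k) mB Bs.
  exists U; split => //; rewrite (mE k); apply: le_trans st.
  rewrite EFinD; apply: leeD; first exact: ltW.
  by apply: le_trans (ltW ks2); apply: tailT => //; exact: open_bmeasurable.
Unshelve. all: by end_near.
Qed.

End restricted_measures.

(** * Potentials and energies *)

Section radon_sums.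
Context {R : realType} {X : ptopologicalType}.
Implicit Types (m mu nu : meas X R).
Local Open Scope ereal_scope.

Lemma lt_sum_compact m e N (U : nat -> set X) t : (0 < e)%R -> radon m ->
  (forall k, open (U k)) -> t < \sum_(k < N) e%:E * m (U k) ->
  exists K : nat -> set X, (forall k, compact (K k) /\ K k `<=` U k) /\
    t < \sum_(k < N) e%:E * m (K k).
Proof.
move=> e0 rm oU; elim: N t => [|N IH] t.
  rewrite big_ord0 => t0; exists (fun=> set0); rewrite big_ord0; split => //.
  by move=> k; split => //; exact: compact0.
rewrite big_ord_recr/= => /lt_adde_split[||s1 [s2 [s1U s2U ts]]].
- by apply: sume_ge0 => k _; rewrite mule_ge0// lee_fin ltW.
- by rewrite mule_ge0// lee_fin ltW.
have [K [KU sK]] := IH _ s1U.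
move: s2U; rewrite muleC -lte_pdivrMr// => s2U.
have [L [cL LU s2L]] := radon_open rm (oU N) s2U.
exists (fun k => if (k < N)%N then K k else if k == N then L else set0); split.
  move=> k; case: ifP => // _; case: eqP => [->//|_].
  by split => //; exact: compact0.
rewrite big_ord_recr/= ltnn eqxx; apply: le_lt_trans ts _.
rewrite EFinD lteD//; last by rewrite muleC -lte_pdivrMr.
apply: lt_le_trans sK _; apply: lee_sum => k _.
by rewrite ltn_ord.
Qed.

(** Layer sums over freely chosen sets: compact subsets of the superlevel sets give compactly
    supported minorants. *)
Definition ksum e N (K : nat -> set X) (y : X) : \bar R :=
  \sum_(k < N) (e * \1_(K k) y)%:E.

Lemma ksum_ge0 e N K y : (0 <= e)%R -> 0 <= ksum e N K y.
Proof. by move=> e0; apply: sume_ge0 => k _; rewrite lee_fin mulr_ge0. Qed.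

Lemma measurable_ksum e N (K : nat -> set (borel X)) : (forall k, measurable (K k)) ->
  measurable_fun [set: borel X] (ksum e N K : borel X -> \bar R).
Proof.
move=> mK; apply: emeasurable_sum => k.
by apply/measurable_EFinP/measurable_funM => //; exact/measurable_indic.
Qed.

Lemma integral_ksum m e N (K : nat -> set X) : (0 <= e)%R ->
  (forall k, bmeasurable (K k)) ->
  \int[m]_x ksum e N K x = \sum_(k < N) e%:E * m (K k).
Proof.
move=> e0 mK; rewrite /ksum ge0_integral_sum//=.
- apply: eq_bigr => k _.
  under eq_integral do rewrite EFinM.
  rewrite ge0_integralZl_EFin//=.
  + by rewrite integral_indic ?setIT//; exact: mK.
  + by apply/measurable_EFinP; apply: measurable_indic; exact: mK.
- by move=> k; apply/measurable_EFinP/measurable_funM => //; apply: measurable_indic; exact: mK.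
- by move=> k x _; rewrite lee_fin mulr_ge0.
Qed.

Lemma ksum_le_lsum e N (K : nat -> set X) (f : borel X -> \bar R) y : (0 <= e)%R ->
  (forall k, (k < N)%N -> K k `<=` level f (e * k.+1%:R)) ->
  ksum e N K y <= lsum e N f y.
Proof.
move=> e0 KU; apply: lee_sum => k _; rewrite lee_fin ler_wpM2l// !indicE.
have [yK|//] := boolP (y \in K k); rewrite mem_set//.
by apply: (KU k (ltn_ord k)); exact/set_mem.
Qed.

End radon_sums.

Section kernel.
Context {R : realType} {X : ptopologicalType}.
Variable kappa : X -> X -> \bar R.
Implicit Types (m mu nu : meas X R).
Local Open Scope ereal_scope.
Hypothesis hX : hausdorff_space X.
Hypothesis k0 : forall x y, 0 <= kappa x y.
Hypothesis klsc : lower_semicontinuous (fun z : X * X => kappa z.1 z.2).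
Hypothesis ksym : forall x y, kappa x y = kappa y x.

Lemma kernel_lsc x : lower_semicontinuous (kappa x).
Proof.
move=> y a /(klsc (x := (x, y)))[V [[A B] /= [Ax By] ABV] Va].
exists B => // z Bz; apply: (Va (x, z)); apply: ABV; split => //=.
exact: nbhs_singleton.
Qed.

Lemma open_level (f : X -> \bar R) e :
  lower_semicontinuous f -> open (level (f : borel X -> \bar R) e : set X).
Proof. by move=> /lower_semicontinuousP; exact. Qed.

Lemma measurable_kernel x : measurable_fun [set: borel X] (kappa x : borel X -> \bar R).
Proof. apply: lsc_measurable; exact: kernel_lsc. Qed.

Lemma kpot_ge0 nu x : 0 <= kpot kappa x nu.
Proof. exact: integral_ge0. Qed.

(** By the tube lemma for the lower semicontinuous kernel, the compact layers of [kappa x] stay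
    below [kappa x'] for all [x'] near [x]. A single function [s] of [y] thus minorizes the kernel
    on a neighbourhood of [x], which yields both [kpot_lsc] and the rectangles of [kap_rect]. *)
Lemma kernel_tube nu x t : radon nu -> t < kpot kappa x nu ->
  exists U L (s : X -> \bar R),
    [/\ open U, U x, compact L, measurable_fun [set: borel X] (s : borel X -> \bar R) &
    [/\ forall y, 0 <= s y, forall y, ~ L y -> s y = 0,
        forall x' y, U x' -> s y <= kappa x' y & t < \int[nu]_y s y]].
Proof.
move=> rnu; rewrite /kpot => /(lt_integral_lsum (measurable_kernel x) (k0 x)).
move=> [e [N [e0]]]; have e0' := ltW e0.
move=> /(lt_sum_compact e0 rnu (U := fun k => level (kappa x : borel X -> \bar R) (e * k.+1%:R)%R)).
move=> [|K [KU tK]]; first by move=> k; apply: open_level; exact: kernel_lsc.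
have mK k : bmeasurable (K k) by apply: compact_bmeasurable => //; have [] := KU k.
have tube : nbhs x (fun x' => forall k : 'I_N, forall y, K k y ->
    (e * k.+1%:R)%:E < kappa x' y).
  apply: filter_forall => k; have [cK KUk] := KU k.
  have /compact_near_coveringP cov := cK.
  apply: (cov X (nbhs x) (fun x' y => (e * k.+1%:R)%:E < kappa x' y)) => y Ky.
  have [V [[A B] /= [Ax By] ABV] Va] := klsc (x := (x, y)) (KUk _ Ky).
  by exists (B, A) => // -[y' x'] [/= By' Ax']; apply: (Va (x', y')); exact: ABV.
move: tube; rewrite nbhsE => -[U [oU Ux] Utube].
exists U, (\big[setU/set0]_(k < N) K k), (ksum e N K); split => //.
- by apply: bigsetU_compact => k _; have [] := KU k.
- exact: measurable_ksum.
split.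
- by move=> y; exact: ksum_ge0.
- move=> y Ly; rewrite /ksum big1// => k _; rewrite indicE memNset ?mulr0// => Ky.
  by apply: Ly; rewrite -bigcup_mkord; exists k => /=.
- move=> x' y /Utube xy; apply: (@le_trans _ _ (lsum e N (kappa x' : borel X -> \bar R) y)).
    apply: ksum_le_lsum => // k kN z Kz; exact: (xy (Ordinal kN)).
  exact: lsum_le.
- by rewrite integral_ksum.
Qed.

Lemma kpot_lsc nu : radon nu -> lower_semicontinuous (fun x => kpot kappa x nu).
Proof.
move=> rnu x a /(kernel_tube rnu)[U [L [s [oU Ux cL ms [s0 _ sk ts]]]]].
exists U; first exact: open_nbhs_nbhs.
move=> y Uy; apply: lt_le_trans ts _; apply: ge0_le_integral => //.
- exact: measurable_kernel.
- by move=> z _; exact: sk.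
Qed.

Lemma measurable_kpot nu : radon nu ->
  measurable_fun [set: borel X] ((fun x => kpot kappa x nu) : borel X -> \bar R).
Proof. by move=> rnu; apply: lsc_measurable; exact: kpot_lsc. Qed.

Lemma kap_ge0 mu nu : 0 <= kap kappa mu nu.
Proof. by apply: integral_ge0 => x _; exact: kpot_ge0. Qed.

Lemma kap_restrm mu nu K : bmeasurable K -> radon nu ->
  kap kappa (restrm K mu) nu = \int[mu]_(x in K) kpot kappa x nu.
Proof.
move=> mK rnu; apply: ge0_integral_restrm => //; first exact: measurable_kpot.
by move=> x; exact: kpot_ge0.
Qed.

Lemma kap_restrm_le mu nu K : bmeasurable K -> radon nu ->
  kap kappa (restrm K mu) nu <= kap kappa mu nu.
Proof.
move=> mK rnu; rewrite kap_restrm//; apply: ge0_subset_integral => //.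
- exact: measurable_kpot.
- by move=> x _; exact: kpot_ge0.
Qed.

Lemma lt_kap_layers mu nu t : radon mu -> radon nu -> t < kap kappa mu nu ->
  exists (e : R) N (K : nat -> set X), [/\ (0 < e)%R, forall k, compact (K k),
    forall k x, K k x -> (e * k.+1%:R)%:E < kpot kappa x nu &
    t < \sum_(k < N) e%:E * mu (K k)].
Proof.
move=> rmu rnu.
move=> /(lt_integral_lsum (measurable_kpot rnu) (kpot_ge0 nu)).
move=> [e [N [e0]]].
move=> /(lt_sum_compact e0 rmu
  (U := fun k => level ((fun x => kpot kappa x nu) : borel X -> \bar R) (e * k.+1%:R)%R)).
move=> [|K [KU tK]]; first by move=> k; apply: open_level; exact: kpot_lsc.
by exists e, N, K; split => // [k|k x]; have [cK kK] := KU k => // /kK.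
Qed.

(** The finitely many compact layers that nearly exhaust the integral lie in one compact set. *)
Lemma lt_kap_restrm mu nu t : radon mu -> radon nu -> t < kap kappa mu nu ->
  exists K, compact K /\ t < kap kappa (restrm K mu) nu.
Proof.
move=> rmu rnu /lt_kap_layers[//|//|e [N [K [e0 cK Kk tK]]]].
have mK k : bmeasurable (K k) by exact: compact_bmeasurable.
exists (\big[setU/set0]_(k < N) K k).
have cKK : compact (\big[setU/set0]_(k < N) K k) by apply: bigsetU_compact => k _.
have mKK : bmeasurable (\big[setU/set0]_(k < N) K k) by exact: compact_bmeasurable.
split => //; apply: lt_le_trans tK _; rewrite kap_restrm//.
rewrite -integral_ksum//; last exact: ltW.
rewrite [leLHS](_ : _ = \int[mu]_(x in \big[setU/set0]_(k < N) K k) ksum e N K x).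
  apply: ge0_le_integral => //.
  - by move=> x _; apply: ksum_ge0; exact: ltW.
  - apply: measurable_funTS; exact: measurable_ksum.
  - apply: measurable_funTS; exact: measurable_kpot.
  - move=> x _; apply: (@le_trans _ _ (lsum e N ((fun x => kpot kappa x nu) : borel X -> \bar R) x)).
      apply: ksum_le_lsum => //; first exact: ltW.
      by move=> k _ z; exact: Kk.
    by apply: lsum_le; [exact: ltW|exact: kpot_ge0].
rewrite [RHS]integral_mkcond; apply: eq_integral => x _; rewrite /patch; case: ifPn => // xK.
rewrite /ksum big1// => k _; rewrite indicE memNset ?mulr0// => Kx.
by move/negP: xK; apply; apply/mem_set; rewrite -bigcup_mkord; exists k => /=.
Qed.

End kernel.

(** * Fubini's theorem for finite sums of products, and symmetry of the mutual energy *)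

Section rectangles.
Context {R : realType} {X : ptopologicalType}.
Implicit Types (m mu nu : meas X R) (F G : X -> X -> \bar R).
Local Open Scope ereal_scope.

(* Radon measures need not be sigma-finite, so Fubini's theorem is only available
   for finite sums of products; kappa is approximated from below by these. *)
Inductive rect : (X -> X -> \bar R) -> Prop :=
| rect0 : rect (fun _ _ => 0)
| rectS (B : set X) (s : X -> \bar R) F : bmeasurable B ->
    measurable_fun [set: borel X] (s : borel X -> \bar R) ->
    (forall y, 0 <= s y) -> rect F ->
    rect (fun x y => (\1_B x)%:E * s y + F x y).

Lemma rect_ge0 F : rect F -> forall x y, 0 <= F x y.
Proof.
elim=> [//|B s G mB ms s0 _ IH] x y.
by rewrite adde_ge0// mule_ge0// lee_fin.
Qed.

Lemma rectD F G : rect F -> rect G -> rect (fun x y => F x y + G x y).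
Proof.
move=> + rG; elim=> [|B s H mB ms s0 _ IH].
  by rewrite (_ : (fun _ _ => _) = G)//; apply/funext => x; apply/funext => y; rewrite add0e.
rewrite (_ : (fun _ _ => _) = fun x y => (\1_B x)%:E * s y + (H x y + G x y)).
  exact: rectS.
by apply/funext => x; apply/funext => y; rewrite addeA.
Qed.

Lemma rect_restrict (D : set X) F : bmeasurable D -> rect F ->
  rect (fun x y => (\1_D x)%:E * F x y).
Proof.
move=> mD; elim=> [|B s H mB ms s0 rH IH].
  rewrite (_ : (fun _ _ => _) = fun _ _ => 0); first exact: rect0.
  by apply/funext => x; apply/funext => y; rewrite mule0.
rewrite (_ : (fun _ _ => _) = fun x y => (\1_(D `&` B) x)%:E * s y + (\1_D x)%:E * H x y).
  by apply: rectS => //; exact: measurableI.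
apply/funext => x; apply/funext => y.
by rewrite indicI /= EFinM -muleA -ge0_muleDr ?mule_ge0 ?lee_fin ?rect_ge0.
Qed.

Lemma rect_measurable_snd F x : rect F ->
  measurable_fun [set: borel X] (F x : borel X -> \bar R).
Proof.
elim=> [|B s H mB ms s0 _ IH]; first exact: measurable_cst.
by apply: emeasurable_funD => //; exact: emeasurable_funM.
Qed.

Lemma rect_measurable_fst F y : rect F ->
  measurable_fun [set: borel X] (F^~ y : borel X -> \bar R).
Proof.
elim=> [|B s H mB ms s0 _ IH]; first exact: measurable_cst.
apply: emeasurable_funD => //; apply: emeasurable_funM => //.
by apply/measurable_EFinP; exact: measurable_indic.
Qed.

Lemma rect_integral_snd nu (B : set X) (s : X -> \bar R) F x : bmeasurable B ->
  measurable_fun [set: borel X] (s : borel X -> \bar R) ->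
  (forall y, 0 <= s y) -> rect F ->
  \int[nu]_y ((\1_B x)%:E * s y + F x y) =
  (\1_B x)%:E * \int[nu]_y s y + \int[nu]_y F x y.
Proof.
move=> mB ms s0 rF; rewrite ge0_integralD//=.
- by rewrite ge0_integralZl// lee_fin.
- by move=> y _; rewrite mule_ge0// lee_fin.
- exact: emeasurable_funM.
- by move=> y _; exact: rect_ge0.
- exact: rect_measurable_snd.
Qed.

Lemma rect_integral_fst mu (B : set X) (s : X -> \bar R) F y : bmeasurable B ->
  measurable_fun [set: borel X] (s : borel X -> \bar R) ->
  (forall y, 0 <= s y) -> rect F ->
  \int[mu]_x ((\1_B x)%:E * s y + F x y) =
  mu B * s y + \int[mu]_x F x y.
Proof.
move=> mB ms s0 rF.
have m1 : measurable_fun [set: borel X] ((fun x => (\1_B x)%:E) : borel X -> \bar R).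
  by apply/measurable_EFinP; exact: measurable_indic.
rewrite ge0_integralD//=.
- by rewrite ge0_integralZr// integral_indic ?setIT//; exact: mB.
- by move=> x _; rewrite mule_ge0// lee_fin.
- exact: emeasurable_funM.
- by move=> x _; exact: rect_ge0.
- exact: rect_measurable_fst.
Qed.

Lemma rect_fubini mu nu F : rect F ->
  [/\ measurable_fun [set: borel X] ((fun x => \int[nu]_y F x y) : borel X -> \bar R),
      measurable_fun [set: borel X] ((fun y => \int[mu]_x F x y) : borel X -> \bar R) &
      \int[mu]_x \int[nu]_y F x y = \int[nu]_y \int[mu]_x F x y].
Proof.
elim=> [|B s H mB ms s0 rH [m1 m2 IH]].
  split; [| |by rewrite !integral0];
  by under eq_fun do rewrite integral0; exact: measurable_cst.
have mI : measurable_fun [set: borel X] ((fun x => (\1_B x)%:E) : borel X -> \bar R).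
  by apply/measurable_EFinP; exact: measurable_indic.
have E1 x := rect_integral_snd nu x mB ms s0 rH.
have E2 y := rect_integral_fst mu y mB ms s0 rH.
rewrite (funext E1) (funext E2); split.
- by apply: emeasurable_funD => //; exact: emeasurable_funM.
- by apply: emeasurable_funD => //; exact: emeasurable_funM.
have I1 x : 0 <= \int[nu]_y H x y by apply: integral_ge0 => y _; exact: rect_ge0.
have I2 y : 0 <= \int[mu]_x H x y by apply: integral_ge0 => x _; exact: rect_ge0.
have Is : 0 <= \int[nu]_y s y by exact: integral_ge0.
rewrite ge0_integralD//; last 2 first.
- by move=> x _; rewrite mule_ge0// lee_fin.
- exact: emeasurable_funM.
rewrite [RHS]ge0_integralD//; last 2 first.
- by move=> y _; rewrite mule_ge0.
- exact: emeasurable_funM.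
rewrite IH; congr (_ + _).
rewrite ge0_integralZr//.
rewrite ge0_integralZl//.
by congr (_ * _); rewrite integral_indic ?setIT//; exact: mB.
Qed.

End rectangles.

Section kernel_symmetry.
Context {R : realType} {X : ptopologicalType}.
Variable kappa : X -> X -> \bar R.
Implicit Types (m mu nu : meas X R).
Local Open Scope ereal_scope.
Hypothesis hX : hausdorff_space X.
Hypothesis k0 : forall x y, 0 <= kappa x y.
Hypothesis klsc : lower_semicontinuous (fun z : X * X => kappa z.1 z.2).
Hypothesis ksym : forall x y, kappa x y = kappa y x.

(** The potential of [nu] is replaced by compact layers [l] in [x]. Around each point [kernel_tube]
    supplies a function of [y] alone whose integral exceeds [l] there, and finitely many such
    products are glued. *)
Lemma kap_rect mu nu t : radon mu -> radon nu -> t < kap kappa mu nu ->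
  exists F, [/\ rect F, forall x y, F x y <= kappa x y &
    t < \int[mu]_x \int[nu]_y F x y].
Proof.
move=> rmu rnu /(lt_kap_layers hX k0 klsc rmu rnu)[e [N [K [e0 cK Kk tK]]]].
have e0' := ltW e0.
have mK k : bmeasurable (K k) by exact: compact_bmeasurable.
pose p : borel X -> \bar R := fun x => kpot kappa x nu.
pose l := ksum e N K.
have ll x : l x <= lsum e N p x by apply: ksum_le_lsum => // k _ z; exact: Kk.
have cKK : compact (\big[setU/set0]_(k < N) K k) by apply: bigsetU_compact => k _.
(* [F] vanishes off [U], so that functions from several sets of the cover can be combined without
   exceeding [kappa]. *)
pose P (U : set X) := open U /\ exists F, [/\ rect F,
  forall x y, ~ U x -> F x y = 0, forall x y, F x y <= kappa x y &
  forall x, U x -> l x <= \int[nu]_y F x y].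
have [||x Kx|U [oU KU [_ [F [rF F0 Fk lF]]]]] := @compact_open_ind X _ P cKK.
- split; first exact: open0.
  by exists (fun _ _ => 0); split => //; exact: rect0.
- move=> U V [oU [F [rF F0 Fk lF]]] [oV [G [rG G0 Gk lG]]].
  split; first exact: openU.
  have mU : bmeasurable (~` U) by apply: measurableC; exact: open_bmeasurable.
  (* Restricting [G] to the complement of [U] separates the two summands: at each [x] the sum is one
     of them. *)
  exists (fun x y => F x y + (\1_(~` U) x)%:E * G x y); split.
  + by apply: rectD => //; exact: rect_restrict.
  + by move=> x y /not_orP[/F0-> /G0->]; rewrite add0e mule0.
  + move=> x y; rewrite indicE; have [Ux|Ux] := pselect (U x).
      by rewrite memNset//= mul0e adde0.
    by rewrite mem_set//= mul1e F0// add0e.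
  + move=> x; have [Ux _|Ux] := pselect (U x).
      have E y : F x y + (\1_(~` U) x)%:E * G x y = F x y.
        by rewrite indicE memNset//= mul0e adde0.
      by rewrite (funext E); exact: lF.
    move=> [//|Vx].
    have E y : F x y + (\1_(~` U) x)%:E * G x y = G x y.
      by rewrite indicE mem_set//= mul1e F0// add0e.
    by rewrite (funext E); exact: lG.
- have px : 0 < p x.
    move: Kx; rewrite -bigcup_mkord => -[k _ /Kk]; apply: le_lt_trans.
    by rewrite lee_fin mulr_ge0.
  have lp : l x < p x by apply: le_lt_trans (ll x) _; exact: lsum_lt.
  have [U [L [s [oU Ux cL ms [s0 _ sk ts]]]]] := kernel_tube hX k0 klsc rnu lp.
  (* Remove the layers that miss [x]: on the remaining neighbourhood [V] no new layer appears, so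
     [l] is at most [l x]. *)
  pose D k := if pselect (K k x) then set0 else K k.
  pose C := \big[setU/set0]_(k < N) D k.
  have cC : compact C.
    by apply: bigsetU_compact => k _; rewrite /D; case: pselect => [?|?] /=; [exact: compact0|exact: cK].
  pose V := U `\` C.
  have oV : open V.
    by apply: openI => //; apply: closed_openC; exact: compact_closed.
  exists V; split => //.
    split => //; rewrite /C -bigcup_mkord => -[k _ /=].
    by rewrite /D; case: pselect.
  split => //; exists (fun x y => (\1_V x)%:E * s y + 0); split.
  + by apply: rectS => //; [exact: open_bmeasurable|exact: rect0].
  + by move=> x' y Vx'; rewrite indicE memNset// mul0e adde0.
  + move=> x' y; rewrite adde0 indicE; have [Vx'|Vx'] := pselect (V x').
      by rewrite mem_set//= mul1e; apply: sk; case: Vx'.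
    by rewrite memNset// mul0e.
  + move=> x' Vx'.
    have E y : (\1_V x')%:E * s y + 0 = s y by rewrite indicE mem_set//= mul1e adde0.
    rewrite (funext E); apply: le_trans (ltW ts); apply: lee_sum => k _.
    rewrite lee_fin ler_wpM2l// !indicE.
    have [Kx'|_] := boolP (x' \in K k); last by case: (_ \in _).
    rewrite mem_set//; apply: contrapT => nKx; case: Vx' => _; apply.
    rewrite /C -bigcup_mkord; exists k => //=.
    by rewrite /D; case: pselect => // ?; exact/set_mem.
exists F; split => //; apply: lt_le_trans tK _.
rewrite -integral_ksum//; have [m1 _ _] := rect_fubini mu nu rF.
apply: ge0_le_integral => //.
- by move=> x _; exact: ksum_ge0.
- exact: measurable_ksum.
- move=> x _; have [Ux|Ux] := pselect (U x); first exact: lF.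
  rewrite /ksum big1.
    by apply: integral_ge0 => y _; exact: rect_ge0.
  move=> k _; rewrite indicE memNset ?mulr0// => Kx.
  by apply: Ux; apply: KU; rewrite -bigcup_mkord; exists k => /=.
Qed.

(** By exchanging the measures one inequality suffices, and it passes through a finite sum of
    products, for which the integrals commute. *)
Lemma kap_sym mu nu : radon mu -> radon nu -> kap kappa mu nu = kap kappa nu mu.
Proof.
suff H m n : radon m -> radon n -> kap kappa m n <= kap kappa n m.
  by move=> rm rn; apply/eqP; rewrite eq_le !H.
move=> rm rn; rewrite leNgt; apply/negP => /(kap_rect rm rn)[F [rF Fk]].
apply/negP; rewrite -leNgt; have [_ m2 ->] := rect_fubini m n rF.
apply: ge0_le_integral => //.
- by move=> y _; apply: integral_ge0 => x _; exact: rect_ge0.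
- exact: measurable_kpot.
- move=> y _; apply: ge0_le_integral => //.
  + by move=> x _; exact: rect_ge0.
  + exact: rect_measurable_fst.
  + exact: measurable_kernel.
  + by move=> x _; rewrite ksym.
Qed.

End kernel_symmetry.

(** * Additivity and finiteness of mutual energies *)

Section energy.
Context {R : realType} {X : ptopologicalType}.
Variables (kappa : X -> X -> \bar R) (h : R).
Implicit Types (m mu nu p q n : meas X R).
Local Open Scope ereal_scope.
Hypothesis hX : hausdorff_space X.
Hypothesis SK : standing_kernel kappa h.

Let k0 x y : 0 <= kappa x y. Proof. by have [+ _ _ _ _] := SK; exact. Qed.
Let klsc : lower_semicontinuous (fun z : X * X => kappa z.1 z.2).
Proof. by have [] := SK. Qed.
Let ksym x y : kappa x y = kappa y x. Proof. by have [_ _ + _ _] := SK; exact. Qed.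

Notation kap := (kap kappa).

Lemma kapC mu nu : radon mu -> radon nu -> kap mu nu = kap nu mu.
Proof. exact: kap_sym. Qed.

Lemma energy_ge0 mu nu : 0 <= kap mu nu.
Proof. exact: kap_ge0. Qed.

Lemma kap_addml m1 m2 nu : radon nu -> kap (addm m1 m2) nu = kap m1 nu + kap m2 nu.
Proof.
move=> rn; apply: ge0_integral_measure_add => //.
  by move=> x _; exact: kpot_ge0.
exact: measurable_kpot.
Qed.

Lemma kap_scaleml r m nu : radon nu -> kap (scalem r m) nu = r%:num%:E * kap m nu.
Proof.
move=> rn; apply: ge0_integral_mscale => //.
  exact: measurable_kpot.
by move=> x _; exact: kpot_ge0.
Qed.

Lemma kap_seriesml (u : nat -> meas X R) nu : radon nu ->
  kap (seriesm u) nu = \sum_(0 <= k <oo) kap (u k) nu.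
Proof.
move=> rn; apply: ge0_integral_measure_series => //.
  by move=> x _; exact: kpot_ge0.
exact: measurable_kpot.
Qed.

Lemma kap0l nu : kap mzero nu = 0.
Proof. exact: integral_measure_zero. Qed.

Lemma kap_addmr m1 m2 nu : radon nu -> radon m1 -> radon m2 ->
  kap nu (addm m1 m2) = kap nu m1 + kap nu m2.
Proof.
move=> rn r1 r2; rewrite kapC ?kap_addml ?(kapC (nu := nu))//.
exact: radon_addm.
Qed.

Lemma kap_scalemr r m nu : radon nu -> radon m ->
  kap nu (scalem r m) = r%:num%:E * kap nu m.
Proof.
move=> rn rm; rewrite kapC ?kap_scaleml ?(kapC (nu := nu))//.
exact: radon_scalem.
Qed.

Lemma kap_restrmr mu nu K : compact K -> radon mu -> radon nu ->
  kap mu (restrm K nu) <= kap mu nu.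
Proof.
move=> cK rm rn; have mK : bmeasurable K by exact: compact_bmeasurable.
rewrite kapC//; last exact: radon_restrm.
by rewrite (kapC rm rn) kap_restrm_le.
Qed.

Lemma kap_restrml mu nu K : compact K -> radon mu -> radon nu ->
  kap (restrm K mu) nu <= kap mu nu.
Proof.
move=> cK rm rn; have mK : bmeasurable K by exact: compact_bmeasurable.
exact: kap_restrm_le.
Qed.

Lemma Eplus_restrm K mu : compact K -> Eplus kappa mu -> Eplus kappa (restrm K mu).
Proof.
move=> cK [rm moo]; split; first exact: radon_restrm.
apply: le_lt_trans moo; apply: le_trans (kap_restrml cK rm rm).
by apply: kap_restrmr => //; exact: radon_restrm.
Qed.

Lemma inE_kap_le p n : Defs.inE kappa p n -> kap p n <= kap p p + kap n n.
Proof.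
move=> pn; have [_ _ _ [spd _ _ _] _] := SK.
have [+ _] := spd p n pn.
have [[rp poo] [rn noo] pnoo] := pn.
have := energy_ge0 p n; have := energy_ge0 p p; have := energy_ge0 n n.
case: (kap p p) poo => [a| |]//; case: (kap n n) noo => [b| |]//;
  case: (kap p n) pnoo => [c| |]//; rewrite ?ltxx//.
by rewrite -EFinM -!EFinD !lee_fin => _ _ _ b0 a0 c0; lra.
Qed.

(** The maximum principle applied to the restriction, whose support lies in [K] and whose potential
    is at most that of [p]. *)
Lemma restrm_kpot_bounded p K (M : R) : radon p -> compact K -> (0 <= M)%R ->
  (forall x, K x -> kpot kappa x p <= M%:E) ->
  forall x, kpot kappa x (restrm K p) <= (h * M)%:E.
Proof.
move=> rp cK M0 KM; have mK : bmeasurable K by exact: compact_bmeasurable.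
have [_ mp] : (1 <= h)%R /\ gen_max_principle kappa h by have [_ _ _ _] := SK.
have sK : Defs.support (restrm K p) `<=` K.
  move=> x xs; apply: contrapT => Kx.
  have oK : open (~` K) by apply: closed_openC; exact: compact_closed.
  by have := xs _ oK Kx; rewrite restrmE// setICl measure0 ltxx.
apply: mp => //; first exact: radon_restrm.
- apply: (subclosed_compact _ cK) => //.
  rewrite -openC openE => x /existsNP[U /not_implyP[oU /not_implyP[Ux U0]]].
  rewrite /interior /= nbhsE; exists U => // y Uy /(_ U oU Uy); exact: U0.
- move=> x /sK Kx; apply: le_trans (KM x Kx).
  rewrite /kpot ge0_integral_restrm//; last exact: measurable_kernel.
  apply: ge0_subset_integral => //.
  exact: measurable_kernel.
Qed.

(* On compact sets where the potential of p is bounded, the maximum principle makes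
   the mutual energies finite, which positive definiteness presupposes. *)
Lemma lt_kap_bounded_kpot p nu t : Eplus kappa p -> radon nu -> t < kap p nu ->
  exists K (M : R), [/\ compact K, (0 <= M)%R, (forall x, K x -> kpot kappa x p <= M%:E) &
    t < kap (restrm K p) nu].
Proof.
move=> [rp poo] rn /(lt_kap_restrm hX k0 klsc rp rn)[K [cK tK]].
have mK : bmeasurable K by exact: compact_bmeasurable.
pose C (j : nat) : set X := K `&` [set x | kpot kappa x p <= j%:R%:E].
have cC j : compact (C j).
  apply: compact_closedI => //.
  rewrite (_ : [set _ | _] = ~` (level ((fun x => kpot kappa x p) : borel X -> \bar R) j%:R)).
    apply: open_closedC; apply: open_level; exact: kpot_lsc.
  by apply/seteqP; split => x /=; rewrite leNgt => /negP.
have mC j : bmeasurable (C j) by exact: compact_bmeasurable.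
have mU := measurable_kpot hX k0 klsc rp.
have mV := measurable_kpot hX k0 klsc rn.
have U0 := kpot_ge0 k0 p; have V0 := kpot_ge0 k0 nu.
pose Z : set (borel X) := [set x | kpot kappa x p = +oo].
have mZ : measurable Z.
  by rewrite -[Z]setTI; exact: (mU measurableT _ (emeasurable_set1 +oo)).
(* Finite energy means that the potential of [p] is [p]-integrable, hence finite [p]-almost
   everywhere; the sets [C j] then exhaust [K] up to a null set. *)
have Z0 : p Z = 0.
  have ip : p.-integrable [set: borel X] (fun x => kpot kappa x p).
    apply/integrableP; split => //.
    by under eq_integral do rewrite gee0_abs//.
  have [N [mN N0 ZN]] := integrable_ae measurableT ip.
  apply: (subset_measure0 mZ mN _ N0) => x Zx; apply: ZN => /=.
  by move=> /(_ Logic.I); rewrite Zx.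
move: tK; rewrite kap_restrm// (@ge0_negligible_integral _ _ _ _ _ Z)//; last first.
  exact: measurable_funTS.
rewrite (_ : K `\` Z = \bigcup_j C j); last first.
  apply/seteqP; split => [x [Kx Zx]|x [j _ [Kx /= jx]]]; last first.
    by split => // Zx; move: jx; rewrite Zx leNgt ltry.
  have : kpot kappa x p < +oo by rewrite ltey; apply/eqP.
  have := U0 x; case E : (kpot kappa x p) => [r| |]// r0 _.
  exists (Num.truncn r).+1 => //; split => //=; rewrite E lee_fin ltW//.
  by have /andP[] := truncn_itv (r0 : (0 <= r)%R).
move=> tC.
have ndC : nondecreasing_seq C.
  move=> i j ij; rewrite subsetEset => x [Kx /= xi]; split => //=.
  by apply: le_trans xi _; rewrite lee_fin ler_nat.
have cv := ge0_nondecreasing_set_cvg_integral ndC mC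
  (fun i => measurable_funTS mV) (fun i x _ => V0 x) (mu := p).
have [j tj] : exists j, t < \int[p]_(x in C j) kpot kappa x nu.
  apply: contrapT => H; move: tC; apply/negP; rewrite -leNgt.
  rewrite -(cvg_lim _ cv)//; apply: lime_le; first by apply/cvg_ex; eexists; exact: cv.
  by apply: nearW => j; rewrite leNgt; apply/negP => tj; apply: H; exists j.
exists (C j), j%:R; split => //; first by move=> x [].
by rewrite kap_restrm.
Qed.

(** Truncate [q] to a compact set, and [p] to a compact set on which its potential is bounded. The
    mutual energy of the truncations is finite, so positive definiteness applies to them, and the
    bound it gives does not depend on the truncations. *)
Lemma Eplus_kap_fin p q : Eplus kappa p -> Eplus kappa q ->
  kap p q < +oo /\ kap p q <= kap p p + kap q q.
Proof.
move=> Ep Eq; have [rp poo] := Ep; have [rq qoo] := Eq.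
suff le : kap p q <= kap p p + kap q q.
  by split => //; apply: le_lt_trans le _; rewrite lte_add_pinfty.
rewrite leNgt; apply/negP; rewrite kapC// => /(lt_kap_restrm hX k0 klsc rq rp)[L [cL]].
have rL := radon_restrm hX cL rq; rewrite kapC// => H.
have [K [M [cK M0 KM]]] := lt_kap_bounded_kpot Ep rL H.
apply/negP; rewrite -leNgt.
have rK := radon_restrm hX cK rp.
have bK := restrm_kpot_bounded rp cK M0 KM.
(* The potential of the truncated [p] is at most [h * M] everywhere, and [q] has finite mass on
   [L]. *)
have fin : kap (restrm K p) (restrm L q) < +oo.
  rewrite kapC//; apply: (@le_lt_trans _ _ (\int[restrm L q]_x (h * M)%:E)).
    apply: ge0_le_integral => //.
    - by move=> x _; exact: kpot_ge0.
    - exact: measurable_kpot.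
    - by move=> x _; exact: bK.
  have mL : bmeasurable L by exact: compact_bmeasurable.
  rewrite integral_cst//.
  rewrite restrmE// setTI lte_mul_pinfty//; last exact: radon_fin.
  by rewrite lee_fin mulr_ge0//; have [_ _ _ _ [h1 _]] := SK; apply: le_trans h1.
have EK := Eplus_restrm cK Ep; have EL := Eplus_restrm cL Eq.
apply: le_trans (inE_kap_le (And3 EK EL fin)) _.
apply: leeD.
  by apply: le_trans (kap_restrmr cK rK rp) (kap_restrml cK rp rp).
by apply: le_trans (kap_restrmr cL rL rq) (kap_restrml cL rq rq).
Qed.

End energy.

(** Two families of inequalities with [t >= 0], because measures can be multiplied by nonnegative
    numbers only; the negative sign comes from exchanging the two parts of a charge. *)
Lemma discriminant_le (R : realType) (a b c : R) : 0 <= a -> 0 <= b ->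
  (forall t, 0 <= t -> 0 <= a + 2 * t * c + t ^+ 2 * b) ->
  (forall t, 0 <= t -> 0 <= a - 2 * t * c + t ^+ 2 * b) -> c ^+ 2 <= a * b.
Proof.
move=> a0 b0 H1 H2.
have [b00|bn0] := eqVneq b 0.
  suff -> : c = 0 by rewrite expr0n/= mulr_ge0.
  have [c0|c0|//] := ltgtP c 0; exfalso.
    have t0 : 0 <= (a + 1) / - c by rewrite divr_ge0 ?addr_ge0// oppr_ge0 ltW.
    have := H1 _ t0; rewrite b00 mulr0 -mulrA.
    have -> : (a + 1) / - c * c = - (a + 1).
      by rewrite invrN mulrN mulNr divfK// lt_eqF.
    lra.
  have t0 : 0 <= (a + 1) / c by rewrite divr_ge0 ?addr_ge0// ltW.
  have := H2 _ t0; rewrite b00 mulr0 -mulrA divfK ?gt_eqF//; lra.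
have b1 : 0 < b by rewrite lt_neqAle eq_sym bn0.
have [c0|c0] := leP 0 c.
  have := H2 (c / b) (divr_ge0 c0 b0).
  have -> : a - 2 * (c / b) * c + (c / b) ^+ 2 * b = (a * b - c ^+ 2) / b by field.
  by rewrite pmulr_lge0 ?invr_gt0// subr_ge0.
have c0' : 0 <= - c / b by rewrite divr_ge0// oppr_ge0 ltW.
have := H1 _ c0'.
have -> : a + 2 * (- c / b) * c + (- c / b) ^+ 2 * b = (a * b - c ^+ 2) / b by field.
by rewrite pmulr_lge0 ?invr_gt0// subr_ge0.
Qed.

(** * The pre-Hilbert structure on differences of positive measures *)

Section energy_form.
Context {R : realType} {X : ptopologicalType}.
Variables (kappa : X -> X -> \bar R) (h : R).
Implicit Types (m mu nu p q n : meas X R).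
Hypothesis hX : hausdorff_space X.
Hypothesis SK : standing_kernel kappa h.

Notation E := (Eplus kappa).

(** Faithful on [Eplus], where [Eplus_kap_fin] excludes the value [+oo], which [fine] sends to 0. *)
Definition en p q : R := fine (kap kappa p q).
Definition sqd p n : R := en p p + en n n - 2 * en p n.
Definition dist p n : R := Num.sqrt (sqd p n).

Lemma enE p q : E p -> E q -> kap kappa p q = (en p q)%:E.
Proof.
move=> Ep Eq; rewrite fineK// ge0_fin_numE.
  by have [] := Eplus_kap_fin hX SK Ep Eq.
exact: (energy_ge0 SK).
Qed.

Lemma en_ge0 p q : 0 <= en p q.
Proof. by apply: fine_ge0; exact: (energy_ge0 SK). Qed.

Lemma enC p q : E p -> E q -> en p q = en q p.
Proof. by move=> [rp _] [rq _]; rewrite /en (kapC hX SK). Qed.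

Lemma Eplus_addm p q : E p -> E q -> E (addm p q).
Proof.
move=> Ep Eq; have [rp pp] := Ep; have [rq qq] := Eq.
have ra := radon_addm hX rp rq; split => //.
rewrite (kap_addml hX SK)// !(kap_addmr hX SK)//.
have [pq _] := Eplus_kap_fin hX SK Ep Eq; have [qp _] := Eplus_kap_fin hX SK Eq Ep.
by apply: lte_add_pinfty; apply: lte_add_pinfty.
Qed.

Lemma Eplus_scalem r p : E p -> E (scalem r p).
Proof.
move=> Ep; have [rp pp] := Ep; have ra := radon_scalem r hX rp; split => //.
rewrite (kap_scaleml hX SK)// (kap_scalemr hX SK)//.
by rewrite enE// -!EFinM ltry.
Qed.

Lemma Eplus_mzero : E mzero.
Proof. by split; [exact: radon_mzero|rewrite kap0l]. Qed.

Lemma en_addl p q n : E p -> E q -> E n -> en (addm p q) n = en p n + en q n.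
Proof.
move=> Ep Eq En; have [rn _] := En.
by rewrite {1}/en (kap_addml hX SK)// !enE.
Qed.

Lemma en_addr p q n : E p -> E q -> E n -> en n (addm p q) = en n p + en n q.
Proof.
move=> Ep Eq En; rewrite enC//; last exact: Eplus_addm.
by rewrite en_addl// (enC Ep En) (enC Eq En).
Qed.

Lemma en_scalel r p n : E p -> E n -> en (scalem r p) n = r%:num * en p n.
Proof.
move=> Ep En; have [rn _] := En.
by rewrite {1}/en (kap_scaleml hX SK)// enE.
Qed.

Lemma en_scaler r p n : E p -> E n -> en n (scalem r p) = r%:num * en n p.
Proof.
move=> Ep En; rewrite enC//; last exact: Eplus_scalem.
by rewrite en_scalel// (enC Ep En).
Qed.

Lemma dist2E p n : E p -> E n -> dist2 kappa p n = (sqd p n)%:E.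
Proof. by move=> Ep En; rewrite /dist2 !enE. Qed.

Lemma sqd_ge0 p n : E p -> E n -> 0 <= sqd p n.
Proof.
move=> Ep En; have [_ _ _ [spd _ _ _] _] := SK.
have [fin _] := Eplus_kap_fin hX SK Ep En.
have [+ _] := spd p n (And3 Ep En fin).
by rewrite -/(dist2 kappa p n) dist2E// lee_fin.
Qed.

Lemma sqd_eq0 p n : E p -> E n -> sqd p n = 0 ->
  forall B, bmeasurable B -> p B = n B.
Proof.
move=> Ep En D0; have [_ _ _ [spd _ _ _] _] := SK.
have [fin _] := Eplus_kap_fin hX SK Ep En.
have [_ +] := spd p n (And3 Ep En fin).
by rewrite -/(dist2 kappa p n) dist2E// D0; exact.
Qed.

Lemma sqdC p n : E p -> E n -> sqd p n = sqd n p.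
Proof. by move=> Ep En; rewrite /sqd (enC Ep En); ring. Qed.

(** The energy form evaluated on the charges p - n and p' - n'. *)
Definition enB p n p' n' : R := en p p' + en n n' - en p n' - en n p'.

Ltac Esolve := repeat (assumption || exact: Eplus_mzero ||
  apply: Eplus_addm || apply: Eplus_scalem).

Lemma sqd_addm p n p' n' : E p -> E n -> E p' -> E n' ->
  sqd (addm p p') (addm n n') = sqd p n + sqd p' n' + 2 * enB p n p' n'.
Proof.
move=> Ep En Ep' En'; rewrite /sqd /enB !(en_addl, en_addr); Esolve.
rewrite (enC Ep' Ep) (enC En' En) (enC Ep' En); ring.
Qed.

Lemma sqd_scalem r p n : E p -> E n ->
  sqd (scalem r p) (scalem r n) = r%:num ^+ 2 * sqd p n.
Proof.
move=> Ep En; rewrite /sqd !(en_scalel, en_scaler); Esolve; ring.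
Qed.

Lemma enB_scalem r p n p' n' : E p -> E n -> E p' -> E n' ->
  enB p n (scalem r p') (scalem r n') = r%:num * enB p n p' n'.
Proof.
move=> Ep En Ep' En'; rewrite /enB !en_scaler; Esolve; ring.
Qed.

Lemma enB_swap p n p' n' : enB p n n' p' = - enB p n p' n'.
Proof. rewrite /enB; ring. Qed.

Lemma cauchy_schwarz p n p' n' : E p -> E n -> E p' -> E n' ->
  enB p n p' n' ^+ 2 <= sqd p n * sqd p' n'.
Proof.
move=> Ep En Ep' En'; apply: discriminant_le; rewrite ?sqd_ge0// => t t0;
  pose r := NngNum t0.
- have := @sqd_ge0 (addm p (scalem r p')) (addm n (scalem r n')).
  rewrite sqd_addm ?sqd_scalem ?enB_scalem; Esolve => /=.
  by rewrite addrAC mulrA; apply; Esolve.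
- have := @sqd_ge0 (addm p (scalem r n')) (addm n (scalem r p')).
  rewrite sqd_addm ?sqd_scalem ?enB_scalem; Esolve => /=.
  by rewrite addrAC enB_swap mulrN mulrN mulrA (sqdC En' Ep'); apply; Esolve.
Qed.

Lemma dist_triangle p q n : E p -> E q -> E n -> dist p n <= dist p q + dist q n.
Proof.
move=> Ep Eq En.
have s1 := sqd_ge0 Ep Eq; have s2 := sqd_ge0 Eq En.
rewrite -(@ler_pXn2r _ 2)// ?nnegrE ?addr_ge0 ?sqrtr_ge0//.
rewrite sqrrD !sqr_sqrtr ?sqd_ge0//.
have -> : sqd p n = sqd p q + sqd q n + 2 * enB p q q n.
  rewrite /sqd /enB (enC Eq En) ; ring.
have CS : enB p q q n <= Num.sqrt (sqd p q) * Num.sqrt (sqd q n).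
  rewrite -sqrtrM//; apply: le_trans (ler_norm _) _.
  by rewrite -sqrtr_sqr ler_wsqrtr//; exact: cauchy_schwarz.
move: CS; set u := _ * _ => CS; rewrite mulr2n; lra.
Qed.

Lemma distC p n : E p -> E n -> dist p n = dist n p.
Proof. by move=> Ep En; rewrite /dist sqdC. Qed.

Lemma dist_addl p n q : E p -> E n -> E q -> dist (addm p q) (addm n q) = dist p n.
Proof.
move=> Ep En Eq; rewrite /dist sqd_addm//; congr Num.sqrt.
rewrite /sqd /enB; ring.
Qed.

(** Charges are pairs of positive measures, so subtracting a charge means adding the exchanged
    pair. *)
Lemma parallelogram p n p' n' : E p -> E n -> E p' -> E n' ->
  sqd (addm p p') (addm n n') + sqd (addm p n') (addm n p') =
  2 * sqd p n + 2 * sqd p' n'.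
Proof.
move=> Ep En Ep' En'; rewrite !sqd_addm// enB_swap (sqdC En' Ep'); ring.
Qed.

End energy_form.

(** * Weak limits *)

Section content_measure.
Context {R : realType} {X : ptopologicalType}.
Variable (hX : hausdorff_space X).
Implicit Types (K L U V : set X).
Local Open Scope ereal_scope.

(** Properties of measures on compact sets that survive pointwise limits. Such a limit need not be
    regular; regularity is restored by going through open sets. *)
Definition compact_content (c : set X -> R) :=
  [/\ forall K, (0 <= c K)%R, c set0 = 0%R,
      forall K L, compact K -> compact L -> K `<=` L -> (c K <= c L)%R,
      forall K L, compact K -> compact L -> (c (K `|` L) <= c K + c L)%R &
      forall K L, compact K -> compact L -> K `&` L = set0 ->
        (c K + c L <= c (K `|` L))%R].

Variables (c : set X -> R) (M : R).
Hypothesis cc : compact_content c.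
Hypothesis cM : forall K, compact K -> (c K <= M)%R.

Definition inner_content U : \bar R :=
  ereal_sup [set (c K)%:E | K in [set K | compact K /\ K `<=` U]].

Definition outer_content (B : set X) : \bar R :=
  ereal_inf [set inner_content U | U in [set U | open U /\ B `<=` U]].

Let ic := inner_content.
Let oc := outer_content.

Let ic_ge K U : compact K -> K `<=` U -> (c K)%:E <= ic U.
Proof. by move=> cK KU; apply: ereal_sup_ubound; exists K. Qed.

Let ic_ge0 U : 0 <= ic U.
Proof.
apply: le_trans (ic_ge compact0 (@sub0set _ U)).
by have [_ -> _ _ _] := cc.
Qed.

Let ic_lt U t : t < ic U -> exists K, [/\ compact K, K `<=` U & t < (c K)%:E].
Proof. by move=> /ereal_sup_gt[_ [K [cK KU] <-] tK]; exists K. Qed.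

Let ic_mono U V : U `<=` V -> ic U <= ic V.
Proof.
move=> UV; apply: ge_ereal_sup => _ [K [cK KU] <-].
by apply: ic_ge => //; exact: subset_trans UV.
Qed.

Let icU U V : open U -> open V -> ic (U `|` V) <= ic U + ic V.
Proof.
move=> oU oV; apply: ge_ereal_sup => _ [K [cK KUV] <-].
have [K1 [K2 [cK1 cK2 KU KV ->]]] := compact_split hX cK oU oV KUV.
have [_ _ _ cU _] := cc.
apply: (@le_trans _ _ (c K1 + c K2)%:E); first by rewrite lee_fin cU.
by rewrite EFinD leeD// ic_ge.
Qed.

(** A compact set in a countable union already lies in finitely many of the open sets, so finite
    subadditivity is enough. *)
Let ic_bigU (U : nat -> set X) : (forall n, open (U n)) ->
  ic (\bigcup_n U n) <= \sum_(i <oo) ic (U i).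
Proof.
move=> oU; apply: ge_ereal_sup => _ [K [cK KU] <-].
have [N KN] := compact_bigcup_open cK oU KU.
apply: (@le_trans _ _ (\sum_(i < N) ic (U i))).
  apply: le_trans (ic_ge cK KN) _; elim: N {KN} => [|N IH].
    rewrite !big_ord0; apply: ge_ereal_sup => _ [L [cL L0] <-].
    have -> : L = set0 by apply/seteqP; split => // x /L0.
    by have [_ -> _ _ _] := cc.
  rewrite !big_ord_recr/=; apply: le_trans (icU _ (oU N)) _.
    by rewrite -bigcup_mkord; apply: bigcup_open => i _.
  exact: leeD.
rewrite -(big_mkord xpredT (fun i => ic (U i))); apply: nneseries_lim_ge => n _ _.
exact: ic_ge0.
Qed.

Let oc_ge0 B : 0 <= oc B.
Proof. by apply: le_ereal_inf_tmp => _ [U _ <-]; exact: ic_ge0. Qed.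

Let oc_mono : {homo oc : A B / A `<=` B >-> A <= B}.
Proof.
move=> A B AB; apply: le_ereal_inf_tmp => _ [U [oU BU] <-].
by apply: ereal_inf_lbound; exists U => //; split => //; exact: subset_trans BU.
Qed.

Let oc_open U : open U -> oc U = ic U.
Proof.
move=> oU; apply/eqP; rewrite eq_le; apply/andP; split.
  by apply: ereal_inf_lbound; exists U => //; split.
by apply: le_ereal_inf_tmp => _ [V [oV UV] <-]; exact: ic_mono.
Qed.

Let oc0 : oc set0 = 0.
Proof.
rewrite oc_open; last exact: open0.
apply/eqP; rewrite eq_le ic_ge0 andbT; apply: ge_ereal_sup => _ [L [cL L0] <-].
have -> : L = set0 by apply/seteqP; split => // x /L0.
by have [_ -> _ _ _] := cc.
Qed.

Let oc_sigma_subadditive : sigma_subadditive oc.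
Proof.
move=> F; have [Foo|Foo] := eqVneq (\sum_(i <oo) oc (F i)) +oo; first by rewrite Foo leey.
have Ffin i : oc (F i) \is a fin_num.
  rewrite ge0_fin_numE// ltey; apply: contra_neq Foo => Fi.
  by apply: (@nneseries_pinfty _ _ xpredT i).
apply/lee_addgt0Pr => e e0.
have /choice[U HU] : forall i, exists U, [/\ open U, F i `<=` U & ic U <= oc (F i) + (e / (2 ^ i.+1)%:R)%:E].
  move=> i; have : oc (F i) < oc (F i) + (e / (2 ^ i.+1)%:R)%:E.
    by rewrite lteDl// lte_fin divr_gt0// ltr0n expn_gt0.
  by move=> /ereal_inf_lt[_ [U [oU FU] <-] /ltW tU]; exists U.
apply: (@le_trans _ _ (oc (\bigcup_i U i))).
  by apply: oc_mono; apply: subset_bigcup => i _; have [] := HU i.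
rewrite oc_open; last by apply: bigcup_open => i _; have [] := HU i.
apply: le_trans (ic_bigU _) _; first by move=> i; have [] := HU i.
apply: le_trans (epsilon_trick xpredT _ (ltW e0)) => //.
by apply: lee_nneseries => // i _; have [] := HU i.
Qed.

HB.instance Definition _ := isOuterMeasure.Build R X outer_content
  oc0 oc_ge0 oc_mono oc_sigma_subadditive.

(** Exhaust the part of V in U by a compact K first, then V minus K, which contains V minus U, by a
    compact L. The two are disjoint, and the content is superadditive on them. *)
Let caratheodory_open U : open U -> caratheodory_measurable outer_content U.
Proof.
move=> oU; apply: le_caratheodory_measurable => B.
apply: le_ereal_inf_tmp => _ [V [oV BV] <-].
apply: (@le_trans _ _ (oc (V `&` U) + oc (V `&` ~` U))).
  by apply: leeD; apply: oc_mono; apply: setSI.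
rewrite oc_open; last exact: openI.
rewrite leNgt; apply/negP => /lt_adde_split[//|//|s1 [s2 [s1U s2U ts]]].
have [K [cK KVU sK]] := ic_lt s1U.
have oVK : open (V `\` K).
  by apply: openI => //; apply: closed_openC; exact: compact_closed.
have : s2%:E < ic (V `\` K).
  apply: lt_le_trans s2U _; rewrite -oc_open//; apply: oc_mono => x [Vx Ux].
  by split => // /KVU[].
move=> /ic_lt[L [cL LVK sL]].
have [_ _ _ _ cD] := cc.
have KL0 : K `&` L = set0 by apply/seteqP; split => // x [Kx /LVK[]].
move: ts; apply/negP; rewrite -ltNge.
apply: (@lt_le_trans _ _ (c K + c L)%:E).
  by rewrite lte_fin ltrD.
apply: (@le_trans _ _ (c (K `|` L))%:E); first by rewrite lee_fin cD.
apply: ic_ge; first exact: compactU.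
by move=> x [/KVU[]|/LVK[]].
Qed.

Let borel_caratheodory (B : set (borel X)) :
  measurable B -> caratheodory_measurable outer_content B.
Proof.
move=> mB.
have sub : <<s @open X >> `<=` (@measurable _ (caratheodory_type outer_content) : set (set X)).
  apply: smallest_sub; last by move=> U; exact: caratheodory_open.
  exact: sigma_algebra_measurable.
exact: sub.
Qed.

Let mc0 : (outer_content : set (borel X) -> \bar R) set0 = 0. Proof. exact: oc0. Qed.
Let mc_ge0 (B : set (borel X)) : 0 <= (outer_content : set (borel X) -> \bar R) B.
Proof. exact: oc_ge0. Qed.
Let mc_sigma : semi_sigma_additive (outer_content : set (borel X) -> \bar R).
Proof.
move=> F mF tF mUF.
exact: (@caratheodory_measure_sigma_additive R X outer_content F
  (fun i => borel_caratheodory (mF i)) tF (borel_caratheodory mUF)).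
Qed.

(** The proofs are arguments so that the term records the hypotheses under which the outer content
    is a measure, and the instance survives the section. *)
Definition content_measure of hausdorff_space X & compact_content c :
  set (borel X) -> \bar R := outer_content.

HB.instance Definition _ := isMeasure.Build _ _ _ (content_measure hX cc) mc0 mc_ge0 mc_sigma.

Lemma content_measure_open U : open U -> content_measure hX cc U = inner_content U.
Proof. exact: oc_open. Qed.

(** In general not an equality, since the measure also counts content that sits in every
    neighbourhood of [K]. This direction is the one that upper semicontinuity on compact sets
    needs. *)
Lemma content_measure_compact K : compact K -> (c K)%:E <= content_measure hX cc K.
Proof.
move=> cK; apply: le_ereal_inf_tmp => _ [U [oU KU] <-]; exact: ic_ge.
Qed.

Lemma radon_content_measure : radon (content_measure hX cc : meas X R).
Proof.
apply: radonI => //.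
- move=> K cK; apply: (@le_lt_trans _ _ M%:E); last exact: ltry.
  apply: (@le_trans _ _ (oc setT)); first exact: oc_mono.
  rewrite oc_open; last exact: openT.
  by apply: ge_ereal_sup => _ [L [cL _] <-]; rewrite lee_fin cM.
- move=> U t oU; rewrite -[X in t < X]/(content_measure hX cc U).
  rewrite content_measure_open// => /ic_lt[K [cK KU tK]].
  by exists K; split => //; apply: lt_le_trans tK _; exact: content_measure_compact.
- move=> B t mB /ereal_inf_lt[_ [U [oU BU] <-] tU]; exists U; split => //.
  by rewrite -[leLHS]/(content_measure hX cc U) content_measure_open// ltW.
Qed.

End content_measure.

(** * Weak limits along filters and vague compactness *)

Lemma ultra_cvg_bounded (R : realType) (T : Type) (F : set_system T) (f : T -> R) (M : R) :
  UltraFilter F -> (forall t, 0 <= f t <= M) -> cvg (f t @[t --> F]).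
Proof.
move=> FU fM; have PF : ProperFilter F by exact: ultra_proper.
have : compact `[0, M]%classic by exact: segment_compact.
move=> /(_ (f @ F) _)[|p [_ pF]].
  by rewrite /fmap /=; apply: filterE => t; rewrite /= in_itv/=; exact: fM.
apply/cvg_ex; exists p => A pA.
have [//|FA] := in_ultra_setVsetC (f @^-1` A) FU.
have [q [/= qA Aq]] : (~` A) `&` A !=set0 by exact: pF.
by [].
Qed.

Lemma ler_filter_limit (R : realType) (T : Type) (F : set_system T)
    {PF : ProperFilter F} (f g : T -> R) (l l' : R) :
  f t @[t --> F] --> l -> g t @[t --> F] --> l' -> (forall t, f t <= g t) -> l <= l'.
Proof.
move=> fl gl fg; rewrite -subr_ge0; apply: cvgr_to_ge (cvgB gl fl) _.
by apply: nearW => t; rewrite subr_ge0.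
Qed.

Section weak_limits.
Context {R : realType} {X : ptopologicalType} {T : Type}.
Implicit Types (F : set_system T) (mu : T -> meas X R) (nu : meas X R).
Local Open Scope ereal_scope.

(** Vague convergence in portmanteau form: upper semicontinuous on compact sets, lower
    semicontinuous on open sets. It applies directly to layer sums and lets mass escape to
    infinity. *)
Definition weak_limit F mu nu :=
  (forall K (r : R), compact K -> nu K < r%:E -> \forall t \near F, mu t K < r%:E) /\
  (forall U (r : R), open U -> r%:E < nu U -> \forall t \near F, r%:E < mu t U).

(** Along an ultrafilter the bounded numbers [mu t K] converge for all compact [K] at once; their
    limits form a content, and its measure is the weak limit. *)
Lemma ultra_weak_limit F mu (M : R) : hausdorff_space X -> UltraFilter F ->
  (forall t, mu t setT <= M%:E) ->
  exists nu, [/\ radon nu, nu setT <= M%:E & weak_limit F mu nu].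
Proof.
move=> hX FU muM; have PF : ProperFilter F by exact: ultra_proper.
have mC (K : set X) : compact K -> bmeasurable K by exact: compact_bmeasurable.
have mMB t (B : set X) : bmeasurable B -> mu t B <= M%:E.
  by move=> mB; apply: le_trans (muM t); apply: le_bmeasure => //; exact: measurableT.
have fE t (B : set X) : bmeasurable B -> mu t B = (fine (mu t B))%:E.
  move=> mB; rewrite fineK// ge0_fin_numE//.
  by apply: le_lt_trans (mMB t B mB) _; exact: ltry.
have fM t (B : set X) : bmeasurable B -> (0 <= fine (mu t B) <= M)%R.
  by move=> mB; rewrite fine_ge0//= -lee_fin -fE// mMB.
pose c (K : set X) : R := if pselect (compact K) then lim (fine (mu t K) @[t --> F]) else 0%R.
have cE (K : set X) : compact K -> fine (mu t K) @[t --> F] --> c K.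
  move=> cK; rewrite /c; case: pselect => // ?.
  by apply: ultra_cvg_bounded FU _ => t; apply: fM; exact: mC.
have cM (K : set X) : compact K -> (c K <= M)%R.
  move=> cK; apply: cvgr_to_le (cE K cK) _; apply: nearW => t.
  by have /andP[] := fM t K (mC K cK).
have cc : compact_content c.
  split.
  - move=> K; have [cK|nK] := pselect (compact K); last by rewrite /c; case: pselect.
    apply: cvgr_to_ge (cE K cK) _; apply: nearW => t.
    by have /andP[] := fM t K (mC K cK).
  - apply: cvg_unique (cE set0 compact0) _ => //.
    have -> : (fun t => fine (mu t set0)) = cst 0%R.
      by apply/funext => t /=; rewrite (_ : mu t set0 = 0)//; exact: measure0.
    exact: cvg_cst.
  - move=> K L cK cL KL; apply: (ler_filter_limit (cE K cK) (cE L cL)).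
    move=> t; rewrite -lee_fin -!fE; [|exact: mC|exact: mC].
    by apply: le_bmeasure => //; exact: mC.
  - move=> K L cK cL; have mK := mC K cK; have mL := mC L cL.
    have mKL := mC _ (compactU cK cL).
    apply: (ler_filter_limit (cE _ (compactU cK cL)) (cvgD (cE K cK) (cE L cL))) => t.
    rewrite -lee_fin EFinD -!fE//; exact: le_bmeasureU.
  - move=> K L cK cL KL0; have mK := mC K cK; have mL := mC L cL.
    have mKL := mC _ (compactU cK cL).
    apply: (ler_filter_limit (cvgD (cE K cK) (cE L cL)) (cE _ (compactU cK cL))) => t.
    rewrite -lee_fin EFinD -!fE// le_eqVlt; apply/orP; left; apply/eqP/esym.
    exact: measureU.
exists (content_measure hX cc : meas X R); split.
- exact: radon_content_measure cM.
- rewrite -[leLHS]/(content_measure hX cc setT) content_measure_open; last exact: openT.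
  by apply: ge_ereal_sup => _ [K [cK _] <-]; rewrite lee_fin cM.
- split => [K r cK nK|U r oU].
    have : (c K < r)%R.
      by rewrite -lte_fin; apply: le_lt_trans nK; exact: content_measure_compact.
    move=> /(cvgr_lt _ (cE K cK)); apply: filterS => t.
    by rewrite -lte_fin -fE//; exact: mC.
  rewrite -[X in _ < X]/(content_measure hX cc U) content_measure_open//.
  move=> /ereal_sup_gt[_ [K [cK KU] <-]]; rewrite lte_fin => rK.
  move: rK => /(cvgr_gt _ (cE K cK)); apply: filterS => t.
  rewrite -lte_fin -fE; last exact: mC.
  move=> /lt_le_trans; apply; apply: le_bmeasure => //; first exact: mC.
  exact: open_bmeasurable.
Qed.

Variable F : set_system T.
Context {FF : ProperFilter F}.
Variables (mu : T -> meas X R) (nu : meas X R) (M : R).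
Hypothesis wl : weak_limit F mu nu.
Hypothesis muM : forall t, mu t setT <= M%:E.
Hypothesis nuM : nu setT <= M%:E.
Hypothesis hX : hausdorff_space X.

Lemma weak_limit_sum_open e N (U : nat -> set X) (s : \bar R) : (0 < e)%R ->
  (forall k, open (U k)) -> s < \sum_(k < N) e%:E * nu (U k) ->
  \forall t \near F, s < \sum_(k < N) e%:E * mu t (U k).
Proof.
move=> e0 oU; elim: N s => [|N IH] s.
  by rewrite big_ord0 => s0; apply: nearW => t; rewrite big_ord0.
rewrite big_ord_recr/= => /lt_adde_split[||s1 [s2 [s1U s2U ts]]].
- by apply: sume_ge0 => k _; rewrite mule_ge0// lee_fin ltW.
- by rewrite mule_ge0// lee_fin ltW.
move: s2U; rewrite muleC -lte_pdivrMr// -EFinM => s2U.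
apply: filterS2 (IH _ s1U) (wl.2 _ _ (oU N) s2U) => t t1 t2.
rewrite big_ord_recr/=; apply: le_lt_trans ts _; rewrite EFinD lteD//.
by rewrite muleC -lte_pdivrMr// -EFinM.
Qed.

Lemma weak_limit_lsc (f : X -> \bar R) (s : \bar R) :
  lower_semicontinuous f -> (forall x, 0 <= f x) -> s < \int[nu]_x f x ->
  \forall t \near F, s < \int[mu t]_x f x.
Proof.
move=> lf f0; have mf := lsc_measurable lf.
move=> /(lt_integral_lsum mf f0)[e [N [e0 sN]]].
have oU k : open (level (f : borel X -> \bar R) (e * k.+1%:R) : set X) by exact: open_level.
apply: filterS (weak_limit_sum_open e0 oU sN) => t /lt_le_trans; apply.
by apply: lsum_integral_le => //; exact: ltW.
Qed.

Lemma weak_limit_sum_compact e N (K : nat -> set X) (s : \bar R) : (0 < e)%R ->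
  (forall k, compact (K k)) -> \sum_(k < N) e%:E * nu (K k) < s ->
  \forall t \near F, \sum_(k < N) e%:E * mu t (K k) < s.
Proof.
move=> e0 cK; elim: N s => [|N IH] s.
  by rewrite big_ord0 => s0; apply: nearW => t; rewrite big_ord0.
rewrite big_ord_recr/= => /gt_adde_split[||s1 [s2 [s1U s2U ts]]].
- by apply: sume_ge0 => k _; rewrite mule_ge0// lee_fin ltW.
- by rewrite mule_ge0// lee_fin ltW.
move: s2U; rewrite muleC -lte_pdivlMr// -EFinM => s2U.
apply: filterS2 (IH _ s1U) (wl.1 _ _ (cK N) s2U) => t t1 t2.
rewrite big_ord_recr/=; apply: lt_le_trans _ ts; rewrite EFinD lteD//.
by rewrite muleC -lte_pdivlMr// -EFinM.
Qed.

(** With closed levels the layer sum is [f] rounded down to a multiple of [e], provided the [N]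
    layers reach above [f]. *)
Lemma ksum_level (f : X -> R) e N x : (0 < e)%R -> (0 <= f x < e * N%:R)%R ->
  ksum e N (fun k => [set y | (e * k.+1%:R <= f y)%R]) x <= (f x)%:E /\
  (f x)%:E <= e%:E + ksum e N (fun k => [set y | (e * k.+1%:R <= f y)%R]) x.
Proof.
move=> e0 /andP[f0 fN].
pose n := Num.truncn (f x / e).
have /andP[n1 n2] : (n%:R <= f x / e < n.+1%:R)%R by apply: truncn_itv; rewrite divr_ge0// ltW.
move: n1 n2; rewrite ler_pdivlMr// ltr_pdivrMr// => n1 n2.
have nN : (n <= N)%N.
  by rewrite -(ler_nat R) -(ler_pM2r e0); apply: le_trans n1 _; rewrite mulrC ltW.
have -> : ksum e N (fun k => [set y | (e * k.+1%:R <= f y)%R]) x = (e * n%:R)%:E.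
  rewrite /ksum sumEFin; congr EFin.
  rewrite (bigID (fun k : 'I_N => (k < n)%N))/= [X in (_ + X)%R]big1 ?addr0; last first.
    move=> k; rewrite -leqNgt => nk; rewrite indicE memNset ?mulr0//=.
    apply/negP; rewrite -ltNge; apply: lt_le_trans n2 _; rewrite mulrC ler_pM2l//.
    by rewrite ler_nat.
  rewrite (eq_bigr (fun=> e)); last first.
    move=> k kn; rewrite indicE mem_set ?mulr1//=; apply: le_trans n1.
    by rewrite mulrC ler_pM2r// ler_nat.
  rewrite -(big_ord_widen_cond N xpredT (fun=> e))//.
  by rewrite sumr_const card_ord mulr_natr.
rewrite -EFinD !lee_fin; split; first by rewrite mulrC.
by apply: ltW; move: n2; rewrite -natr1 mulrDl mul1r addrC mulrC.
Qed.

(** Superlevel sets at positive height are compact, so the upper half of weak convergence applies to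
    each layer; rounding costs at most one step times the mass. *)
Lemma weak_limit_usc (f : X -> R) (B e : R) : (forall x, (0 <= f x <= B)%R) ->
  (forall r, (0 < r)%R -> compact [set x | (r <= f x)%R]) -> (0 < e)%R ->
  \forall t \near F, \int[mu t]_x (f x)%:E <= \int[nu]_x (f x)%:E + e%:E.
Proof.
move=> fB cf e0.
have M0 : (0 <= M)%R by rewrite -lee_fin; apply: le_trans nuM.
(* Rounding by [d] costs at most [d * M <= e / 2]; [M + 1] avoids a zero denominator. *)
pose d := (e / (2 * (M + 1)))%R.
have d0 : (0 < d)%R by rewrite divr_gt0// mulr_gt0// ltr_wpDl.
pose N := (Num.truncn (B / d)).+1.
have fN x : (0 <= f x < d * N%:R)%R.
  have /andP[-> fxB] := fB x; apply: le_lt_trans fxB _.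
  have B0 : (0 <= B)%R by have /andP[] := fB point; exact: le_trans.
  have /andP[_] := truncn_itv (divr_ge0 B0 (ltW d0)).
  by rewrite ltr_pdivrMr// mulrC.
pose K k : set X := [set y | (d * k.+1%:R <= f y)%R].
have cK k : compact (K k) by apply: cf; rewrite mulr_gt0.
have mK k : bmeasurable (K k) by exact: compact_bmeasurable.
have mf : measurable_fun [set: borel X] (f : borel X -> R).
  apply: (measurability _ (RGenCInfty.measurableE R)).
  move=> /= _ [_ [r ->]] <-; rewrite setTI.
  have [r0|r0] := ltP 0%R r.
    apply: compact_bmeasurable => //.
    rewrite (_ : _ @^-1` _ = [set x | (r <= f x)%R]); first exact: cf.
    by apply/seteqP; split => x /=; rewrite in_itv/= andbT.
  rewrite (_ : _ @^-1` _ = setT) //.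
  apply/seteqP; split => x //= _; rewrite in_itv/= andbT.
  by have /andP[+ _] := fB x; exact: le_trans.
have mF : measurable_fun [set: borel X] ((fun x => (f x)%:E) : borel X -> \bar R).
  exact/measurable_EFinP.
have lo : \sum_(k < N) d%:E * nu (K k) <= \int[nu]_x (f x)%:E.
  rewrite -integral_ksum//; last exact: ltW.
  apply: ge0_le_integral => //.
  - by move=> x _; apply: ksum_ge0; exact: ltW.
  - exact: measurable_ksum.
  - by move=> x _; have [] := ksum_level d0 (fN x).
have nufin : \int[nu]_x (f x)%:E < +oo.
  apply: (@le_lt_trans _ _ (\int[nu]_x B%:E)).
    apply: ge0_le_integral => //.
    - by move=> x _; rewrite lee_fin; have /andP[] := fB x.
    - by move=> x _; rewrite lee_fin; have /andP[] := fB x.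
  rewrite integral_cst//; have B0 : (0 <= B)%R by have /andP[] := fB point; exact: le_trans.
  by rewrite lte_mul_pinfty//; apply: le_lt_trans nuM (ltry _).
have : \sum_(k < N) d%:E * nu (K k) < \int[nu]_x (f x)%:E + (e / 2)%:E.
  apply: le_lt_trans lo _; rewrite lteDl ?lte_fin ?divr_gt0//.
  by rewrite ge0_fin_numE//; apply: integral_ge0 => x _; rewrite lee_fin; have /andP[] := fB x.
move=> /(weak_limit_sum_compact d0 cK); apply: filterS => t tK.
apply: (@le_trans _ _ (\int[mu t]_x (d%:E + ksum d N K x))).
  apply: ge0_le_integral => //.
  - by move=> x _; rewrite lee_fin; have /andP[] := fB x.
  - apply: emeasurable_funD => //; exact: measurable_ksum.
  - by move=> x _; have [] := ksum_level d0 (fN x).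
rewrite ge0_integralD//; last 3 first.
- by move=> x _; rewrite lee_fin ltW.
- by move=> x _; apply: ksum_ge0; exact: ltW.
- exact: measurable_ksum.
rewrite integral_cst// integral_ksum//; last exact: ltW.
apply: (@le_trans _ _ ((e / 2)%:E + (\int[nu]_x (f x)%:E + (e / 2)%:E))); last first.
  by rewrite addeCA -EFinD -splitr.
apply: leeD; last exact: ltW.
apply: (@le_trans _ _ (d%:E * M%:E)).
  by rewrite lee_wpmul2l// lee_fin ltW.
rewrite -EFinM lee_fin /d.
have M1 : (0 < 2 * (M + 1))%R by rewrite mulr_gt0// ltr_wpDl.
rewrite mulrAC ler_pdivrMr// mulrA divfK//.
by rewrite ler_pM2l// lerDl.
Qed.

End weak_limits.

Section vague.
Context {R : realType} {X : ptopologicalType} {T : Type}.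
Local Open Scope ereal_scope.

Lemma continuous_lsc (f : X -> R) : continuous f ->
  lower_semicontinuous (fun x => (f x)%:E).
Proof.
move=> cf; apply/lower_semicontinuousP => a.
have -> : [set x | a%:E < (f x)%:E] = f @^-1` [set y | (a < y)%R].
  by apply/seteqP; split => x /=; rewrite lte_fin.
by apply: open_comp => //; exact: open_gt.
Qed.

Lemma compact_support_level (f : X -> R) (r : R) : Cc f -> (0 < r)%R ->
  compact [set x | (r <= f x)%R].
Proof.
move=> [cf cK] r0; apply: (subclosed_compact _ cK).
  by apply: (@preimage_closed _ _ f [set y | (r <= y)%R]) => //; exact: closed_ge.
move=> x /= rx; apply: subset_closure => /=; apply: contraTneq rx => ->.
by rewrite -ltNge.
Qed.

Lemma compact_support_bounded (f : X -> R) : Cc f -> exists B, forall x, (f x <= B)%R.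
Proof.
move=> [cf cK]; pose U (n : nat) := f @^-1` [set y | (y < n%:R)%R].
have [|x _|N KN] := @compact_bigcup_open X _ U cK.
- by move=> n; rewrite /U; apply: open_comp => //; exact: open_lt.
- exists (Num.truncn `|f x|).+1 => //=; apply: le_lt_trans (ler_norm _) _.
  by have /andP[] := truncn_itv (normr_ge0 (f x)).
exists N%:R => x; have [->//|fx] := eqVneq (f x) 0%R.
have := KN x (@subset_closure _ [set x | f x != 0%R] x fx); rewrite -bigcup_mkord => -[n /= nN fn].
by apply: ltW; apply: lt_le_trans fn _; rewrite ler_nat ltnW.
Qed.

Variables (F : set_system T).
Context {FF : ProperFilter F}.
Variables (mu : T -> meas X R) (nu : meas X R) (M : R).
Hypothesis wl : weak_limit F mu nu.
Hypothesis muM : forall t, mu t setT <= M%:E.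
Hypothesis nuM : nu setT <= M%:E.
Hypothesis hX : hausdorff_space X.

Lemma bounded_integral_fin (m : meas X R) (f : X -> R) (B : R) : m setT <= M%:E ->
  measurable_fun [set: borel X] ((fun x => (f x)%:E) : borel X -> \bar R) ->
  (forall x, 0 <= f x <= B)%R -> \int[m]_x (f x)%:E \is a fin_num.
Proof.
move=> mM mf fB; have f0 x : 0 <= (f x)%:E by rewrite lee_fin; have /andP[] := fB x.
rewrite ge0_fin_numE; last exact: integral_ge0.
apply: (@le_lt_trans _ _ (\int[m]_x B%:E)).
  by apply: ge0_le_integral => // x _; rewrite lee_fin; have /andP[] := fB x.
rewrite integral_cst//; have B0 : (0 <= B)%R by have /andP[] := fB point; exact: le_trans.
by rewrite lte_mul_pinfty//; apply: le_lt_trans mM (ltry _).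
Qed.

Lemma weak_limit_Cc_ge0 (f : X -> R) (e : R) : Cc f -> (forall x, 0 <= f x)%R ->
  (0 < e)%R -> \forall t \near F,
  (`|fine (\int[mu t]_x (f x)%:E) - fine (\int[nu]_x (f x)%:E)| <= e)%R.
Proof.
move=> Cf f0 e0; have [cf _] := Cf; have [B fB] := compact_support_bounded Cf.
have fB' x : (0 <= f x <= B)%R by rewrite f0 fB.
have lf := continuous_lsc cf; have mf := lsc_measurable lf.
have nfin := bounded_integral_fin nuM mf fB'.
have near1 := weak_limit_usc wl muM nuM hX fB' (fun r => compact_support_level Cf) e0.
have near2 : \forall t \near F, \int[nu]_x (f x)%:E - e%:E < \int[mu t]_x (f x)%:E.
  apply: (weak_limit_lsc wl lf); first by move=> x; rewrite lee_fin.
  by rewrite lteBlDr// lteDl// lte_fin.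
apply: filterS2 (near1 FF) near2 => t.
have mfin := bounded_integral_fin (muM t) mf fB'.
rewrite -(fineK nfin) -(fineK mfin) -EFinB -EFinD lee_fin lte_fin => t1 t2.
by rewrite ler_distl (ltW t2) t1.
Qed.

Lemma Cc_comp (f g : X -> R) : Cc f -> continuous g ->
  (forall x, f x = 0%R -> g x = 0%R) -> Cc g.
Proof.
move=> [cf cK] cg fg; split => //; apply: (subclosed_compact _ cK).
  exact: closed_closure.
by apply: closureS => x /=; apply: contra_neq; exact: fg.
Qed.

Lemma weak_limit_vague (f : X -> R) (e : R) : Cc f -> (0 < e)%R ->
  \forall t \near F, `|mint (mu t) f - mint nu f| < e%:E.
Proof.
move=> Cf e0; have [cf _] := Cf.
pose fp x := Num.max (f x) 0%R; pose fn x := Num.max (- f x)%R 0%R.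
have cfp : continuous fp.
  by move=> x; apply: (@continuous_max _ _ f (cst 0%R)); [exact: cf|exact: cvg_cst].
have cfn : continuous fn.
  move=> x; apply: (@continuous_max _ _ (fun x => - f x)%R (cst 0%R)); last exact: cvg_cst.
  exact: (cvgN (cf x)).
have Cfp : Cc fp by apply: Cc_comp Cf cfp _ => x fx; rewrite /fp fx maxxx.
have Cfn : Cc fn by apply: Cc_comp Cf cfn _ => x fx; rewrite /fn fx oppr0 maxxx.
have fp0 x : (0 <= fp x)%R by rewrite /fp le_max lexx orbT.
have fn0 x : (0 <= fn x)%R by rewrite /fn le_max lexx orbT.
have [Bp fpB] := compact_support_bounded Cfp.
have [Bn fnB] := compact_support_bounded Cfn.
have e2 : (0 < e / 3)%R by rewrite divr_gt0.
have mp := lsc_measurable (continuous_lsc cfp).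
have mn := lsc_measurable (continuous_lsc cfn).
have mE (m : meas X R) : m setT <= M%:E ->
    mint m f = (fine (\int[m]_x (fp x)%:E) - fine (\int[m]_x (fn x)%:E))%:E.
  move=> mM; rewrite EFinB !fineK.
  - rewrite /mint integralE; congr (_ - _); apply: eq_integral => x _.
      by rewrite funeposE /fp EFin_max.
    by rewrite funenegE /fn EFin_max.
  - by apply: (bounded_integral_fin mM mn (B := Bn)) => x; rewrite fn0 fnB.
  - by apply: (bounded_integral_fin mM mp (B := Bp)) => x; rewrite fp0 fpB.
apply: filterS2 (weak_limit_Cc_ge0 Cfp fp0 e2) (weak_limit_Cc_ge0 Cfn fn0 e2) => t.
rewrite (mE _ (muM t)) (mE _ nuM) -EFinB abse_EFin lte_fin.
set a := fine _; set b := fine _; set c := fine _; set d := fine _ => ab cd.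
have -> : (a - c - (b - d) = (a - b) - (c - d))%R by ring.
apply: le_lt_trans (ler_normB _ _) _; move: ab cd.
move: (`|a - b|)%R (`|c - d|)%R => u v; lra.
Qed.

End vague.

(** The bridge to [consistent], which speaks of vague cluster points of nets: every set of [F] meets
    every tail of the sequence. *)
Lemma weak_limit_cluster (R : realType) (X : ptopologicalType) (F : set_system nat)
    (mu : nat -> meas X R) (nu : meas X R) (M : R) :
  hausdorff_space X -> ProperFilter F -> \oo `<=` F -> weak_limit F mu nu ->
  (forall t, (mu t setT <= M%:E)%E) -> (nu setT <= M%:E)%E ->
  vague_cluster (fun m n => (m <= n)%N : Prop) mu nu.
Proof.
move=> hX PF ooF wl muM nuM n f e d0 Cf e0.
have : \forall t \near F, (d0 <= t)%N /\ forall k : 'I_n, (`|mint (mu t) (f k) - mint nu (f k)| < e%:E)%E.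
  apply: filterI; first by apply: ooF; exact: nbhs_infty_ge.
  by apply: filter_forall => k; exact: (weak_limit_vague wl muM nuM).
by move=> /filter_ex[t [dt H]]; exists t.
Qed.

(** * Families of measures *)

Section family_sums.
Context {R : realType} {X : ptopologicalType} {J : countType}.
Implicit Types (D : set J) (m : J -> meas X R) (nu : meas X R).
Local Open Scope ereal_scope.

(** Turns sums over a countable index type into series: indices are enumerated by their codes, and
    numbers that code nothing contribute 0. *)
Lemma esum_pickle D (f : J -> \bar R) : (forall j, 0 <= f j) ->
  \sum_(k <oo) oapp (fun j => if j \in D then f j else 0) 0 (pickle_inv k) =
  \esum_(j in D) f j.
Proof.
move=> f0; rewrite nneseries_esumT; last first.
  by move=> k; case: pickle_inv => //= j; case: ifP.
pose a k := oapp f 0 (@pickle_inv J k).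
have -> : \esum_(j in D) f j = \esum_(k in choice.pickle @` D) a k.
  rewrite esum_image; first by apply: eq_esum => j _; rewrite /a pickleK_inv.
  by move=> i j _ _; exact: (pcan_inj choice.pickleK).
rewrite [RHS]esum_mkcond; apply: eq_esum => k _; rewrite /a.
have := @pickle_invK J k; case E : pickle_inv => [j|]/= kj.
  have -> // : (k \in [set choice.pickle x | x in D]) = (j \in D).
  apply/idP/idP => /set_mem.
    move=> [i Di ik]; apply/mem_set.
    by move: E; rewrite -ik pickleK_inv => -[<-].
  by move=> Dj; apply/mem_set; exists j.
by case: ifP.
Qed.

(** Encoded as a series over [nat], padded with zero measures, to inherit the measure structure and
    the results on [seriesm]. *)
Definition famsum D m : meas X R :=
  seriesm (fun k => oapp (fun j => if j \in D then m j else mzero) mzero (pickle_inv k)).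

Lemma famsumE D m B : famsum D m B = \esum_(j in D) m j B.
Proof.
rewrite -esum_pickle//; apply: eq_eseriesr => k _.
by case: pickle_inv => //= j; case: ifP.
Qed.

(** The index [l] is exempt from the mass bound because its component may have infinite mass; the
    series is cut just after the code of [l]. *)
Lemma radon_famsum D m (l : J) : hausdorff_space X -> (forall j, radon (m j)) ->
  \esum_(j in D `\ l) m j setT < +oo -> radon (famsum D m).
Proof.
move=> hX rm fin; apply: (@radon_seriesm _ _ _ (choice.pickle l).+1) => //.
  move=> k; case: pickle_inv => /= [j|]; last exact: radon_mzero.
  by case: ifP => _; [exact: rm|exact: radon_mzero].
apply: le_lt_trans fin; rewrite -esum_pickle//.
rewrite [leRHS](nneseries_split 0 (choice.pickle l).+1)//; last first.
  by move=> k _; case: pickle_inv => //= j; case: ifP.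
rewrite add0n; apply: (@le_trans _ _ (\sum_((choice.pickle l).+1 <= k <oo)
    oapp (fun j => if j \in D `\ l then m j setT else 0) 0 (pickle_inv k))); last first.
  rewrite leeDr//; apply: sume_ge0 => k _.
  by case: pickle_inv => //= j; case: ifP.
rewrite ![\sum_(_ <= _ <oo) _]eseries_cond/=.
apply: lee_nneseries => // k lk; have := @pickle_invK J k.
case: pickle_inv => //= j kj.
have jl : j <> l by move=> jl; move: lk; rewrite -kj jl ltnn.
suff -> : (j \in D `\ l) = (j \in D) by case: ifP.
apply/idP/idP => /set_mem; first by case=> Dj _; exact/mem_set.
by move=> Dj; apply/mem_set; split.
Qed.

End family_sums.

Section family_energy.
Context {R : realType} {X : ptopologicalType}.
Variables (kappa : X -> X -> \bar R) (h : R).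
Local Open Scope ereal_scope.
Hypothesis hX : hausdorff_space X.
Hypothesis SK : standing_kernel kappa h.

Lemma kap_famsuml (J : countType) (D : set J) (m : J -> meas X R) (nu : meas X R) : radon nu ->
  kap kappa (famsum D m) nu = \esum_(j in D) kap kappa (m j) nu.
Proof.
move=> rn; rewrite (kap_seriesml hX SK)// -esum_pickle; last first.
  by move=> j; exact: (energy_ge0 SK).
apply: eq_eseriesr => k _; case: pickle_inv => /= [j|]; last by rewrite kap0l.
by case: ifP => // _; rewrite kap0l.
Qed.

Lemma kap_famsumr (J : countType) (D : set J) (m : J -> meas X R) (nu : meas X R) :
  radon nu -> radon (famsum D m) -> (forall j, D j -> radon (m j)) ->
  kap kappa nu (famsum D m) = \esum_(j in D) kap kappa nu (m j).
Proof.
move=> rn rD rm; rewrite (kapC hX SK)// kap_famsuml//.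
by apply: eq_esum => j Dj; rewrite (kapC hX SK)//; exact: rm.
Qed.

Lemma kap_famsum (J1 J2 : countType) (D1 : set J1) (D2 : set J2)
    (m1 : J1 -> meas X R) (m2 : J2 -> meas X R) :
  radon (famsum D2 m2) -> (forall j, D1 j -> radon (m1 j)) ->
  (forall j, D2 j -> radon (m2 j)) ->
  kap kappa (famsum D1 m1) (famsum D2 m2) =
  \esum_(jk in [set jk | D1 jk.1 /\ D2 jk.2]) kap kappa (m1 jk.1) (m2 jk.2).
Proof.
move=> r2 rm1 rm2; rewrite kap_famsuml//.
rewrite (eq_esum (b := fun j => \esum_(k in D2) kap kappa (m1 j) (m2 k))); last first.
  by move=> j Dj; rewrite kap_famsumr//; exact: rm1.
by rewrite esum_esum// => i j _ _; exact: (energy_ge0 SK).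
Qed.

Section pairing.
Variables (J1 J2 : countType) (s1 : J1 -> bool) (m1 : J1 -> meas X R)
  (s2 : J2 -> bool) (m2 : J2 -> meas X R).
Let P1 := famsum [set j | s1 j] m1.
Let N1 := famsum [set j | ~~ s1 j] m1.
Let P2 := famsum [set j | s2 j] m2.
Let N2 := famsum [set j | ~~ s2 j] m2.
Hypothesis rm1 : forall j, radon (m1 j).
Hypothesis rm2 : forall j, radon (m2 j).
Hypothesis rP2 : radon P2.
Hypothesis rN2 : radon N2.

(** Pairs of equal sign split into both positive and both negative, and each block is a mutual
    energy of sums. *)
Lemma kpair_posE : kpair_pos kappa s1 m1 s2 m2 = kap kappa P1 P2 + kap kappa N1 N2.
Proof.
rewrite /kpair_pos (esumID [set jk | s1 jk.1]); last by move=> jk _; exact: (energy_ge0 SK).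
rewrite !kap_famsum//; congr (_ + _); congr (esum _ _); apply/seteqP; split => -[j k] /=;
  by case: (s1 j); case: (s2 k) => //= -[].
Qed.

Lemma kpair_negE : kpair_neg kappa s1 m1 s2 m2 = kap kappa P1 N2 + kap kappa N1 P2.
Proof.
rewrite /kpair_neg (esumID [set jk | s1 jk.1]); last by move=> jk _; exact: (energy_ge0 SK).
rewrite !kap_famsum//; congr (_ + _); congr (esum _ _); apply/seteqP; split => -[j k] /=;
  by case: (s1 j); case: (s2 k) => //= -[].
Qed.

Lemma kpairE : Eplus kappa P1 -> Eplus kappa N1 -> Eplus kappa P2 -> Eplus kappa N2 ->
  kpair kappa s1 m1 s2 m2 = (enB kappa P1 N1 P2 N2)%:E.
Proof.
move=> EP1 EN1 EP2 EN2; rewrite /kpair kpair_posE kpair_negE !(enE hX SK)//.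
rewrite -EFinB /enB; move: (en kappa P1 P2) (en kappa N1 N2) (en kappa P1 N2) (en kappa N1 P2).
by move=> x y z w; rewrite opprD addrA.
Qed.

End pairing.

Lemma Eplus_famsum (J : countType) (s : J -> bool) (m : J -> meas X R) :
  (forall j, radon (m j)) ->
  radon (famsum [set j | s j] m) -> radon (famsum [set j | ~~ s j] m) ->
  fam_finite_energy kappa s m <->
  Eplus kappa (famsum [set j | s j] m) /\ Eplus kappa (famsum [set j | ~~ s j] m).
Proof.
move=> rm rP rN; rewrite /fam_finite_energy kpair_posE// kpair_negE//; split.
  move=> [pos _]; split; split => //; apply: le_lt_trans pos.
    by rewrite leeDl//; exact: (energy_ge0 SK).
  by rewrite leeDr//; exact: (energy_ge0 SK).
move=> [EP EN]; have [PN _] := Eplus_kap_fin hX SK EP EN.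
have [NP _] := Eplus_kap_fin hX SK EN EP.
have [_ PP] := EP. have [_ NN] := EN.
split; first exact: lte_add_pinfty PP NN.
exact: lte_add_pinfty PN NP.
Qed.

End family_energy.

(* A second functional N is almost minimized among the almost minimizers of G, so
   that the midpoint defect of N tends to 0 although that of G says nothing on N. *)
Lemma minimizing_sequence (R : realType) (T : Type) (t0 : T) (mid : T -> T -> T)
    (G N : T -> R) (c : R) :
  (forall x, c <= G x) -> (forall x y, G (mid x y) <= (G x + G y) / 2) ->
  (forall x, 0 <= N x) -> (forall r, exists B, forall x, G x <= r -> N x <= B) ->
  exists (u : nat -> T) (gamma B : R), [/\ forall x, gamma <= G x,
    forall n, G (u n) <= gamma + n.+1%:R^-1, forall n, N (u n) <= B &
    forall e, 0 < e -> exists n0, forall m n, (n0 <= m)%N -> (n0 <= n)%N ->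
      2 * N (u m) + 2 * N (u n) - 4 * N (mid (u m) (u n)) < e].
Proof.
move=> cG Gmid N0 NB.
have hG : has_inf (range G).
  by split; [exists (G t0), t0|exists c => _ [x _ <-]].
pose gamma := inf (range G).
have gG x : gamma <= G x by apply: ge_inf; [exact: hG.2|exists x].
have [B GB] := NB (gamma + 1).
have i0 n : 0 < n.+1%:R^-1 :> R by rewrite invr_gt0.
have i1 n : n.+1%:R^-1 <= 1 :> R by rewrite invf_le1 ?ler1n.
(* The infimum [d n] of [V n] increases with [n], as the sublevel sets of [G] shrink, and stays
   bounded because [N] is bounded on them; [D] is its supremum. *)
pose V n := [set N x | x in [set x | G x <= gamma + n.+1%:R^-1]].
have hV n : has_inf (V n).
  split; last by exists 0 => _ [x _ <-].
  have [_ [x _ <-] xg] := inf_adherent (i0 n) hG.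
  by exists (N x), x => //=; exact: ltW.
pose d n := inf (V n).
have dN n x : G x <= gamma + n.+1%:R^-1 -> d n <= N x.
  by move=> Gx; apply: ge_inf; [exact: (hV n).2|exists x].
have dmono m n : (m <= n)%N -> d m <= d n.
  move=> mn; apply: lb_le_inf; first exact: (hV n).1.
  move=> _ [x /= xn <-]; apply: dN; apply: le_trans xn _.
  by rewrite lerD2l lef_pV2 ?posrE// ler_nat ltnS.
have /choice[u uP] : forall n, exists x, G x <= gamma + n.+1%:R^-1 /\ N x <= d n + n.+1%:R^-1.
  by move=> n; have [_ [x xg <-] xN] := inf_adherent (i0 n) (hV n); exists x; split => //; exact: ltW.
have uB n : N (u n) <= B.
  by apply: GB; apply: le_trans (uP n).1 _; rewrite lerD2l.
have hD : has_sup (range d).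
  split; first by exists (d 0%N), 0%N.
  by exists B => _ [n _ <-]; apply: le_trans (uB n); exact: dN (uP n).1.
pose D := sup (range d).
have dD n : d n <= D by apply: ub_le_sup; [exact: hD.2|exists n].
exists u, gamma, B; split => // [n|e e0]; first exact: (uP n).1.
(* With every error below [e / 16], the defect is at most
   [4 (D + e / 16) - 4 (D - e / 16) = e / 2]. *)
have e8 : 0 < e / 16 by rewrite divr_gt0.
have [_ [n1 _ <-] n1D] := sup_adherent e8 hD.
pose n2 := Num.truncn (e / 16)^-1.
have n2e : n2.+1%:R^-1 < e / 16.
  rewrite -[ltRHS]invrK ltf_pV2 ?posrE ?invr_gt0//.
  have e80 : 0 <= (e / 16)^-1 by rewrite invr_ge0 ltW.
  by have /andP[] := truncn_itv e80.
exists (maxn n1 n2) => m n; rewrite !geq_max => /andP[m1 m2] /andP[k1 k2].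
have small k : (n2 <= k)%N -> k.+1%:R^-1 < e / 16.
  by move=> nk; apply: le_lt_trans n2e; rewrite lef_pV2 ?posrE// ler_nat ltnS.
have Nu k : (n2 <= k)%N -> N (u k) <= D + e / 16.
  by move=> nk; apply: le_trans (uP k).2 _; rewrite lerD// ltW// small.
have Gu k : (n1 <= k)%N -> G (u k) <= gamma + n1.+1%:R^-1.
  move=> nk; apply: le_trans (uP k).1 _.
  by rewrite lerD2l lef_pV2 ?posrE// ler_nat ltnS.
(* Midpoint convexity of [G] keeps the midpoint in the sublevel set of rank [n1]. *)
have : d n1 <= N (mid (u m) (u n)).
  apply: dN; apply: le_trans (Gmid _ _) _.
  have := Gu _ m1; have := Gu _ k1; move: (_^-1) => w A1 A2; lra.
move=> A3; have A1 := Nu _ m2; have A2 := Nu _ k2; move: n1D; rewrite -/D => n1D; lra.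
Qed.

(** * Capacity *)

Lemma half_ge0 (R : realType) : 0 <= 2^-1 :> R. Proof. by rewrite invr_ge0. Qed.

Section capacity.
Context {R : realType} {X : ptopologicalType}.
Variables (kappa : X -> X -> \bar R) (h : R).
Implicit Types (A B C K : set X) (nu theta : meas X R).
Hypothesis hX : hausdorff_space X.
Hypothesis SK : standing_kernel kappa h.

Notation E := (Eplus kappa).
Notation en := (en kappa).

(** Compact carriers inside [A] replace concentration on [A]. They come from inner regularity
    through [normalize_compact] and are stable under midpoints. *)
Definition inner_probability A theta :=
  [/\ E theta, theta setT = 1%E & exists C, [/\ compact C, C `<=` A & theta (~` C) = 0%E]].

Lemma inner_probability_concentrated A theta :
  inner_probability A theta -> concentrated theta A.
Proof.
move=> [_ _ [C [cC CA C0]]]; exists C; split => //; exact: compact_bmeasurable.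
Qed.

Lemma inner_probabilityS A B theta : A `<=` B ->
  inner_probability A theta -> inner_probability B theta.
Proof.
move=> AB [Et t1 [C [cC CA C0]]]; split => //; exists C; split => //.
exact: subset_trans AB.
Qed.

Definition halfm mu nu : meas X R :=
  addm (scalem (NngNum (half_ge0 R)) mu) (scalem (NngNum (half_ge0 R)) nu).

Lemma halfmE mu nu B : halfm mu nu B = ((2^-1)%:E * mu B + (2^-1)%:E * nu B)%E.
Proof. by rewrite addmE !scalemE. Qed.

Lemma Eplus_halfm mu nu : E mu -> E nu -> E (halfm mu nu).
Proof.
by move=> Em En; apply: (Eplus_addm hX SK); exact: (Eplus_scalem hX SK).
Qed.

Lemma en_halfm mu nu : E mu -> E nu ->
  en (halfm mu nu) (halfm mu nu) = (en mu mu + en nu nu + 2 * en mu nu) / 4.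
Proof.
move=> Em En; have hm := Eplus_scalem hX SK (NngNum (half_ge0 R)) Em.
have hn := Eplus_scalem hX SK (NngNum (half_ge0 R)) En; have ha := Eplus_addm hX SK hm hn.
rewrite !((en_addl hX SK), (en_addr hX SK))//.
rewrite !((en_scalel hX SK), (en_scaler hX SK))//= (enC hX SK En Em).
by field.
Qed.

Lemma sqd_en_halfm mu nu : E mu -> E nu ->
  sqd kappa mu nu = 2 * en mu mu + 2 * en nu nu - 4 * en (halfm mu nu) (halfm mu nu).
Proof. by move=> Em En; rewrite en_halfm// /sqd; field. Qed.

Lemma inner_probability_halfm A mu nu : inner_probability A mu ->
  inner_probability A nu -> inner_probability A (halfm mu nu).
Proof.
move=> [Em m1 [C [cC CA C0]]] [En n1 [C' [cC' CA' C0']]].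
split; first exact: Eplus_halfm.
  by rewrite halfmE m1 n1 -EFinM -EFinD; congr EFin; field.
exists (C `|` C'); split; [exact: compactU|by rewrite subUset|].
have mC : bmeasurable C by exact: compact_bmeasurable.
have mC' : bmeasurable C' by exact: compact_bmeasurable.
have mCC : bmeasurable (~` (C `|` C')) by apply: measurableC; exact: measurableU.
have -> : halfm mu nu (~` (C `|` C')) = 0%E.
  rewrite halfmE (subset_measure0 mCC _ _ C0); last 2 first.
  - exact: measurableC.
  - by move=> x xC Cx; apply: xC; left.
  rewrite (subset_measure0 mCC _ _ C0'); last 2 first.
  - exact: measurableC.
  - by move=> x xC Cx; apply: xC; right.
  by rewrite mule0 adde0.
by [].
Qed.

Lemma normalize_compact nu A C : E nu -> compact C -> C `<=` A -> (0 < nu C)%E ->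
  exists theta, inner_probability A theta /\
    en theta theta <= en nu nu / fine (nu C) ^+ 2.
Proof.
move=> En cC CA nuC; have [rn _] := En.
have mC : bmeasurable C by exact: compact_bmeasurable.
have nuCoo := radon_fin rn cC.
have nE : nu C = (fine (nu C))%:E by rewrite fineK// ge0_fin_numE// ltW.
have r0 : 0 < fine (nu C) by rewrite -lte_fin -nE.
have ri0 : 0 <= (fine (nu C))^-1 by rewrite invr_ge0 ltW.
have Er := Eplus_restrm hX SK cC En.
exists (scalem (NngNum ri0) (restrm C nu)); split; first split.
- exact: (Eplus_scalem hX SK).
- by rewrite scalemE restrmE// setTI/= nE -EFinM mulVf// gt_eqF.
- by exists C; split => //; rewrite scalemE restrmE// setICl measure0 mule0.
rewrite (en_scalel hX SK)//; last exact: (Eplus_scalem hX SK).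
rewrite (en_scaler hX SK)//= mulrA -expr2 exprVn mulrC ler_wpM2r//.
rewrite -lee_fin -!(enE hX SK)//.
have [rr _] := Er.
by apply: le_trans (kap_restrmr hX SK cC rr rn) _; exact: (kap_restrml hX SK).
Qed.

Lemma capacity_ge A theta : inner_probability A theta ->
  ((capacity kappa A)^-1 <= (en theta theta)%:E)%E.
Proof.
move=> At; have [Et t1 _] := At.
rewrite /capacity inveK -(enE hX SK)//; apply: ereal_inf_lbound.
by exists theta => //; split => //; exact: inner_probability_concentrated.
Qed.

(** A positive mass would leave a positive mass on a compact subset of [A], and normalizing there
    gives a unit measure of finite energy on [B]. Two sets occur because the exceptional set [B]
    need not be Borel. *)
Lemma capacity0_null A B nu : A `<=` B -> bmeasurable A -> capacity kappa B = 0%E ->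
  E nu -> (nu A < +oo)%E -> nu A = 0%E.
Proof.
move=> AB mA cA0 En nuA; apply: contrapT => /eqP nA0; have [rn _] := En.
have nA : (0 < nu A)%E by rewrite lt_neqAle eq_sym nA0 measure_ge0.
have [C [cC CA nC]] := radon_inner hX rn mA nuA nA.
have [theta [/capacity_ge]] := normalize_compact En cC (subset_trans CA AB) nC.
by rewrite cA0 inve0 leye_eq.
Qed.

Lemma capacity_pinfty A (e : R) : capacity kappa A = +oo%E -> 0 < e ->
  exists theta, inner_probability A theta /\ en theta theta < e.
Proof.
move=> cA e0.
have : ereal_inf [set kap kappa nu nu | nu in
     [set nu : meas X R | [/\ E nu, concentrated nu A & nu setT = 1%E]]] = 0%E.
  by apply/eqP; rewrite -inve_eqy -/(capacity kappa A) cA.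
move=> inf0.
(* Keeping more than half of the mass on a compact set and normalizing multiplies the energy by at
   most 4. *)
have : (ereal_inf [set kap kappa nu nu | nu in
     [set nu : meas X R | [/\ E nu, concentrated nu A & nu setT = 1%E]]] < (e / 4)%:E)%E.
  by rewrite inf0 lte_fin divr_gt0.
move=> /ereal_inf_lt[_ [nu [En [B [mB BA B0]] n1] <-]].
rewrite (enE hX SK)// lte_fin => ene.
have [rn _] := En.
have nB : nu B = 1%E.
  have : nu setT = (nu B + nu (~` B))%E.
    by rewrite -(setUv B); apply: measureU; [exact: mB|exact: measurableC|rewrite setICr].
  by rewrite n1 B0 adde0.
have [||C [cC CB nC]] := @radon_inner _ _ nu B (2^-1)%:E hX rn mB.
- by rewrite nB ltry.
- by rewrite nB lte_fin; lra.
have nC0 : (0 < nu C)%E by apply: lt_trans nC; rewrite lte_fin.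
have [theta [At te]] := normalize_compact En cC (subset_trans CB BA) nC0.
exists theta; split => //; apply: le_lt_trans te _.
have nuCoo := radon_fin rn cC.
move: nC; rewrite (_ : nu C = (fine (nu C))%:E); last by rewrite fineK// ge0_fin_numE// ltW.
rewrite lte_fin; move: (fine _) => r r2.
have r0 : 0 < r by apply: lt_trans r2.
rewrite ltr_pdivrMr ?exprn_gt0//; apply: lt_le_trans ene _.
rewrite ler_wpM2l//; first exact: ltW.
have -> : 4^-1 = 2^-1 ^+ 2 :> R by field.
by rewrite ler_pXn2r ?nnegrE// ltW.
Qed.

End capacity.

Section capacity_tail.
Context {R : realType} {X : ptopologicalType}.
Variables (kappa : X -> X -> \bar R) (h : R).
Implicit Types (A B C K : set X) (nu theta : meas X R).
Hypothesis hX : hausdorff_space X.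
Hypothesis SK : standing_kernel kappa h.

Notation E := (Eplus kappa).
Notation en := (en kappa).
Notation IP := (inner_probability kappa).

Lemma capacity_lb A : capacity kappa A <> +oo%E ->
  exists k : R, 0 < k /\ forall theta, IP A theta -> k <= en theta theta.
Proof.
move=> cA; pose c := ((capacity kappa A)^-1)%E.
have c0 : (0 <= c)%E.
  rewrite /c /capacity inveK; apply: le_ereal_inf_tmp => _ [nu _ <-].
  exact: (energy_ge0 SK).
have cn0 : c != 0%E by rewrite /c inve_eq0; exact/eqP.
have cge theta : IP A theta -> (c <= (en theta theta)%:E)%E by exact: (capacity_ge hX SK).
case: c c0 cn0 cge => [c| |//] c0 cn0 cge.
  exists c; split.
    move: c0; rewrite lee_fin le_eqVlt eq_sym; case/orP => // /eqP c0.
    by move: cn0; rewrite c0 eqxx.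
  by move=> theta /cge; rewrite lee_fin.
(* Capacity zero: there is no such measure, and any constant will do. *)
by exists 1; split => // theta /cge; rewrite leye_eq.
Qed.

(** The compact set pushes the measures to infinity, and the integer controls how close they are to
    the infimum. A net is needed since no sequence of compact sets need exhaust [X]. *)
Let D := ({K : set X | compact K} * nat)%type.
Let leD (d d' : D) : Prop := sval d.1 `<=` sval d'.1 /\ (d.2 <= d'.2)%N.

Let leD_directed : directed leD.
Proof.
split.
- exact: inhabits (exist _ set0 compact0, 0%N).
- by move=> a; split.
- by move=> a b c [ab ab'] [bc bc']; split; [exact: subset_trans bc|exact: leq_trans bc'].
- move=> a b; exists (exist _ (sval a.1 `|` sval b.1) (compactU (svalP a.1) (svalP b.1)),
    maxn a.2 b.2).
  by split; split => /=; [exact: subsetUl|exact: leq_maxl|exact: subsetUr|exact: leq_maxr].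
Qed.

(* If the tails kept bounded energy, almost minimal unit charges on [A `\` K]
   would form a strong Cauchy net converging vaguely to 0, hence strongly to 0
   by consistency, against the finiteness of the capacity of [A]. *)
Lemma capacity_tail A (e : R) : capacity kappa A <> +oo%E -> 0 < e ->
  exists K, compact K /\ forall nu C, E nu -> compact C -> C `<=` A `\` K ->
    fine (nu C) ^+ 2 <= e * en nu nu.
Proof.
move=> /capacity_lb[k [k0 kA]] e0; apply: contrapT => H.
(* If the conclusion fails at [K], some measure has too much mass on a compact part of the tail;
   normalizing it gives energy at most [1 / e]. *)
have IPK K : compact K -> exists theta, IP (A `\` K) theta /\ en theta theta <= e^-1.
  move=> cK; apply: contrapT => HK; apply: H; exists K; split => // nu C En cC CA.
  rewrite leNgt; apply/negP => lt; have [rn _] := En.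
  have enn := en_ge0 SK nu nu.
  have f0 : 0 <= fine (nu C) by apply: fine_ge0.
  have nC : fine (nu C) != 0.
    by apply: contraTneq lt => ->; rewrite expr0n/= -leNgt mulr_ge0// ltW.
  have nC0 : (0 < nu C)%E.
    rewrite lt_neqAle measure_ge0 andbT; apply: contra_neq nC => <-.
    by [].
  have [theta [At te]] := normalize_compact hX SK En cC CA nC0.
  apply: HK; exists theta; split => //; apply: le_trans te _.
  rewrite ler_pdivrMr; last by rewrite exprn_gt0// lt_neqAle eq_sym nC.
  by rewrite mulrC ler_pdivlMr// mulrC ltW.
pose V K := [set en theta theta | theta in IP (A `\` K)].
have hV K : compact K -> has_inf (V K).
  move=> cK; split; last by exists 0 => _ [theta _ <-]; exact: (en_ge0 SK).
  by have [theta [At _]] := IPK K cK; exists (en theta theta), theta.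
pose c K := inf (V K).
have cV K theta : compact K -> IP (A `\` K) theta -> c K <= en theta theta.
  by move=> cK At; apply: ge_inf; [exact: (hV K cK).2|exists theta].
have ce K : compact K -> c K <= e^-1.
  by move=> cK; have [theta [At te]] := IPK K cK; apply: le_trans (cV _ _ cK At) te.
pose cs := sup [set c K | K in [set K | compact K]].
have hs : has_sup [set c K | K in [set K | compact K]].
  split; first by exists (c set0), set0 => //; exact: compact0.
  by exists e^-1 => _ [K cK <-]; exact: ce.
have ccs K : compact K -> c K <= cs.
  by move=> cK; apply: ub_le_sup; [exact: hs.2|exists K].
have /choice[th thP] : forall d : D, exists theta, IP (A `\` sval d.1) theta /\
    en theta theta <= c (sval d.1) + d.2.+1%:R^-1.
  move=> [[K cK] n] /=.
  have n0 : 0 < n.+1%:R^-1 :> R by rewrite invr_gt0.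
  have [_ [theta At <-] te] := inf_adherent n0 (hV K cK).
  by exists theta; split => //; exact: ltW.
have Eth d : E (th d) by have [[]] := thP d.
have cauchy r : 0 < r -> exists d0, forall a b, leD d0 a -> leD d0 b ->
    (dist2 kappa (th a) (th b) < r%:E)%E.
  move=> r0; have r16 : 0 < r / 16 by rewrite divr_gt0.
  have [_ [K0 cK0 <-] K0s] := sup_adherent r16 hs.
  pose n0 := Num.truncn (r / 16)^-1.
  have n0r : n0.+1%:R^-1 < r / 16.
    rewrite -[ltRHS]invrK ltf_pV2 ?posrE ?invr_gt0//.
    have r160 : 0 <= (r / 16)^-1 by rewrite invr_ge0 ltW.
    by have /andP[] := truncn_itv r160.
  exists (exist _ K0 cK0, n0) => a b [/= K0a na] [/= K0b nb].
  rewrite (dist2E hX SK)// lte_fin (sqd_en_halfm hX SK)//.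
  have small m : (n0 <= m)%N -> m.+1%:R^-1 < r / 16.
    by move=> nm; apply: le_lt_trans n0r; rewrite lef_pV2 ?posrE// ler_nat ltnS.
  have sub K : K0 `<=` K -> A `\` K `<=` A `\` K0.
    by move=> KK x [Ax Kx]; split => // /KK.
  (* Both measures live off [K0], hence so does their midpoint. *)
  have mid : c K0 <= en (halfm (th a) (th b)) (halfm (th a) (th b)).
    apply: cV => //; apply: (inner_probability_halfm hX SK).
      by apply: inner_probabilityS (thP a).1; exact: sub.
    by apply: inner_probabilityS (thP b).1; exact: sub.
  have ea := (thP a).2; have eb := (thP b).2.
  have ca := ccs _ (svalP a.1); have cb := ccs _ (svalP b.1).
  have sa := small _ na; have sb := small _ nb.
  move: ea eb ca cb sa sb mid K0s; rewrite -/cs.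
  move: (_^-1) (_^-1) (en _ _) (en _ _) (en _ _) (c _) (c _) (c _) => *; lra.
have cluster : vague_cluster leD th mzero.
  move=> n f r d0 Cf r0.
  pose S := \big[setU/set0]_(i < n) closure [set x | f i x != 0].
  have cS : compact S by apply: bigsetU_compact => i _; have [] := Cf i.
  (* Once the compact set contains the supports of the test functions, the measure lives where all
     of them vanish. *)
  exists (exist _ (sval d0.1 `|` S) (compactU (svalP d0.1) cS), d0.2).
  split; first by split => //=; exact: subsetUl.
  move=> i; set d := (_, _); rewrite /mint integral_measure_zero sube0.
  have [[_ _ [C [cC CA C0]]] _] := thP d.
  have mC : bmeasurable C by exact: compact_bmeasurable.
  have [cf _] := Cf i.
  have mf := lsc_measurable (continuous_lsc cf).
  suff -> : (\int[th d]_x (f i x)%:E = 0)%E by rewrite abse0 lte_fin.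
  rewrite (ae_eq_integral (cst 0%E))//; first by rewrite integral0.
  exists (~` C); split => //; first exact: measurableC.
  move=> x /= /not_implyP[_ fx] Cx; apply: fx; congr EFin.
  apply: contrapT => /eqP fx; have [_] := CA _ Cx; apply.
  right; rewrite /S (bigD1 i)//=; left.
  exact: (@subset_closure _ [set x | f i x != 0]).
have [_ _ _ [_ cons _ _] _] := SK.
have [_ lim] := cons D leD th leD_directed Eth cauchy mzero (radon_mzero hX) cluster.
(* The squared distance to 0 is the energy, which [kA] keeps above [k]. *)
have [d0 d0k] := lim k k0.
have := d0k d0 (conj (@subset_refl _ _) (leqnn _)).
rewrite (dist2E hX SK)//; last exact: Eplus_mzero.
rewrite lte_fin /sqd (_ : en mzero mzero = 0); last by rewrite /en kap0l.
rewrite (enC hX SK (Eth d0))//; last exact: Eplus_mzero.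
rewrite (_ : en mzero _ = 0); last by rewrite /en kap0l.
have : k <= en (th d0) (th d0).
  by apply: kA; apply: inner_probabilityS (thP d0).1; exact: subDsetl.
move=> kt; move: k0; lra.
Qed.

End capacity_tail.

(** * Strong limits and the weight *)

Section limits_of_series.
Context {R : realType} {X : ptopologicalType} {T : Type}.
Variables (F : set_system T).
Context {FF : ProperFilter F}.
Variables (u : T -> nat -> meas X R) (v : nat -> meas X R) (b : nat -> \bar R).
Local Open Scope ereal_scope.
Hypothesis hX : hausdorff_space X.
Hypothesis wl : forall k, weak_limit F (fun t => u t k) (v k).
Hypothesis ub : forall t k, u t k setT <= b k.
Hypothesis bfin : \sum_(0 <= k <oo) b k < +oo.
Hypothesis b0 : forall k, 0 <= b k.

Lemma nneseries_tail_lt (s : R) : (0 < s)%R -> exists n, \sum_(n <= k <oo) b k < s%:E.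
Proof.
move=> s0; have := @nneseries_tail_cvg _ b xpredT bfin (fun _ _ => b0 _).
move=> /fine_cvgP[fin /cvgrPdist_lt /(_ s s0)] fs.
near \oo => n; exists n.
have kfin : \sum_(n <= i <oo) b i \is a fin_num by near: n.
rewrite -(fineK kfin) lte_fin.
have : (`|0 - fine (\sum_(n <= i <oo) b i)| < s)%R by near: n.
by rewrite sub0r normrN ger0_norm// fine_ge0// nneseries_ge0.
Unshelve. all: by end_near. Qed.

Lemma weak_limit_big_compact n K (s : \bar R) : compact K ->
  \sum_(k < n) v k K < s -> \forall t \near F, \sum_(k < n) u t k K < s.
Proof.
move=> cK; elim: n s => [|n IH] s.
  by rewrite big_ord0 => s0; apply: nearW => t; rewrite big_ord0.
rewrite big_ord_recr/= => /gt_adde_split[||s1 [s2 [s1U s2U ts]]] //.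
  by apply: sume_ge0.
apply: filterS2 (IH _ s1U) ((wl n).1 _ _ cK s2U) => t t1 t2.
by rewrite big_ord_recr/=; apply: lt_le_trans _ ts; rewrite EFinD lteD.
Qed.

Lemma weak_limit_big_open n U (s : \bar R) : open U ->
  s < \sum_(k < n) v k U -> \forall t \near F, s < \sum_(k < n) u t k U.
Proof.
move=> oU; elim: n s => [|n IH] s.
  by rewrite big_ord0 => s0; apply: nearW => t; rewrite big_ord0.
rewrite big_ord_recr/= => /lt_adde_split[||s1 [s2 [s1U s2U ts]]] //.
  by apply: sume_ge0.
apply: filterS2 (IH _ s1U) ((wl n).2 _ _ oU s2U) => t t1 t2.
by rewrite big_ord_recr/=; apply: le_lt_trans ts _; rewrite EFinD lteD.
Qed.

Lemma lt_seriesm (w : nat -> meas X R) B (s : \bar R) : s < seriesm w B ->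
  exists n, s < \sum_(k < n) w k B.
Proof.
move=> sw; apply: contrapT => H; move: sw; apply/negP; rewrite -leNgt seriesmE.
apply: lime_le; first exact: is_cvg_nneseries.
by apply: nearW => n; rewrite big_mkord leNgt; apply/negP => sn; apply: H; exists n.
Qed.

Lemma seriesm_split (w : nat -> meas X R) B n :
  seriesm w B = \sum_(k < n) w k B + \sum_(n <= k <oo) w k B.
Proof. by rewrite seriesmE (nneseries_split 0 n)// add0n big_mkord. Qed.

(** Lower bounds are already attained by finite partial sums. For upper bounds, the summable [b]
    makes the tails small uniformly in [t]. *)
Lemma weak_limit_seriesm : weak_limit F (fun t => seriesm (u t)) (seriesm v).
Proof.
split=> [K r cK vr|U r oU /lt_seriesm[n vn]]; last first.
  apply: filterS (weak_limit_big_open oU vn) => t /lt_le_trans; apply.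
  by rewrite (seriesm_split _ _ n) leeDl// nneseries_ge0.
have vr0 : seriesm v K + 0 < r%:E by rewrite adde0.
have [s1 [s2 [vs1 s20 sr]]] :=
  @gt_adde_split _ (seriesm v K) 0 r%:E (measure_ge0 _ _) (lexx 0) vr0.
have [n bn] := nneseries_tail_lt s20.
have vs : \sum_(k < n) v k K < s1%:E.
  by apply: le_lt_trans vs1; rewrite (seriesm_split _ _ n) leeDl// nneseries_ge0.
apply: filterS (weak_limit_big_compact cK vs) => t ts.
rewrite (seriesm_split _ _ n); apply: lt_le_trans _ sr; rewrite EFinD lteD//.
apply: le_lt_trans bn; apply: lee_nneseries => // k _.
apply: le_trans (ub t k); apply: le_bmeasure => //; last exact: measurableT.
exact: compact_bmeasurable.
Qed.

End limits_of_series.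

Section strong_limit.
Context {R : realType} {X : ptopologicalType}.
Variables (kappa : X -> X -> \bar R) (h : R).
Hypothesis hX : hausdorff_space X.
Hypothesis SK : standing_kernel kappa h.

(** The weak limit is taken along [F], but consistency, applied to the sequence as a net, makes the
    whole sequence converge strongly. *)
Lemma strong_limit (F : set_system nat) (p : nat -> meas X R) (nu : meas X R) (M : R) :
  ProperFilter F -> \oo `<=` F -> (forall n, Eplus kappa (p n)) ->
  (forall e, 0 < e -> exists n0, forall m n, (n0 <= m)%N -> (n0 <= n)%N ->
     sqd kappa (p m) (p n) < e) ->
  radon nu -> weak_limit F p nu -> (forall n, (p n setT <= M%:E)%E) ->
  (nu setT <= M%:E)%E ->
  Eplus kappa nu /\ forall e, 0 < e -> exists n0, forall n, (n0 <= n)%N ->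
    sqd kappa (p n) nu < e.
Proof.
move=> PF ooF Ep cauchy rnu wl pM nuM.
have [_ _ _ [_ cons _ _] _] := SK.
have dir : directed (fun m n => (m <= n)%N : Prop).
  split; [exact: inhabits 0%N|exact: leqnn|by move=> a b c; exact: leq_trans|].
  by move=> a b; exists (maxn a b); split; [exact: leq_maxl|exact: leq_maxr].
have cl := weak_limit_cluster hX PF ooF wl pM nuM.
have [e e0|Enu lim] := cons nat _ p dir Ep _ nu rnu cl.
  have [n0 H] := cauchy e e0; exists n0 => a b n0a n0b.
  by rewrite (dist2E hX SK)// lte_fin; exact: H.
split => // e e0; have [n0 H] := lim e e0; exists n0 => n n0n.
by rewrite -lte_fin -(dist2E hX SK)//; exact: H.
Qed.

End strong_limit.

(** * The weight under weak limits, and its tails *)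

Section weight.
Context {R : realType} {X : ptopologicalType}.
Variables (S : set X) (g : X -> R) (c : R).
Implicit Types (m nu : meas X R) (K : set X).
Hypothesis hX : hausdorff_space X.
Hypothesis cS : closed S.
Hypothesis gS : {within S, continuous g}.
Hypothesis c0 : 0 < c.
Hypothesis gc : forall x, S x -> c <= g x.

Let mS : bmeasurable S. Proof. exact: closed_bmeasurable. Qed.

Let near_outside x : ~ S x -> nbhs x (~` S).
Proof. by move=> Sx; apply: open_nbhs_nbhs; split => //; exact: closed_openC. Qed.

Let near_weight x (P : set R) : S x -> nbhs (g x) P -> nbhs x (fun y => S y -> P (g y)).
Proof. by move=> Sx Px; move/subspace_continuousP: gS => /(_ x Sx P Px). Qed.

(** The value [+oo] off the closed set [S] makes the weight lower semicontinuous on all of [X];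
    measures carried by [S] do not see it. *)
Definition extended_weight (x : X) : \bar R := if x \in S then (g x)%:E else +oo%E.

Lemma extended_weight_lsc : lower_semicontinuous extended_weight.
Proof.
move=> x a; rewrite /extended_weight; case: ifPn => [/set_mem Sx|].
  rewrite lte_fin => ag.
  exists (fun y => S y -> a < g y).
    by apply: (near_weight (P := [set z | a < z])) => //; apply: open_nbhs_nbhs; split => //; exact: open_gt.
  by move=> y Vy; case: ifPn => [/set_mem/Vy|_]; [rewrite lte_fin|rewrite ltry].
move=> Sx _; exists (~` S).
  by apply: near_outside => /mem_set; apply/negP.
by move=> y Sy; rewrite memNset// ltry.
Qed.

Lemma extended_weight_ge0 x : (0 <= extended_weight x)%E.
Proof.
rewrite /extended_weight; case: ifPn => // /set_mem Sx.
by rewrite lee_fin; apply: le_trans (gc Sx); exact: ltW.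
Qed.

Lemma measurable_weight :
  measurable_fun (S : set (borel X)) ((fun x => (g x)%:E) : borel X -> \bar R).
Proof.
apply: (eq_measurable_fun (extended_weight : borel X -> \bar R)).
  by move=> x xS; rewrite /extended_weight xS.
by apply: measurable_funTS; exact: (lsc_measurable extended_weight_lsc).
Qed.

Lemma weight_ge0 x : S x -> (0 <= (g x)%:E)%E.
Proof. by move=> Sx; rewrite lee_fin; apply: le_trans (gc Sx); exact: ltW. Qed.

Lemma integral_extended_weight m : m (~` S) = 0%E ->
  (\int[m]_x extended_weight x = \int[m]_(x in S) (g x)%:E)%E.
Proof.
move=> m0; rewrite (@ge0_negligible_integral _ _ _ _ _ (~` S : set (borel X)))//.
- rewrite setTD setCK; apply: eq_integral => x xS.
  by rewrite /extended_weight xS.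
- exact: measurableC.
- exact: (lsc_measurable extended_weight_lsc).
- by move=> x _; exact: extended_weight_ge0.
Qed.

Lemma mass_setT m : m (~` S) = 0%E -> m setT = m S.
Proof.
move=> m0; have : m setT = (m S + m (~` S))%E.
  by rewrite -(setUv S); apply: measureU; [exact: mS|exact: measurableC|rewrite setICr].
by rewrite m0 adde0.
Qed.

Lemma mass_le_weight m : m (~` S) = 0%E ->
  (c%:E * m setT <= \int[m]_(x in S) (g x)%:E)%E.
Proof.
move=> /mass_setT ->; rewrite -integral_cst//; apply: ge0_le_integral => //.
- by move=> x _; rewrite lee_fin ltW.
- exact: measurable_weight.
Qed.

Lemma closed_weight_ge r : closed [set x | S x /\ r <= g x].
Proof.
rewrite -openC openE => x /= xS; rewrite /interior.
have [Sx|Sx] := pselect (S x); last first.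
  by apply: filterS (near_outside Sx) => y Sy [].
have gr : g x < r by rewrite ltNge; apply/negP => rg; apply: xS.
apply: filterS (near_weight (P := [set z | z < r]) Sx _); last first.
  by apply: open_nbhs_nbhs; split => //; exact: open_lt.
by move=> y Vy [Sy]; have := Vy Sy => /=; rewrite ltNge => /negP.
Qed.

Lemma compact_weight_bounded K : compact K -> exists B : R, 0 <= B /\
  forall x, K x -> S x -> g x <= B.
Proof.
move=> cK; pose U n := ~` [set x | S x /\ n%:R <= g x].
have [|x Kx|N KN] := @compact_bigcup_open X _ U cK.
- by move=> n; apply: closed_openC; exact: closed_weight_ge.
- exists (Num.truncn `|g x|).+1 => //= -[_].
  apply/negP; rewrite -ltNge; apply: le_lt_trans (ler_norm _) _.
  by have /andP[] := truncn_itv (normr_ge0 (g x)).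
exists N%:R; split => // x /KN; rewrite -bigcup_mkord => -[n /= nN Unx] Sx.
rewrite leNgt; apply/negP => Ng; apply: Unx; split => //.
by apply: le_trans (ltW Ng); rewrite ler_nat ltnW.
Qed.

Lemma weight_compact_fin m K : radon m -> compact K ->
  (\int[m]_(x in S `&` K) (g x)%:E < +oo)%E.
Proof.
move=> rm cK; have [B [B0 gB]] := compact_weight_bounded cK.
have mK : bmeasurable K by exact: compact_bmeasurable.
have mSK : bmeasurable (S `&` K) by exact: measurableI.
apply: (@le_lt_trans _ _ (\int[m]_(x in S `&` K) B%:E)%E).
  apply: ge0_le_integral => //.
  - by move=> x [Sx _]; exact: weight_ge0.
  - by apply: measurable_funS measurable_weight => // x [].
  - by move=> x [Sx Kx]; rewrite lee_fin gB.
rewrite integral_cst// lte_mul_pinfty//.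
apply: le_lt_trans (radon_fin rm cK); exact: le_bmeasure.
Qed.

Section limits.
Variables (T : Type) (F : set_system T).
Context {FF : ProperFilter F}.
Variables (u : T -> meas X R) (v : meas X R) (M a : R).
Hypothesis wl : weak_limit F u v.
Hypothesis uM : forall t, (u t setT <= M%:E)%E.
Hypothesis vM : (v setT <= M%:E)%E.
Hypothesis uS : forall t, u t (~` S) = 0%E.

Lemma weak_limit_concentrated : v (~` S) = 0%E.
Proof.
apply: contrapT => /eqP vS.
have v0 : (0%:E < v (~` S))%E by rewrite lt_neqAle eq_sym vS measure_ge0.
have [t] := filter_ex (wl.2 _ _ (closed_openC cS) v0).
by rewrite uS ltxx.
Qed.

Lemma weak_limit_weight_le :
  (forall t, (\int[u t]_(x in S) (g x)%:E <= a%:E)%E) ->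
  (\int[v]_(x in S) (g x)%:E <= a%:E)%E.
Proof.
move=> ua; rewrite -integral_extended_weight; last exact: weak_limit_concentrated.
rewrite leNgt; apply/negP => av.
have [t] := filter_ex (weak_limit_lsc wl extended_weight_lsc extended_weight_ge0 av).
by rewrite integral_extended_weight// ltNge ua.
Qed.

(** Weight can be lost in the limit only by escaping to infinity, which the uniform tail bound
    excludes; on a compact set [weak_limit_usc] applies. *)
Lemma weak_limit_weight_ge :
  (forall t, (\int[u t]_(x in S) (g x)%:E = a%:E)%E) ->
  (forall e : R, 0 < e -> exists K, compact K /\
     forall t, (\int[u t]_(x in S `\` K) (g x)%:E <= e%:E)%E) ->
  (a%:E <= \int[v]_(x in S) (g x)%:E)%E.
Proof.
move=> ua tail; apply/lee_addgt0Pr => e e0.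
have e2 : 0 < e / 2 by rewrite divr_gt0.
have [K [cK Ke]] := tail _ e2.
have mK : bmeasurable K by exact: compact_bmeasurable.
have mSK : bmeasurable (S `&` K) by exact: measurableI.
have mSDK : bmeasurable (S `\` K) by exact: measurableD.
have [B [B0 gB]] := compact_weight_bounded cK.
(* Cut off to [S] and [K], the weight is bounded and has compact superlevel sets at positive
   height. *)
pose f x : R := if x \in S `&` K then g x else 0.
have fB x : 0 <= f x <= B.
  rewrite /f; case: ifPn => [/set_mem[Sx Kx]|_]; last by rewrite lexx.
  by rewrite gB// andbT; apply: le_trans (gc Sx); exact: ltW.
have cf r : 0 < r -> compact [set x | r <= f x].
  move=> r0; rewrite (_ : [set x | r <= f x] = K `&` [set x | S x /\ r <= g x]).
    by apply: compact_closedI => //; exact: closed_weight_ge.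
  apply/seteqP; split => x /=; rewrite /f.
    by case: ifPn => [/set_mem[]//|_]; rewrite leNgt r0.
  by move=> [Kx [Sx rg]]; rewrite mem_set.
have intf m : (\int[m]_x (f x)%:E = \int[m]_(x in S `&` K) (g x)%:E)%E.
  rewrite [RHS]integral_mkcond; apply: eq_integral => x _.
  by rewrite /f /patch; case: ifP.
have [t] := filter_ex (weak_limit_usc wl uM vM hX fB cf e2).
rewrite !intf => tf; have split_t : (\int[u t]_(x in S) (g x)%:E =
    \int[u t]_(x in S `&` K) (g x)%:E + \int[u t]_(x in S `\` K) (g x)%:E)%E.
  rewrite -ge0_integral_setU//.
  - by rewrite setUIDK.
  - by rewrite setUIDK; exact: measurable_weight.
  - by move=> x; rewrite setUIDK; exact: weight_ge0.
  - by apply/disj_setPS => x [[_ Kx] [_ nKx]].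
apply: (@le_trans _ _ ((\int[v]_(x in S) (g x)%:E + (e / 2)%:E) + (e / 2)%:E)%E); last first.
  by rewrite -[leLHS]addeA -EFinD -splitr.
rewrite -(ua t) split_t; apply: leeD; last exact: Ke.
apply: (le_trans tf); apply: leeD => //.
apply: ge0_subset_integral => //; first exact: measurable_weight.
by move=> x Sx; exact: weight_ge0.
Qed.

End limits.
End weight.

Section weight_tail.
Context {R : realType} {X : ptopologicalType}.
Variables (kappa : X -> X -> \bar R) (h : R) (S : set X) (g : X -> R) (c : R).
Hypothesis hX : hausdorff_space X.
Hypothesis SK : standing_kernel kappa h.
Hypothesis cS : closed S.
Hypothesis gS : {within S, continuous g}.
Hypothesis c0 : 0 < c.
Hypothesis gc : forall x, S x -> c <= g x.
Variables (T : Type) (u : T -> meas X R) (B M : R).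
Hypothesis Eu : forall t, Eplus kappa (u t).
Hypothesis uB : forall t, en kappa (u t) (u t) <= B.
Hypothesis uM : forall t, (u t setT <= M%:E)%E.
Hypothesis capS : capacity kappa S <> +oo%E.

Let mS : bmeasurable S. Proof. exact: closed_bmeasurable. Qed.

Let mtail K : compact K -> bmeasurable (S `\` K).
Proof. by move=> cK; apply: measurableD => //; exact: compact_bmeasurable. Qed.

Let utail_fin t K : compact K -> (u t (S `\` K) < +oo)%E.
Proof.
move=> cK; apply: le_lt_trans (ltry M); apply: le_trans (uM t).
apply: le_bmeasure => //; [exact: mtail|exact: measurableT].
Qed.

Let mgt K : compact K ->
  measurable_fun (S `\` K : set (borel X)) ((fun x => (g x)%:E) : borel X -> \bar R).
Proof.
move=> cK; apply: measurable_funS (measurable_weight cS gS) => //.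
Qed.

Lemma mass_tail (e : R) : 0 < e -> exists K, compact K /\
  forall t, (u t (S `\` K) <= e%:E)%E.
Proof.
move=> e0; have B1 : 0 < `|B| + 1 by rewrite ltr_wpDl.
(* Since the energies are at most [B], this constant bounds the squared mass of the tail by [e ^ 2];
   the absolute value and the 1 keep the denominator positive. *)
have [|K [cK tK]] := @capacity_tail _ _ _ _ hX SK S (e ^+ 2 / (`|B| + 1)) capS.
  by rewrite divr_gt0// exprn_gt0.
exists K; split => // t; have [rt _] := Eu t.
rewrite leNgt; apply/negP => et.
have [C [cC CS eC]] := radon_inner hX rt (mtail cK) (utail_fin t cK) et.
have := tK (u t) C (Eu t) cC CS.
have Cfin := radon_fin rt cC.
move: eC; rewrite (_ : u t C = (fine (u t C))%:E); last by rewrite fineK// ge0_fin_numE.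
rewrite lte_fin /=; move: (fine _) => r er; apply/negP; rewrite -ltNge.
apply: (@le_lt_trans _ _ (e ^+ 2)); last first.
  by rewrite ltr_pXn2r// nnegrE ltW// (lt_trans e0).
rewrite mulrAC ler_pdivrMr//; apply: ler_wpM2l; first by rewrite exprn_ge0// ltW.
apply: le_trans (uB t) _; apply: le_trans (ler_norm _) _.
by rewrite lerDl.
Qed.

Lemma weight_tail_bounded (M0 e : R) : (forall x, S x -> `|g x| <= M0) -> 0 < e ->
  exists K, compact K /\ forall t, (\int[u t]_(x in S `\` K) (g x)%:E <= e%:E)%E.
Proof.
move=> gM e0; have M1 : 0 < `|M0| + 1 by rewrite ltr_wpDl.
have [|K [cK uK]] := @mass_tail (e / (`|M0| + 1)); first by rewrite divr_gt0.
exists K; split => // t.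
apply: (@le_trans _ _ (\int[u t]_(x in S `\` K) (`|M0| + 1)%:E)%E).
  apply: ge0_le_integral => //.
  - exact: mtail.
  - by move=> x [Sx _]; exact: (weight_ge0 c0 gc).
  - exact: mgt.
  - move=> x [Sx _]; rewrite lee_fin; apply: le_trans (ler_norm _) _.
    by apply: le_trans (gM x Sx) _; apply: le_trans (ler_norm _) _; rewrite lerDl.
rewrite integral_cst//; last exact: mtail.
apply: (@le_trans _ _ ((`|M0| + 1)%:E * (e / (`|M0| + 1))%:E)%E).
  by apply: lee_pmul => //; rewrite lee_fin ltW.
by rewrite -EFinM lee_fin mulrC divfK// gt_eqF.
Qed.

(** Either [x] is below [t = W ^ (1 / (r - 1))], or [x ^ r >= t ^ (r - 1) * x = W * x]. Since
    [r > 1], the coefficient of [y] can be made as small as wanted. *)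
Lemma powR_split (r W x y : R) : 1 < r -> 0 < W -> 0 < x -> x `^ r <= y ->
  x <= W `^ (r - 1)^-1 + y / W.
Proof.
move=> r1 W0 x0 xy; pose t := W `^ (r - 1)^-1.
have r10 : 0 < r - 1 by rewrite subr_gt0.
have tW : t `^ (r - 1) = W by rewrite -powRrM mulVf ?gt_eqF// powRr1// ltW.
have y0 : 0 <= y by apply: le_trans xy; exact: powR_ge0.
have t0 : 0 <= t by exact: powR_ge0.
have [xt|tx] := leP x t.
  by apply: le_trans xt _; rewrite lerDl divr_ge0// ltW.
suff : x <= y / W by move=> H; apply: le_trans H _; rewrite lerDr.
rewrite ler_pdivlMr//; apply: le_trans xy.
rewrite -[in leRHS](subrK 1 r) powRD; last by rewrite (gt_eqF x0) implybT.
rewrite powRr1; last exact: ltW.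
rewrite mulrC ler_pM2r// -tW.
by apply: ge0_ler_powR; rewrite ?nnegrE //; exact: ltW.
Qed.

(** Off a null set [g] is at most [t0] plus the potential of [p] divided by [W]. The potential
    integrates to a mutual energy bounded by [B2], and the constant part is small because the mass
    of the tail is. *)
Lemma weight_tail_potential (r e : R) (p n : meas X R) : 1 < r -> Defs.inE kappa p n ->
  nearly_everywhere kappa S (fun x => ((g x `^ r)%:E <= kpot kappa x p - kpot kappa x n)%E) ->
  0 < e ->
  exists K, compact K /\ forall t, (\int[u t]_(x in S `\` K) (g x)%:E <= e%:E)%E.
Proof.
move=> r1 [Ep _ _] ne e0; have [rp _] := Ep.
pose B2 := `|B| + en kappa p p + 1.
have enp := en_ge0 SK p p.
have B20 : 0 < B2 by rewrite ltr_wpDl// addr_ge0.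
(* [W] comes first and makes the potential part [B2 / W = e / 2]; [K] is then chosen for the
   threshold [t0] that [W] determines. *)
pose W := 2 * B2 / e.
have W0 : 0 < W by rewrite divr_gt0// mulr_gt0.
pose t0 := W `^ (r - 1)^-1.
have t00 : 0 < t0 by exact: powR_gt0.
have k0 x y : (0 <= kappa x y)%E by have [+ _ _ _ _] := SK; exact.
have klsc : lower_semicontinuous (fun z : X * X => kappa z.1 z.2) by have [] := SK.
have mp := measurable_kpot hX k0 klsc rp.
have Up0 := kpot_ge0 k0 p.
pose f (x : borel X) : \bar R := (t0%:E + (W^-1)%:E * kpot kappa x p)%E.
have Wi0 : 0 <= W^-1 by rewrite invr_ge0 ltW.
have mf : measurable_fun [set: borel X] f.
  by apply: emeasurable_funD => //; exact: measurable_funeM.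
have f0 x : (0 <= f x)%E.
  by rewrite adde_ge0// ?mule_ge0// ?lee_fin// ltW.
have [|K [cK uK]] := @mass_tail (e / (2 * t0)); first by rewrite divr_gt0// mulr_gt0.
exists K; split => // t; have mK := mtail cK; have [rt _] := Eu t.
pose Z : set (borel X) := (S `\` K) `&` [set x | (f x < (g x)%:E)%E].
have mZ : measurable Z.
  by apply: measurable_lte => //; [exact: measurable_funTS|exact: mgt].
(* [Z] lies in the exceptional set of capacity zero: elsewhere [g ^ r] is at most the potential of
   [p], that of [n] being nonnegative, and [powR_split] applies. *)
have Z0 : u t Z = 0%E.
  apply: (capacity0_null hX SK _ mZ ne (Eu t)).
    move=> x [[Sx _] /= fg]; split => // gp; move: fg; apply/negP; rewrite -leNgt /f.
    have gx0 : 0 < g x by apply: lt_le_trans (gc Sx).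
    have {gp} : ((g x `^ r)%:E <= kpot kappa x p)%E.
      by apply: le_trans gp _; rewrite geeDl// oppe_le0 kpot_ge0.
    have := Up0 x; case: (kpot kappa x p) => [y| |//] y0.
      by rewrite lee_fin => /(powR_split r1 W0 gx0); rewrite -EFinM -EFinD lee_fin mulrC.
    by move=> _; rewrite gt0_muley ?lte_fin ?invr_gt0// addey// leey.
  apply: le_lt_trans (utail_fin t cK).
  by apply: (le_bmeasure (u t) mZ mK) => x [].
apply: (@le_trans _ _ (\int[u t]_(x in S `\` K) f x)%E).
  apply: ae_ge0_le_integral => //.
  - by move=> x [Sx _]; exact: (weight_ge0 c0 gc).
  - exact: mgt.
  - exact: measurable_funTS.
  exists Z; split => // x /= /not_implyP[SKx gf]; split => //=.
  by rewrite ltNge; apply/negP.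
apply: (@le_trans _ _ (\int[u t]_(x in S `\` K) t0%:E +
    \int[u t]_(x in S `\` K) ((W^-1)%:E * kpot kappa x p))%E).
  rewrite ge0_integralD//.
  - by move=> x _; rewrite lee_fin ltW.
  - by move=> x _; rewrite mule_ge0.
  - by apply: measurable_funTS; exact: measurable_funeM.
apply: (@le_trans _ _ ((e / 2)%:E + (e / 2)%:E)%E); last by rewrite -EFinD -splitr.
apply: leeD.
  rewrite integral_cst//; apply: (@le_trans _ _ (t0%:E * (e / (2 * t0))%:E)%E).
    by apply: lee_pmul => //; rewrite lee_fin ltW.
  rewrite -EFinM lee_fin (_ : t0 * _ = e / 2)//.
  by field; rewrite gt_eqF.
rewrite ge0_integralZl//; last exact: measurable_funTS.
apply: (@le_trans _ _ ((W^-1)%:E * B2%:E)%E).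
  apply: lee_pmul => //; first by apply: integral_ge0 => x _.
  apply: (@le_trans _ _ (kap kappa (u t) p)).
    by apply: ge0_subset_integral.
  have [_ le] := Eplus_kap_fin hX SK (Eu t) Ep; apply: le_trans le _.
  rewrite !(enE hX SK)// -EFinD lee_fin /B2 -addrA lerD//.
    by apply: le_trans (uB t) (ler_norm _).
  by rewrite lerDl.
rewrite -EFinM lee_fin /W (_ : _^-1 * _ = e / 2)//.
by field; rewrite !gt_eqF.
Qed.

End weight_tail.

(** * Algebra of sums, multiples and midpoints of measures *)

Section measure_identities.
Context {R : realType} {X : ptopologicalType}.
Implicit Types (m p q : meas X R).
Local Open Scope ereal_scope.

Lemma measure_ext m1 m2 : (forall B, m1 B = m2 B) -> m1 = m2.
Proof. by move=> m12; apply: eq_measure; apply/funext => B; exact: m12. Qed.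

Lemma addmC m1 m2 : addm m1 m2 = addm m2 m1.
Proof. by apply: measure_ext => B; rewrite !addmE addeC. Qed.

Lemma addmA m1 m2 m3 : addm m1 (addm m2 m3) = addm (addm m1 m2) m3.
Proof. by apply: measure_ext => B; rewrite !addmE addeA. Qed.

Lemma addmAC m1 m2 m3 : addm (addm m1 m2) m3 = addm (addm m1 m3) m2.
Proof. by apply: measure_ext => B; rewrite !addmE addeAC. Qed.

Lemma halfm_addm p1 p2 q1 q2 :
  halfm (addm p1 q1) (addm p2 q2) = addm (halfm p1 p2) (halfm q1 q2).
Proof.
apply: measure_ext => B; rewrite addmE !halfmE !addmE.
by rewrite !ge0_muleDr// addeACA.
Qed.

Lemma halfmm m : halfm m m = m.
Proof.
apply: measure_ext => B; rewrite halfmE -ge0_muleDl ?lee_fin//.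
by rewrite -EFinD (_ : (_ + _)%R = 1%R) ?mul1e//; field.
Qed.

Lemma halfm_scalem m1 m2 : halfm m1 m2 = scalem (NngNum (half_ge0 R)) (addm m1 m2).
Proof. by apply: measure_ext => B; rewrite halfmE scalemE addmE ge0_muleDr. Qed.

Lemma integral_addm m1 m2 (S : set X) (f : X -> \bar R) : bmeasurable S ->
  measurable_fun (S : set (borel X)) (f : borel X -> \bar R) ->
  (forall x, S x -> 0 <= f x) ->
  \int[addm m1 m2]_(x in S) f x = \int[m1]_(x in S) f x + \int[m2]_(x in S) f x.
Proof. by move=> mS mf f0; exact: ge0_integral_measure_add. Qed.

Lemma integral_scalem r m (S : set X) (f : X -> \bar R) : bmeasurable S ->
  measurable_fun (S : set (borel X)) (f : borel X -> \bar R) ->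
  (forall x, S x -> 0 <= f x) ->
  \int[scalem r m]_(x in S) f x = r%:num%:E * \int[m]_(x in S) f x.
Proof. by move=> mS mf f0; exact: ge0_integral_mscale. Qed.

Lemma integral_halfm m1 m2 (S : set X) (f : X -> \bar R) : bmeasurable S ->
  measurable_fun (S : set (borel X)) (f : borel X -> \bar R) ->
  (forall x, S x -> 0 <= f x) ->
  \int[halfm m1 m2]_(x in S) f x =
  (2^-1)%:E * \int[m1]_(x in S) f x + (2^-1)%:E * \int[m2]_(x in S) f x.
Proof. by move=> mS mf f0; rewrite integral_addm// !integral_scalem. Qed.

Section family_identities.
Context {I : countType}.
Implicit Types (D : set I) (mu : I -> meas X R).

Lemma famsum_addm D mu1 mu2 : famsum D (fun i => addm (mu1 i) (mu2 i)) =
  addm (famsum D mu1) (famsum D mu2).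
Proof.
apply: measure_ext => B; rewrite addmE !famsumE -esumD//.
by apply: eq_esum => i _; exact: addmE.
Qed.

Lemma famsum_scalem r D mu : famsum D (fun i => scalem r (mu i)) = scalem r (famsum D mu).
Proof.
apply: measure_ext => B; rewrite scalemE !famsumE.
rewrite -esum_pickle// -[in RHS]esum_pickle// -nneseriesZl//; last first.
  by move=> k _; case: pickle_inv => //= i; case: ifP.
by apply: eq_eseriesr => k _; case: pickle_inv => [i|]/=; first case: ifP; rewrite ?mule0.
Qed.

Lemma famsum_halfm D mu1 mu2 : famsum D (fun i => halfm (mu1 i) (mu2 i)) =
  halfm (famsum D mu1) (famsum D mu2).
Proof. by rewrite famsum_addm !famsum_scalem. Qed.

Lemma famsum_rem D mu i : D i -> famsum D mu = addm (famsum (D `\ i) mu) (mu i).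
Proof.
move=> Di; apply: measure_ext => B; rewrite addmE !famsumE (esumID [set i])// addeC.
congr (_ + _); rewrite (_ : D `&` [set i] = [set i]) ?esum_set1//.
by apply/seteqP; split => [j []//|j ->].
Qed.

Lemma eq_famsum D mu nu : (forall i, D i -> mu i = nu i) -> famsum D mu = famsum D nu.
Proof. by move=> e; apply: measure_ext => B; rewrite !famsumE; apply: eq_esum => i /e ->. Qed.

Lemma famsumID D S mu : famsum D mu = addm (famsum (D `&` S) mu) (famsum (D `&` ~` S) mu).
Proof. by apply: measure_ext => B; rewrite addmE !famsumE (esumID S). Qed.

Lemma famsum0 D mu B : (forall i, D i -> mu i B = 0) -> famsum D mu B = 0.
Proof. by move=> m0; rewrite famsumE esum1. Qed.

End family_identities.

Lemma famsum_image (J K : countType) (f : J -> K) (D : set J) (m : K -> meas X R) :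
  injective f -> famsum (f @` D) m = famsum D (m \o f).
Proof.
move=> fI; apply: measure_ext => B; rewrite !famsumE esum_image// => i j _ _; exact: fI.
Qed.

Lemma famsum_option (J : countType) (D : set (option J)) (m : option J -> meas X R) :
  D None -> famsum D m = addm (famsum (Some @^-1` D) (m \o Some)) (m None).
Proof.
move=> DN; rewrite (famsum_rem _ DN); congr addm.
rewrite (_ : D `\ None = Some @` (Some @^-1` D)); first by rewrite famsum_image// => i j [].
by apply/seteqP; split => [[j [Dj _]|[_ []]//]|_ [j Dj <-]]; [exists j|split].
Qed.

Lemma famsum_sum (J K : countType) (D : set (J + K)) (m : J + K -> meas X R) :
  famsum D m = addm (famsum (inl @^-1` D) (m \o inl)) (famsum (inr @^-1` D) (m \o inr)).
Proof.
rewrite (famsumID D (range inl)); congr addm.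
  rewrite (_ : D `&` range inl = inl @` (inl @^-1` D)); first by rewrite famsum_image// => i j [].
  apply/seteqP; split => [x [Dx [j _ jx]]|_ [j Dj <-]]; first by exists j => //=; rewrite jx.
  by split => //; exists j.
rewrite (_ : D `&` ~` range inl = inr @` (inr @^-1` D)); first by rewrite famsum_image// => i j [].
apply/seteqP; split => [[j [_ []]|k [Dk _]]|_ [k Dk <-]]; [by exists j|by exists k|].
by split => // -[].
Qed.

End measure_identities.

Section energy_bounds.
Context {R : realType} {X : ptopologicalType}.
Variables (kappa : X -> X -> \bar R) (h : R).
Hypothesis hX : hausdorff_space X.
Hypothesis SK : standing_kernel kappa h.
Local Notation E := (Eplus kappa).
Local Notation en := (en kappa).
Local Notation sqd := (sqd kappa).
Local Notation dist := (dist kappa).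

Lemma sqd_halfm p q n m : E p -> E q -> E n -> E m ->
  sqd (halfm p q) (halfm n m) =
  (2 * sqd p n + 2 * sqd q m - sqd (addm p m) (addm n q)) / 4.
Proof.
move=> Ep Eq En Em; rewrite !halfm_scalem (sqd_scalem hX SK)//; try exact: (Eplus_addm hX SK).
rewrite -(parallelogram hX SK Ep En Eq Em) /=.
by move: (sqd _ _) (sqd _ _) => x y; field.
Qed.

Lemma enB_self p n : E p -> E n -> enB kappa p n p n = sqd p n.
Proof.
move=> Ep En; rewrite /enB (enC hX SK En Ep); change (sqd p n) with (en p p + en n n - 2 * en p n).
by move: (en p p) (en n n) (en p n) => x y z; ring.
Qed.

Lemma enBC p n p' n' : E p -> E n -> E p' -> E n' ->
  enB kappa p n p' n' = enB kappa p' n' p n.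
Proof.
move=> Ep En Ep' En'; rewrite /enB (enC hX SK Ep Ep') (enC hX SK En En').
rewrite (enC hX SK Ep En') (enC hX SK En Ep').
by move: (en p' p) (en n' n) (en n' p) (en p' n) => x y z w; ring.
Qed.

(** The kernel is nonnegative, so the other terms only add energy. *)
Lemma Eplus_addml p q : radon p -> radon q -> E (addm p q) ->
  E p /\ en p p <= en (addm p q) (addm p q).
Proof.
move=> rp rq Epq; have [rpq fpq] := Epq.
have le : (kap kappa p p <= kap kappa (addm p q) (addm p q))%E.
  rewrite (kap_addml hX SK)// (kap_addmr hX SK)//.
  apply: (@le_trans _ _ (kap kappa p p + kap kappa p q)%E).
    by rewrite leeDl//; exact: (energy_ge0 SK).
  by rewrite leeDl//; exact: (energy_ge0 SK).
have Ep : E p by split => //; exact: le_lt_trans le fpq.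
by split => //; move: le; rewrite !(enE hX SK)// lee_fin.
Qed.

Lemma Eplus_addmr p q : radon p -> radon q -> E (addm p q) ->
  E q /\ en q q <= en (addm p q) (addm p q).
Proof.
by move=> rp rq; rewrite addmC; exact: Eplus_addml.
Qed.

Lemma kap_le_mass (mu nu : meas X R) (S T : set X) (M : R) : radon nu -> 0 <= M ->
  bmeasurable S -> bmeasurable T ->
  mu (~` S) = 0%E -> nu (~` T) = 0%E ->
  (forall x y, S x -> T y -> (kappa x y <= M%:E)%E) ->
  (kap kappa mu nu <= M%:E * nu setT * mu setT)%E.
Proof.
move=> rn M0 mS mT muS nuT SM.
have k0 x y : (0 <= kappa x y)%E by have [+ _ _ _ _] := SK; exact.
have klsc : lower_semicontinuous (fun z : X * X => kappa z.1 z.2) by have [] := SK.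
have mk := measurable_kpot hX k0 klsc rn.
have mST : bmeasurable (~` S) by exact: measurableC.
have mTT : bmeasurable (~` T) by exact: measurableC.
rewrite /kap -[X in (_ <= X * _)%E]gee0_abs; last by rewrite mule_ge0.
apply: (@le_trans _ _ (\int[mu]_x (M%:E * nu setT))%E); last first.
  by rewrite integral_cst// gee0_abs// mule_ge0.
apply: ae_ge0_le_integral => //.
- by move=> x _; exact: (kpot_ge0 k0 nu x).
- by move=> x _; rewrite mule_ge0.
exists (~` S); split => // x /= /not_implyP[_ nle] Sx; apply: nle.
apply: (@le_trans _ _ (\int[nu]_y M%:E)%E); last by rewrite integral_cst.
apply: ae_ge0_le_integral => //.
- exact: measurable_kernel.
exists (~` T); split => // y /= /not_implyP[_ nle] Ty; apply: nle.
exact: SM.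
Qed.

End energy_bounds.

Section families_limits.
Context {R : realType} {X : ptopologicalType}.
Local Open Scope ereal_scope.

Lemma weak_limit_famsum (T : Type) (F : set_system T) {FF : ProperFilter F} (I : countType)
    (D : set I) (u : T -> I -> meas X R) (v : I -> meas X R) (b : I -> \bar R) :
  hausdorff_space X ->
  (forall i, weak_limit F (fun t => u t i) (v i)) ->
  (forall t i, D i -> u t i setT <= b i) -> (forall i, 0 <= b i) ->
  \esum_(i in D) b i < +oo ->
  weak_limit F (fun t => famsum D (u t)) (famsum D v).
Proof.
move=> hX wl ub b0 bfin.
apply: (@weak_limit_seriesm _ _ _ F _ _ _
  (fun k => oapp (fun i => if i \in D then b i else 0) 0 (pickle_inv k))) => //.
- move=> k; case: pickle_inv => [i|]/=; first case: ifP => // _.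
  + by split => K r _ r0; near=> t.
  + by split => K r _ r0; near=> t.
- move=> t k; case: pickle_inv => //= i; case: ifP => // /set_mem; exact: ub.
- by rewrite esum_pickle.
- by move=> k; case: pickle_inv => //= i; case: ifP.
Unshelve. all: by end_near.
Qed.

End families_limits.

(** * The Gauss variational problem *)

Section gauss_problem.
Context {R : realType} {X : ptopologicalType} {I : countType}.
Variables (kappa : X -> X -> \bar R) (h : R) (sg : I -> bool) (A : I -> set X)
  (cp cn : meas X R) (g : X -> R) (l : I) (a : I -> R) (c : R).
Hypothesis hX : hausdorff_space X.
Hypothesis SK : standing_kernel kappa h.
Hypothesis cond : condenser kappa sg A.
Hypothesis chi : external_field kappa sg A cp cn.
Hypothesis gA : {within Aall A, continuous g}.
Hypothesis c0 : 0 < c.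
Hypothesis cg : forall x, Aall A x -> c <= g x.
Hypothesis sl : ~~ sg l.
Hypothesis Al : forall i, i <> l -> A i `&` A l = set0.
Hypothesis afin : (\esum_(i in [set: I]) (a i)%:E < +oo)%E.
Hypothesis a0 : forall i, 0 < a i.
Local Notation E := (Eplus kappa).
Local Notation en := (en kappa).
Local Notation sqd := (sqd kappa).
Local Notation dist := (dist kappa).
Implicit Types (mu nu : I -> meas X R) (m : meas X R).

Let cA i : closed (A i). Proof. by have [+ _ _ _] := cond => /(_ i)[]. Qed.
Let mA i : bmeasurable (A i). Proof. exact: closed_bmeasurable. Qed.
Let gAi i : {within A i, continuous g}.
Proof. by apply: continuous_subspaceW gA => x Ax; exists i. Qed.
Let cgi i x : A i x -> c <= g x. Proof. by move=> Ax; apply: cg; exists i. Qed.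
Let mg i : measurable_fun (A i : set (borel X)) ((fun x => (g x)%:E) : borel X -> \bar R).
Proof. exact: measurable_weight. Qed.
Let g0 i x : A i x -> (0 <= (g x)%:E)%E.
Proof. exact: (weight_ge0 c0 (@cgi i)). Qed.
Let Ep : E cp. Proof. by have [[]] := chi. Qed.
Let En : E cn. Proof. by have [[]] := chi. Qed.

Local Notation gint i m := (\int[m]_(x in A i) (g x)%:E)%E.

Definition positive_part mu := famsum [set i | sg i] mu.
Definition negative_part mu := famsum [set i | ~~ sg i] mu.
Definition negative_rest mu := famsum ([set i | ~~ sg i] `\ l) mu.
(* ||R mu + chi||^2, that is G_chi mu + ||chi||^2 *)
Definition field_energy mu :=
  sqd (addm (positive_part mu) cp) (addm (negative_part mu) cn).
Definition upd mu m i := if i == l then m else mu i.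
Definition midfamily mu nu i : meas X R := halfm (mu i) (nu i).

(** The class with constraints on all indices but [l], with finite energy expressed through the sums
    of the two parts ([candidate_class]). The component of index [l] may have infinite mass. *)
Definition candidate mu :=
  [/\ (forall i, radon (mu i)), (forall i, mu i (~` A i) = 0%E),
     E (positive_part mu), E (negative_part mu) &
     forall i, i <> l -> gint i (mu i) = (a i)%:E].

Lemma concentrated_null i m : concentrated m (A i) <-> m (~` A i) = 0%E.
Proof.
split=> [[B [mB BA B0]]|m0]; last by exists (A i); split; [exact: mA|exact: subset_refl|].
apply/eqP; rewrite eq_le measure_ge0 andbT -B0.
have mAC : bmeasurable (~` A i) by apply: measurableC; exact: mA.
have mBC : bmeasurable (~` B) by exact: measurableC.
by apply: (le_bmeasure m mAC mBC); exact: subsetC.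
Qed.

(** Here [inf g > 0] enters: mass is at most [g]-mass divided by [c]. *)
Lemma component_mass mu i : mu i (~` A i) = 0%E -> (gint i (mu i) <= (a i)%:E)%E ->
  (mu i setT <= (a i / c)%:E)%E.
Proof.
move=> m0 ma; have := le_trans (mass_le_weight (@cA i) (@gAi i) c0 (@cgi i) m0) ma.
case: (mu i setT) (measure_ge0 (mu i) setT) => [r _|_|].
- by rewrite -EFinM !lee_fin ler_pdivlMr// mulrC.
- by rewrite gt0_muley ?lte_fin// leye_eq.
- by rewrite leNye.
Qed.

Lemma mass_bound_fin D : (\esum_(i in D) (a i / c)%:E < +oo)%E.
Proof.
apply: (@le_lt_trans _ _ ((c^-1)%:E * \esum_(i in [set: I]) (a i)%:E)%E); last first.
  by apply: lte_mul_pinfty => //; rewrite lee_fin invr_ge0 ltW.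
have a0' i : (0 <= (a i)%:E)%E by rewrite lee_fin ltW.
have ac0 i : (0 <= (a i / c)%:E)%E by rewrite lee_fin divr_ge0// ltW.
rewrite -!esum_pickle// -nneseriesZl; last first.
  by move=> k _; case: pickle_inv => //= i; case: ifP.
apply: lee_nneseries => k _; first by case: pickle_inv => //= i; case: ifP.
case: pickle_inv => [i|]/=; last by rewrite mule0.
rewrite in_setT; case: ifP => _; first by rewrite -EFinM mulrC.
by rewrite mule_ge0// lee_fin invr_ge0 ltW.
Qed.

Definition total_mass : R := fine (\esum_(i in [set: I]) (a i / c)%:E).

Lemma famsum_mass D mu : (forall i, (mu i setT <= (a i / c)%:E)%E) ->
  (famsum D mu setT <= total_mass%:E)%E.
Proof.
move=> mm; rewrite famsumE fineK; last first.
  rewrite ge0_fin_numE ?mass_bound_fin//.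
  by apply: esum_ge0 => i _; rewrite lee_fin divr_ge0// ltW.
rewrite esum_mkcond; apply: le_esum => i _; case: ifP => // _.
by rewrite lee_fin divr_ge0// ltW.
Qed.

Lemma radon_famsum_mass D mu : (forall i, radon (mu i)) ->
  (forall i, i <> l -> (mu i setT <= (a i / c)%:E)%E) -> radon (famsum D mu).
Proof.
move=> rm mm; apply: (@radon_famsum _ _ _ _ _ l) => //.
by apply: le_lt_trans (mass_bound_fin (D `\ l)); apply: le_esum => i [_ il]; exact: mm.
Qed.

Lemma radon_part D mu : (forall i, radon (mu i)) -> (forall i, mu i (~` A i) = 0%E) ->
  (forall i, i <> l -> gint i (mu i) = (a i)%:E) -> radon (famsum D mu).
Proof.
move=> rm m0 ma; apply: radon_famsum_mass => // i il.
by apply: component_mass => //; rewrite ma.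
Qed.

Lemma positive_part_upd mu m : positive_part (upd mu m) = positive_part mu.
Proof.
apply: eq_famsum => i /= si; rewrite /upd; case: eqP => // il.
by move: sl; rewrite -il si.
Qed.

Lemma negative_partE mu : negative_part mu = addm (negative_rest mu) (mu l).
Proof. exact: famsum_rem. Qed.

Lemma negative_part_upd mu m : negative_part (upd mu m) = addm (negative_rest mu) m.
Proof.
rewrite negative_partE /upd eqxx; congr addm.
by apply: eq_famsum => i [_ /eqP/negbTE ->].
Qed.

Lemma candidate_class mu : EplusAag kappa sg A g a [set i | i <> l] mu <-> candidate mu.
Proof.
split.
  move=> [[rc fe] ma]; have rm i := (rc i).1.
  have m0 i : mu i (~` A i) = 0%E by apply/concentrated_null; exact: (rc i).2.
  have := (Eplus_famsum hX SK rm (radon_part _ rm m0 ma) (radon_part _ rm m0 ma)).1 fe.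
  by case.
move=> [rm m0 EP EN ma]; split => //; split.
  by move=> i; split => //; apply/concentrated_null.
by apply/(Eplus_famsum hX SK rm); [case: EP|case: EN|].
Qed.

Lemma candidate_full mu : EplusAag kappa sg A g a setT mu <->
  candidate mu /\ gint l (mu l) = (a l)%:E.
Proof.
rewrite -candidate_class; split => [[EA ma]|[[EA ma] mal]].
  by split; [split => // i _|]; exact: ma.
by split => // i _; have [->//|/eqP il] := eqVneq i l; exact: ma.
Qed.

Lemma field_positiveE : famsum [set j | chi_sign j] (chi_fam cp cn) = cp.
Proof.
apply: measure_ext => B; rewrite famsumE.
by rewrite (_ : [set _ | _] = [set true])// esum_set1.
Qed.

Lemma field_negativeE : famsum [set j | ~~ chi_sign j] (chi_fam cp cn) = cn.
Proof.
apply: measure_ext => B; rewrite famsumE.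
rewrite (_ : [set _ | _] = [set false]) ?esum_set1//.
by apply/seteqP; split => -[].
Qed.

Lemma GchiE mu : candidate mu ->
  Gchi kappa sg cp cn mu = (field_energy mu - sqd cp cn)%:E.
Proof.
move=> [rm m0 EP EN ma]; rewrite /Gchi.
have rP : radon (positive_part mu) by case: EP.
have rN : radon (negative_part mu) by case: EN.
have rchi b : radon (chi_fam cp cn b) by case: b => /=; [case: Ep|case: En].
rewrite (kpairE hX SK)// (kpairE hX SK) ?field_positiveE ?field_negativeE//.
rewrite -EFinM -EFinD; congr EFin.
rewrite -/(positive_part mu) -/(negative_part mu) /field_energy (sqd_addm hX SK)//.
rewrite (enB_self hX SK)// (enBC hX SK Ep En)//.
by move: (sqd _ _) (sqd cp cn) (enB _ _ _ _ _) => x y z; ring.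
Qed.

Lemma Gchi_le mu nu : candidate mu -> candidate nu ->
  (Gchi kappa sg cp cn mu <= Gchi kappa sg cp cn nu)%E = (field_energy mu <= field_energy nu).
Proof. by move=> cm cn'; rewrite !GchiE// lee_fin lerD2r. Qed.

Lemma candidate_Eplus mu : candidate mu ->
  E (addm (positive_part mu) cp) /\ E (addm (negative_part mu) cn).
Proof. by move=> [_ _ EP EN _]; split; exact: (Eplus_addm hX SK). Qed.

Lemma field_energy_ge0 mu : candidate mu -> 0 <= field_energy mu.
Proof. by move=> /candidate_Eplus[EP EN]; exact: (sqd_ge0 hX SK). Qed.

Lemma radon_rest mu : candidate mu -> radon (negative_rest mu).
Proof. by move=> [rm m0 _ _ ma]; exact: radon_part. Qed.

Lemma candidate_rest mu : candidate mu -> E (negative_rest mu) /\ E (mu l).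
Proof.
move=> cm; have [rm m0 _ EN ma] := cm; have rr := radon_rest cm.
move: EN; rewrite negative_partE => EN.
by have [] := Eplus_addml hX SK rr (rm l) EN; have [] := Eplus_addmr hX SK rr (rm l) EN.
Qed.

Lemma candidate_upd mu m : candidate mu -> E m -> m (~` A l) = 0%E -> candidate (upd mu m).
Proof.
move=> cm Em ml; have [rm m0 EP EN ma] := cm.
split.
- by move=> i; rewrite /upd; case: eqP => // _; case: Em.
- by move=> i; rewrite /upd; case: eqP => // ->.
- by rewrite positive_part_upd.
- by rewrite negative_part_upd; apply: (Eplus_addm hX SK) => //; exact: (candidate_rest cm).1.
- by move=> i il; rewrite /upd; case: eqP => // _; exact: ma.
Qed.

Lemma positive_part_mid mu nu :
  positive_part (midfamily mu nu) = halfm (positive_part mu) (positive_part nu).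
Proof. exact: famsum_halfm. Qed.

Lemma negative_part_mid mu nu :
  negative_part (midfamily mu nu) = halfm (negative_part mu) (negative_part nu).
Proof. exact: famsum_halfm. Qed.

Lemma gint_mid i mu nu : gint i (midfamily mu nu i) =
  ((2^-1)%:E * gint i (mu i) + (2^-1)%:E * gint i (nu i))%E.
Proof. by apply: integral_halfm => // x /g0. Qed.

Lemma candidate_mid mu nu : candidate mu -> candidate nu -> candidate (midfamily mu nu).
Proof.
move=> [rm m0 EP EN ma] [rn n0 EP' EN' na]; split.
- by move=> i; apply: radon_addm => //; exact: radon_scalem.
- by move=> i; rewrite /midfamily halfmE m0 n0 !mule0 adde0.
- by rewrite positive_part_mid; exact: (Eplus_halfm hX SK).
- by rewrite negative_part_mid; exact: (Eplus_halfm hX SK).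
- move=> i il; rewrite gint_mid ma// na// -!EFinM -EFinD; congr EFin.
  by move: (a i) => x; field.
Qed.

Lemma field_energy_mid mu nu : candidate mu -> candidate nu ->
  field_energy (midfamily mu nu) =
  (2 * field_energy mu + 2 * field_energy nu -
   sqd (addm (addm (positive_part mu) cp) (addm (negative_part nu) cn))
       (addm (addm (negative_part mu) cn) (addm (positive_part nu) cp))) / 4.
Proof.
move=> /candidate_Eplus[EP EN] /candidate_Eplus[EP' EN'].
rewrite -(sqd_halfm hX SK)// !halfm_addm !halfmm.
by rewrite -positive_part_mid -negative_part_mid.
Qed.

Lemma field_energy_mid_le mu nu : candidate mu -> candidate nu ->
  field_energy (midfamily mu nu) <= (field_energy mu + field_energy nu) / 2.
Proof.
move=> cm cn'; have [EP EN] := candidate_Eplus cm; have [EP' EN'] := candidate_Eplus cn'.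
rewrite field_energy_mid//.
have := sqd_ge0 hX SK (Eplus_addm hX SK EP EN') (Eplus_addm hX SK EN EP').
move: (sqd _ _) (field_energy mu) (field_energy nu) => x y z x0; lra.
Qed.

Definition minimal mu := candidate mu /\
  forall nu, candidate nu -> field_energy mu <= field_energy nu.

Lemma solvesP mu : solves kappa sg A cp cn g a [set i | i <> l] mu <-> minimal mu.
Proof.
split=> [[/candidate_class cm min]|[cm min]].
  by split => // nu cn'; rewrite -(Gchi_le cm cn'); apply: min; exact/candidate_class.
split; first exact/candidate_class.
by move=> nu /candidate_class cn'; rewrite (Gchi_le cm cn'); exact: min.
Qed.

Lemma positive_part_null mu B : candidate mu -> bmeasurable B -> B `<=` A l ->
  positive_part mu B = 0%E.
Proof.
move=> [_ m0 _ _ _] mB BA; apply: famsum0 => i /= si.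
have il : i <> l by move=> il; move: sl; rewrite -il si.
apply/eqP; rewrite eq_le measure_ge0 andbT -(m0 i).
apply: (le_bmeasure (mu i) mB (measurableC (mA i))) => x Bx Ai.
have : (A i `&` A l) x by split => //; exact: BA.
by rewrite Al.
Qed.

Lemma negative_rest_null mu B : candidate mu -> bmeasurable B -> B `<=` A l ->
  negative_rest mu B = 0%E.
Proof.
move=> [_ m0 _ _ _] mB BA; apply: famsum0 => i [_ il].
apply/eqP; rewrite eq_le measure_ge0 andbT -(m0 i).
apply: (le_bmeasure (mu i) mB (measurableC (mA i))) => x Bx Ai.
have : (A i `&` A l) x by split => //; exact: BA.
by rewrite Al.
Qed.

(* The two halves of the parallelogram identity force P mu + N nu = N mu + P nu,
   and on A l only the components of index l survive. *)
Lemma minimal_unique mu nu B : minimal mu -> minimal nu ->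
  bmeasurable B -> B `<=` A l -> mu l B = nu l B.
Proof.
move=> [cm mm] [cn' mn] mB BA.
have [EP EN] := candidate_Eplus cm; have [EP' EN'] := candidate_Eplus cn'.
have EPN := Eplus_addm hX SK EP EN'; have ENP := Eplus_addm hX SK EN EP'.
have s0 := sqd_ge0 hX SK EPN ENP.
have : sqd (addm (addm (positive_part mu) cp) (addm (negative_part nu) cn))
    (addm (addm (negative_part mu) cn) (addm (positive_part nu) cp)) = 0.
  have := mm _ (candidate_mid cm cn'); have := mn _ cm; have := mm _ cn'.
  rewrite field_energy_mid//; move: s0.
  move: (sqd _ _) (field_energy mu) (field_energy nu) => x y z x0 A1 A2 A3; lra.
move=> /(sqd_eq0 hX SK EPN ENP)/(_ B mB).
rewrite !negative_partE !addmE !positive_part_null// !negative_rest_null// !add0e.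
(* The field is bounded, so its masses on [B] are finite and cancel in the extended reals; those of
   the components may be infinite. *)
have cpB : (cp B <= cp setT)%E by exact: (le_bmeasure cp mB measurableT).
have cnB : (cn B <= cn setT)%E by exact: (le_bmeasure cn mB measurableT).
have [_ [cpT cnT] _ _ _] := chi.
have cpf : cp B \is a fin_num by rewrite ge0_fin_numE//; exact: le_lt_trans cpT.
have cnf : cn B \is a fin_num by rewrite ge0_fin_numE//; exact: le_lt_trans cnT.
rewrite -(fineK cpf) -(fineK cnf); move: (fine _) (fine _) => s t.
case: (mu l B) => [x| |]; case: (nu l B) => [y| |] //.
by rewrite -!EFinD => -[] e; congr EFin; lra.
Qed.

(** The cap on index [l] bounds the total mass, which provides vague compactness; unlike the
    equality, it passes to weak limits. *)
Definition subcandidate mu := candidate mu /\ (gint l (mu l) <= (a l)%:E)%E.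

Lemma subcandidate_mass mu i : subcandidate mu -> (mu i setT <= (a i / c)%:E)%E.
Proof.
move=> [[_ m0 _ _ ma] mal]; apply: component_mass => //.
by have [->//|/eqP il] := eqVneq i l; rewrite ma.
Qed.

Lemma subcandidate_mid mu nu : subcandidate mu -> subcandidate nu ->
  subcandidate (midfamily mu nu).
Proof.
move=> [cm ml] [cn' nl]; split; first exact: candidate_mid.
rewrite gint_mid; apply: (@le_trans _ _ ((2^-1)%:E * (a l)%:E + (2^-1)%:E * (a l)%:E)%E).
  by apply: leeD; apply: lee_wpmul2l => //; rewrite lee_fin invr_ge0.
by rewrite -!EFinM -EFinD lee_fin; move: (a l) => x; lra.
Qed.

Lemma component_energy mu i : candidate mu -> E (mu i) /\
  en (mu i) (mu i) <= en (positive_part mu) (positive_part mu) +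
                      en (negative_part mu) (negative_part mu).
Proof.
move=> [rm m0 EP EN ma].
have rD D : radon (famsum D mu) by exact: radon_part.
have P0 := en_ge0 SK (positive_part mu) (positive_part mu).
have N0 := en_ge0 SK (negative_part mu) (negative_part mu).
case si: (sg i).
  have e : positive_part mu = addm (famsum ([set i | sg i] `\ i) mu) (mu i) by exact: famsum_rem.
  move: EP P0; rewrite e => EP P0.
  have [Ei le] := Eplus_addmr hX SK (rD _) (rm i) EP.
  by split => //; apply: le_trans le _; rewrite lerDl.
have e : negative_part mu = addm (famsum ([set i | ~~ sg i] `\ i) mu) (mu i).
  by apply: famsum_rem => /=; rewrite si.
move: EN N0; rewrite e => EN N0.
have [Ei le] := Eplus_addmr hX SK (rD _) (rm i) EN.
by split => //; apply: le_trans le _; rewrite lerDr.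
Qed.

Lemma measurable_union (D : set I) : bmeasurable (\bigcup_(i in D) A i).
Proof.
rewrite (bigcup_mkcond D A); apply: countable_bigcupT_measurable; first exact: countableP.
by move=> i; case: ifP => _; [exact: mA|exact: measurable0].
Qed.

Lemma famsum_null D mu : (forall i, mu i (~` A i) = 0%E) ->
  famsum D mu (~` \bigcup_(i in D) A i) = 0%E.
Proof.
move=> m0; apply: famsum0 => i Di; apply/eqP; rewrite eq_le measure_ge0 andbT -(m0 i).
apply: (le_bmeasure (mu i) (measurableC (measurable_union D)) (measurableC (mA i))).
by apply: subsetC => x Ax; exists i.
Qed.

(** [field_energy] controls the charge P - N only. The bound on [kappa] over A+ x A- controls the
    mutual energy of P and N, and their energies add up to the squared distance plus twice that
    mutual energy. *)
Lemma subcandidate_bounded r : exists B, forall mu, subcandidate mu -> field_energy mu <= r ->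
  en (positive_part mu) (positive_part mu) + en (negative_part mu) (negative_part mu) <= B.
Proof.
have [_ _ _ [M kM]] := cond.
exists ((Num.sqrt r + dist cn cp) ^+ 2 + 2 * (`|M| * total_mass * total_mass)) => mu sm mr.
have [cm _] := sm; have [rm m0 EP EN ma] := cm.
set P := positive_part mu; set N := negative_part mu.
have [EPc ENc] := candidate_Eplus cm.
have dPN : dist P N <= Num.sqrt r + dist cn cp.
  rewrite -(dist_addl hX SK EP EN Ep).
  apply: le_trans (dist_triangle hX SK EPc ENc (Eplus_addm hX SK EN Ep)) _.
  apply: lerD; first exact: ler_wsqrtr.
  by rewrite (addmC N cn) (addmC N cp) (dist_addl hX SK En Ep EN).
have s0 := sqd_ge0 hX SK EP EN.
have sPN : sqd P N <= (Num.sqrt r + dist cn cp) ^+ 2.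
  rewrite -(sqr_sqrtr s0); apply: lerXn2r dPN; rewrite nnegrE ?sqrtr_ge0//.
  by rewrite addr_ge0// sqrtr_ge0.
have T0 : 0 <= total_mass.
  by apply: fine_ge0; apply: esum_ge0 => i _; rewrite lee_fin divr_ge0// ltW.
have kPN : en P N <= `|M| * total_mass * total_mass.
  rewrite -lee_fin -(enE hX SK)//.
  apply: le_trans (kap_le_mass hX SK (M := `|M|) _ _ (measurable_union _) (measurable_union _)
    (famsum_null [set i | sg i] m0) (famsum_null [set i | ~~ sg i] m0) _) _ => //.
  - by case: EN.
  - by move=> x y Ax Ay; apply: le_trans (kM x y Ax Ay) _; rewrite lee_fin ler_norm.
  rewrite !EFinM; apply: lee_pmul; rewrite ?mule_ge0//.
    apply: lee_pmul => //; apply: famsum_mass => i; exact: subcandidate_mass.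
  apply: famsum_mass => i; exact: subcandidate_mass.
rewrite (_ : en P P + en N N = sqd P N + 2 * en P N); last first.
  by change (sqd P N) with (en P P + en N N - 2 * en P N); rewrite subrK.
by apply: lerD => //; rewrite ler_pM2l.
Qed.

Hypothesis gcond : forall i, (exists M : R, forall x, A i x -> `|g x| <= M) \/
  exists r : R, 1 < r /\ exists p n : meas X R, Defs.inE kappa p n /\
    nearly_everywhere kappa (A i)
      (fun x => ((g x `^ r)%:E <= kpot kappa x p - kpot kappa x n)%E).
Hypothesis capl : forall i, capacity kappa (A i) = +oo%E <-> i = l.

Lemma weight_tail (T : Type) (w : T -> I -> meas X R) i B e : i <> l ->
  (forall t, subcandidate (w t)) ->
  (forall t, en (positive_part (w t)) (positive_part (w t)) +
             en (negative_part (w t)) (negative_part (w t)) <= B) -> 0 < e ->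
  exists K, compact K /\ forall t, (\int[w t i]_(x in A i `\` K) (g x)%:E <= e%:E)%E.
Proof.
move=> il sw wB e0.
have cw t := component_energy i (sw t).1.
have capi : capacity kappa (A i) <> +oo%E by move/capl.
have wM t : (w t i setT <= (a i / c)%:E)%E by exact: subcandidate_mass.
have wB' t : en (w t i) (w t i) <= B by apply: le_trans (wB t); exact: (cw t).2.
have [[M gM]|[r [r1 [p [n [Epn ne]]]]]] := gcond i.
  exact: (weight_tail_bounded hX SK (@cA i) (@gAi i) c0 (@cgi i) (fun t => (cw t).1) wB' wM
    capi gM e0).
exact: (weight_tail_potential hX SK (@cA i) (@gAi i) c0 (@cgi i) (fun t => (cw t).1) wB' wM
    capi r1 Epn ne e0).
Qed.

Lemma exists_subminimal mu0 : subcandidate mu0 -> exists mu, subcandidate mu /\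
  forall nu, subcandidate nu -> field_energy mu <= field_energy nu.
Proof.
move=> s0; pose T := {mu | subcandidate mu}.
pose mid (x y : T) : T := exist _ _ (subcandidate_mid (svalP x) (svalP y)).
pose N (x : T) := en (positive_part (sval x)) (positive_part (sval x)) +
                  en (negative_part (sval x)) (negative_part (sval x)).
have [|||r|u [gamma [B [gG Gg NB Nc]]]] :=
  @minimizing_sequence R T (exist _ _ s0) mid (fun x => field_energy (sval x)) N 0.
- by move=> x; exact: field_energy_ge0 (svalP x).1.
- by move=> x y; exact: field_energy_mid_le (svalP x).1 (svalP y).1.
- by move=> x; rewrite addr_ge0// (en_ge0 SK).
- by have [B HB] := subcandidate_bounded r; exists B => x; exact: HB (svalP x).
pose w n := sval (u n); have sw n : subcandidate (w n) by exact: svalP.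
have cw n : candidate (w n) := (sw n).1.
have wm n i := subcandidate_mass i (sw n).
(* One ultrafilter containing all tails gives weak limits of all components simultaneously. *)
have [F [UF ooF]] : exists F : set_system nat, UltraFilter F /\ \oo `<=` F.
  exact: ultraFilterLemma.
have PF : ProperFilter F by exact: ultra_proper.
have /choice[v vP] : forall i, exists m : meas X R,
    [/\ radon m, (m setT <= (a i / c)%:E)%E & weak_limit F (fun n => w n i) m].
  by move=> i; apply: ultra_weak_limit => // n; exact: wm.
have rv i : radon (v i) by case: (vP i).
have vm i : (v i setT <= (a i / c)%:E)%E by case: (vP i).
have wl i : weak_limit F (fun n => w n i) (v i) by case: (vP i).
have ac0 i : (0 <= (a i / c)%:E)%E by rewrite lee_fin divr_ge0// ltW.
have rD D : radon (famsum D v) by exact: radon_famsum_mass.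
have wD D : weak_limit F (fun n => famsum D (w n)) (famsum D v).
  by apply: (weak_limit_famsum hX wl _ ac0 (mass_bound_fin D)) => n i _; exact: wm.
have limD D : (forall n, E (famsum D (w n))) ->
    (forall e, 0 < e -> exists n0, forall k n : nat, (n0 <= k)%N -> (n0 <= n)%N ->
      sqd (famsum D (w k)) (famsum D (w n)) < e) ->
    E (famsum D v) /\ forall e, 0 < e -> exists n0, forall n, (n0 <= n)%N ->
      sqd (famsum D (w n)) (famsum D v) < e.
  move=> ED cD; apply: (strong_limit hX SK PF ooF ED cD (rD D) (wD D) (M := total_mass)).
    by move=> n; exact: famsum_mass.
  exact: famsum_mass.
have EP n : E (positive_part (w n)) by case: (cw n).
have EN n : E (negative_part (w n)) by case: (cw n).
(* The midpoint defect of [N] is the sum of the squared distances between the two parts, so both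
   parts become Cauchy. *)
have midE k n : 2 * N (u k) + 2 * N (u n) - 4 * N (mid (u k) (u n)) =
    sqd (positive_part (w k)) (positive_part (w n)) +
    sqd (negative_part (w k)) (negative_part (w n)).
  rewrite !(sqd_en_halfm hX SK)// -positive_part_mid -negative_part_mid /N /=.
  rewrite -!/(w _); move: (en _ _) (en _ _) (en _ _) (en _ _) (en _ _) (en _ _) => *; ring.
have [EPv lP] : E (positive_part v) /\ forall e, 0 < e -> exists n0, forall n, (n0 <= n)%N ->
    sqd (positive_part (w n)) (positive_part v) < e.
  apply: limD => // e e0; have [n0 Hn0] := Nc e e0; exists n0 => m n m0 n0'.
  apply: le_lt_trans (Hn0 m n m0 n0'); rewrite midE lerDl; exact: (sqd_ge0 hX SK).
have [ENv lN] : E (negative_part v) /\ forall e, 0 < e -> exists n0, forall n, (n0 <= n)%N ->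
    sqd (negative_part (w n)) (negative_part v) < e.
  apply: limD => // e e0; have [n0 Hn0] := Nc e e0; exists n0 => m n m0 n0'.
  apply: le_lt_trans (Hn0 m n m0 n0'); rewrite midE lerDr; exact: (sqd_ge0 hX SK).
have w0 n i : w n i (~` A i) = 0%E by case: (cw n).
have v0 i : v i (~` A i) = 0%E.
  exact: (weak_limit_concentrated (@cA i) (wl i) (fun n => w0 n i)).
have wle n i : (gint i (w n i) <= (a i)%:E)%E.
  have [[_ _ _ _ ma] mal] := sw n.
  by have [->//|/eqP il] := eqVneq i l; rewrite ma.
have vle i : (gint i (v i) <= (a i)%:E)%E.
  exact: (weak_limit_weight_le (@cA i) (@gAi i) c0 (@cgi i) (wl i)
    (fun n => w0 n i) (fun n => wle n i)).
(* For [i <> l] finite capacity of [A i] provides the tail bound that prevents loss of [g]-mass; on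
   [A l] some may be lost. *)
have vge i : i <> l -> ((a i)%:E <= gint i (v i))%E.
  move=> il; apply: (weak_limit_weight_ge hX (@cA i) (@gAi i) c0 (@cgi i) (wl i)
    (fun n => wm n i) (vm i)).
    by move=> n; have [_ _ _ _ ma] := cw n; exact: ma.
  by move=> e e0; exact: (weight_tail il sw NB e0).
have cv : candidate v.
  by split => // i il; apply/eqP; rewrite eq_le vle vge.
exists v; split; first by split.
suff vg : field_energy v <= gamma by move=> nu sn; exact: le_trans vg (gG (exist _ _ sn)).
rewrite leNgt; apply/negP => gv.
have d0 : 0 < (field_energy v - gamma) / 2 by rewrite divr_gt0// subr_gt0.
have [n0 _ Hn0] := near_infty_natSinv_lt (PosNum d0).
pose q := gamma + (field_energy v - gamma) / 2.
have qv : q < field_energy v by rewrite /q; move: (field_energy v) gv => x xg; lra.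
have wq n : (n0 <= n)%N -> field_energy (w n) <= q.
  move=> nn; apply: le_trans (Gg n) _; rewrite lerD2l ltW//; exact: (Hn0 n nn).
have q0 : 0 <= q by apply: le_trans (wq n0 (leqnn _)); exact: field_energy_ge0.
have v0' : 0 < field_energy v by exact: le_lt_trans qv.
(* A third of the gap in norm, because each of the two parts of [w n] may be off by less than
   [e]. *)
pose e := (Num.sqrt (field_energy v) - Num.sqrt q) / 3.
have e0 : 0 < e by rewrite divr_gt0// subr_gt0 ltr_sqrt.
have [n1 Hn1] := lP (e ^+ 2) (exprn_gt0 2 e0).
have [n2 Hn2] := lN (e ^+ 2) (exprn_gt0 2 e0).
pose n := (n0 + n1 + n2)%N.
have distlt p m : sqd p m < e ^+ 2 -> dist p m < e.
  move=> pm; change (Num.sqrt (sqd p m) < e).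
  by rewrite -[ltRHS](ger0_norm (ltW e0)) -sqrtr_sqr ltr_sqrt// exprn_gt0.
have n0n : (n0 <= n)%N by rewrite /n -addnA leq_addr.
have n1n : (n1 <= n)%N by rewrite /n addnAC leq_addl.
have n2n : (n2 <= n)%N by rewrite /n leq_addl.
have A1 := distlt _ _ (Hn1 n n1n); have A2 := distlt _ _ (Hn2 n n2n).
have [EPvc ENvc] := candidate_Eplus cv; have [EPc ENc] := candidate_Eplus (cw n).
have B1 := dist_triangle hX SK EPvc EPc ENvc; have B2 := dist_triangle hX SK EPc ENc ENvc.
have A3 : dist (addm (positive_part (w n)) cp) (addm (negative_part (w n)) cn) <= Num.sqrt q.
  by apply: ler_wsqrtr; exact: wq.
have A4 : dist (addm (positive_part v) cp) (addm (negative_part v) cn) =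
  Num.sqrt (field_energy v) by [].
move: B1 B2; rewrite A4 (dist_addl hX SK EPv (EP n) Ep) (dist_addl hX SK (EN n) ENv En).
rewrite (distC hX SK EPv (EP n)).
move: e0 A1 A2 A3; rewrite /e; move: (dist _ _) (dist _ _) (dist _ _) (dist _ _).
move: (Num.sqrt _) (Num.sqrt _) => *; lra.
Qed.

Local Notation field_dist mu := (Num.sqrt (field_energy mu)).

Lemma upd_id mu : upd mu (mu l) = mu.
Proof. by apply/funext => i; rewrite /upd; case: eqP => // ->. Qed.

(** Changing the [l]-th component alone moves the charge by the difference of the two measures. *)
Lemma field_dist_upd mu m m' : candidate mu -> E m -> E m' ->
  field_dist (upd mu m) <= field_dist (upd mu m') + dist m' m.
Proof.
move=> cm Em Em'; have [Er _] := candidate_rest cm; have [EPc _] := candidate_Eplus cm.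
rewrite /field_energy !positive_part_upd !negative_part_upd.
have Erc := Eplus_addm hX SK Er En.
rewrite (addmC _ m) (addmC _ m') -!addmA.
apply: le_trans (dist_triangle hX SK EPc (Eplus_addm hX SK Em' Erc) (Eplus_addm hX SK Em Erc)) _.
by apply: lerD => //; rewrite (dist_addl hX SK).
Qed.

Lemma sqd_addr p q : E p -> E q -> sqd p (addm p q) = en q q.
Proof.
move=> Epp Eqq; change (en p p + en (addm p q) (addm p q) - 2 * en p (addm p q) = en q q).
have Epq := Eplus_addm hX SK Epp Eqq.
rewrite (en_addl hX SK)// !(en_addr hX SK)// (enC hX SK Eqq Epp).
by move: (en p p) (en p q) (en q q) => x y z; ring.
Qed.

Lemma gint_compact_fin m K : radon m -> compact K -> m (~` K) = 0%E -> (gint l m < +oo)%E.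
Proof.
move=> rm cK mK.
have mKC : bmeasurable (~` K) by apply: measurableC; exact: compact_bmeasurable.
rewrite (ge0_negligible_integral mKC (mA l) (@mg l) (@g0 l) mK) setDE setCK.
exact: (weight_compact_fin hX (@cA l) (@gAi l) c0 (@cgi l) rm cK).
Qed.

(** The halving argument of [subminimal_minimal] needs finite [g]-mass on [A l]; compact truncation
    provides it at an arbitrarily small cost in norm. *)
Lemma truncate_candidate mu e : candidate mu -> 0 < e -> exists m,
  [/\ candidate (upd mu m), (gint l m < +oo)%E &
      field_dist (upd mu m) <= field_dist mu + e].
Proof.
move=> cm e0; have [_ Eq] := candidate_rest cm; have [rq _] := Eq.
have [_ q0 _ _ _] := cm.
have k0 x y : (0 <= kappa x y)%E by have [+ _ _ _ _] := SK; exact.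
have klsc : lower_semicontinuous (fun z : X * X => kappa z.1 z.2) by have [] := SK.
(* The energy of the restriction is at most its mutual energy with [mu l]. The squared distance is
   therefore at most the energy of [mu l] minus that mutual energy, hence below [e ^ 2]. *)
have lt : ((en (mu l) (mu l) - e ^+ 2)%:E < kap kappa (mu l) (mu l))%E.
  by rewrite (enE hX SK)// lte_fin ltrBlDr ltrDl exprn_gt0.
have [K [cK lK]] := lt_kap_restrm hX k0 klsc rq rq lt.
have EK := Eplus_restrm hX SK cK Eq; have rK := radon_restrm hX cK rq.
have mK := compact_bmeasurable hX cK.
exists (restrm K (mu l)); split.
- apply: candidate_upd => //; rewrite restrmE//.
  apply/eqP; rewrite eq_le measure_ge0 andbT -(q0 l).
  have mAC : bmeasurable (~` A l) by apply: measurableC; exact: mA.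
  by apply: (le_bmeasure (mu l) (measurableI _ _ mAC mK) mAC) => x [].
- by apply: (gint_compact_fin rK cK); rewrite restrmE// setICl measure0.
- apply: le_trans (field_dist_upd cm EK Eq) _; rewrite upd_id lerD2l.
  change (Num.sqrt (sqd (mu l) (restrm K (mu l))) <= e).
  rewrite -[leRHS](ger0_norm (ltW e0)) -sqrtr_sqr ler_wsqrtr//.
  change (en (mu l) (mu l) + en (restrm K (mu l)) (restrm K (mu l)) -
    2 * en (mu l) (restrm K (mu l)) <= e ^+ 2).
  have := kap_restrmr hX SK cK rK rq; rewrite !(enE hX SK)// lee_fin.
  move: lK; rewrite (enE hX SK)// lte_fin (enC hX SK EK Eq).
  move: (en _ _) (en _ _) (en _ _) (e ^+ 2) => x y z w *; lra.
Qed.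

(* Taking midpoints with mu halves the excess of g-mass over that of mu. *)
Lemma subminimal_minimal mu : subcandidate mu ->
  (forall nu, subcandidate nu -> field_energy mu <= field_energy nu) ->
  (gint l (mu l) < (a l)%:E)%E -> minimal mu.
Proof.
move=> [cm _] min; have gm0 : (0 <= gint l (mu l))%E by apply: integral_ge0 => x /g0.
move=> ba; have [b bE] : exists b, gint l (mu l) = b%:E.
  by exists (fine (gint l (mu l))); rewrite fineK// ge0_fin_numE// (lt_trans ba)// ltry.
move: ba gm0; rewrite bE lte_fin lee_fin => ba b0.
(* [k] counts the halvings that bring the excess [(a l - b) * 2 ^ k] down to [a l - b]; convexity
   carries the inequality back from the midpoint to [nu]. *)
have step k nu : candidate nu -> (gint l (nu l) <= (b + (a l - b) * 2 ^+ k)%:E)%E ->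
    field_energy mu <= field_energy nu.
  elim: k nu => [|k IH] nu cn' nb.
    by apply: min; split => //; apply: le_trans nb _; rewrite lee_fin expr0 mulr1 subrKC.
  suff le : field_energy mu <= field_energy (midfamily mu nu).
    have := le_trans le (field_energy_mid_le cm cn').
    by move: (field_energy mu) (field_energy nu) => x y *; lra.
  apply: IH; first exact: candidate_mid.
  rewrite gint_mid bE.
  apply: (@le_trans _ _ ((2^-1)%:E * b%:E + (2^-1)%:E * (b + (a l - b) * 2 ^+ k.+1)%:E)%E).
    by rewrite leeD2l// lee_wpmul2l// lee_fin invr_ge0.
  by rewrite -!EFinM -EFinD lee_fin exprS; move: (a l) (2 ^+ k) => s t; lra.
have fin nu : candidate nu -> (gint l (nu l) < +oo)%E -> field_energy mu <= field_energy nu.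
  move=> cn' nf; have n0 : (0 <= gint l (nu l))%E by apply: integral_ge0 => x /g0.
  have [k kP] : exists k, fine (gint l (nu l)) / (a l - b) <= 2 ^+ k.
    exists (Num.truncn (fine (gint l (nu l)) / (a l - b))).+1.
    have r0 : 0 <= fine (gint l (nu l)) / (a l - b).
      by rewrite divr_ge0// ?fine_ge0// subr_ge0 ltW.
    have /andP[_ /ltW r1] := truncn_itv r0; apply: le_trans r1 _.
    by rewrite -natrX ler_nat ltnW// ltn_expl.
  apply: (step k) => //; rewrite -(fineK (x := gint l (nu l))) ?ge0_fin_numE// lee_fin.
  move: kP; rewrite ler_pdivrMr ?subr_gt0// mulrC => kP.
  by apply: le_trans kP _; rewrite lerDr.
(* Candidates of infinite [g]-mass are reached by truncation. *)
split => // nu cn'; rewrite -ler_sqrt; last exact: field_energy_ge0.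
apply/ler_addgt0Pr => e e0; have [m [cum mfin le]] := truncate_candidate cn' e0.
apply: le_trans le; apply: ler_wsqrtr; apply: fin => //.
by rewrite /upd eqxx.
Qed.

Lemma minimal_gint mu nu : minimal mu -> minimal nu -> gint l (mu l) = gint l (nu l).
Proof. by move=> mm mn; apply: eq_measure_integral => B mB BA; exact: minimal_unique. Qed.

Lemma Gauss_solvableP : Gauss_solvable kappa sg A cp cn g a <->
  exists mu, [/\ candidate mu, gint l (mu l) = (a l)%:E &
    forall nu, candidate nu -> gint l (nu l) = (a l)%:E -> field_energy mu <= field_energy nu].
Proof.
split=> [[mu [/candidate_full[cm ml] min]]|[mu [cm ml min]]]; exists mu.
  by split => // nu cn' nl; rewrite -(Gchi_le cm cn'); apply: min; exact/candidate_full.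
split; first exact/candidate_full.
by move=> nu /candidate_full[cn' nl]; rewrite (Gchi_le cm cn'); exact: min.
Qed.

Lemma solvable_of_le lam mu0 : minimal lam -> subcandidate mu0 ->
  ((a l)%:E <= gint l (lam l))%E -> Gauss_solvable kappa sg A cp cn g a.
Proof.
move=> mlam s0 al; have [mu [[cm ml] min]] := exists_subminimal s0.
apply/Gauss_solvableP; exists mu; split => //; last first.
  by move=> nu cn' nl; apply: min; split => //; rewrite nl.
apply/eqP; rewrite eq_le ml /=; rewrite leNgt; apply/negP => ba.
have mm := subminimal_minimal (conj cm ml) min ba.
by move: ba; rewrite (minimal_gint mm mlam) ltNge al.
Qed.

(* The only place where C(A l) = +oo enters. *)
Lemma small_energy_weight b e : 0 < b -> 0 < e -> exists m,
  [/\ E m, m (~` A l) = 0%E, gint l m = b%:E & en m m <= e].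
Proof.
move=> b0 e0; have cl : capacity kappa (A l) = +oo%E by exact/capl.
(* A unit measure on [A l] has [g]-mass [r >= c], so scaling it by [b / r <= b / c] multiplies its
   energy by at most [(b / c) ^ 2]. *)
have S0 : 0 < b / c by rewrite divr_gt0.
have [t [[Et t1 [C [cC CA tC]]] te]] :=
  capacity_pinfty hX SK cl (divr_gt0 e0 (exprn_gt0 2 S0)).
have rt : radon t by case: Et.
have tA : t (~` A l) = 0%E.
  apply/eqP; rewrite eq_le measure_ge0 andbT -tC.
  apply: (le_bmeasure t (measurableC (mA l)) (measurableC (compact_bmeasurable hX cC))).
  exact: subsetC.
have := gint_compact_fin rt cC tC.
have := mass_le_weight (@cA l) (@gAi l) c0 (@cgi l) tA; rewrite t1 mule1.
case rE : (gint l t) => [r| |]// cr _; rewrite lee_fin in cr.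
have r0 : 0 < r by exact: lt_le_trans cr.
have br : 0 <= b / r by rewrite divr_ge0// ltW.
exists (scalem (NngNum br) t); split.
- exact: (Eplus_scalem hX SK).
- by rewrite scalemE tA mule0.
- by rewrite integral_scalem// ?rE => [|x /g0//]; rewrite -EFinM /= divfK// gt_eqF.
- rewrite (en_scalel hX SK)// ?(en_scaler hX SK)//; last exact: (Eplus_scalem hX SK).
  rewrite /= mulrA -expr2; apply: (@le_trans _ _ ((b / c) ^+ 2 * (e / (b / c) ^+ 2))).
    apply: ler_pM; rewrite ?exprn_ge0 ?(en_ge0 SK)//; last exact: ltW.
    rewrite lerXn2r ?nnegrE//; first by rewrite ltW.
    by rewrite ler_pM2l// lef_pV2 ?posrE.
  by rewrite mulrC divfK// expf_neq0// gt_eqF.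
Qed.

Lemma le_of_solvable lam : minimal lam -> Gauss_solvable kappa sg A cp cn g a ->
  ((a l)%:E <= gint l (lam l))%E.
Proof.
move=> mlam /Gauss_solvableP[mu [cm ml min]]; rewrite leNgt; apply/negP => ba.
have [cl minl] := mlam; have [_ El] := candidate_rest cl.
have [_ l0 _ _ _] := cl.
have gl0 : (0 <= gint l (lam l))%E by apply: integral_ge0 => x /g0.
have [b bE] : exists b, gint l (lam l) = b%:E.
  by exists (fine (gint l (lam l))); rewrite fineK// ge0_fin_numE// (lt_trans ba)// ltry.
suff mmu : minimal mu by move: ba; rewrite (minimal_gint mlam mmu) ml ltxx.
split => // nu /minl; apply: le_trans; rewrite -ler_sqrt; last exact: field_energy_ge0.
apply/ler_addgt0Pr => e e0.
move: ba; rewrite bE lte_fin -subr_gt0 => ba.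
(* Supplying the missing [g]-mass within distance [e] of [lam] produces a competitor for [mu]. *)
have [t [Et tA tb te]] := small_energy_weight ba (exprn_gt0 2 e0).
have Elt := Eplus_addm hX SK El Et.
have cu : candidate (upd lam (addm (lam l) t)).
  by apply: candidate_upd => //; rewrite addmE l0 tA adde0.
apply: (@le_trans _ _ (field_dist (upd lam (addm (lam l) t)))).
  apply/ler_wsqrtr/min => //; rewrite /upd eqxx integral_addm// => [|x /g0//].
  by rewrite bE tb -EFinD subrKC.
apply: le_trans (field_dist_upd cl Elt El) _; rewrite upd_id lerD2l.
change (Num.sqrt (sqd (lam l) (addm (lam l) t)) <= e).
by rewrite sqd_addr// -[leRHS](ger0_norm (ltW e0)) -sqrtr_sqr ler_wsqrtr.
Qed.

(** [None] has negative sign, so [w] joins the negative part, and the entry of index [l] is the zero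
    measure: the charge is that of [lam] with [w] as [l]-th component, plus chi. Projecting is thus
    minimizing over the [l]-th coordinate alone. *)
Lemma projection_functionalE lam w : candidate lam -> E w -> w (~` A l) = 0%E ->
  kpair kappa (numin_sign sg) (numin_meas cp cn l lam w)
              (numin_sign sg) (numin_meas cp cn l lam w) = (field_energy (upd lam w))%:E.
Proof.
move=> cl Ew wA; have [rm m0 EP EN ma] := cl; have [Er _] := candidate_rest cl.
have [EPc _] := candidate_Eplus cl.
(* The measures indexed by [inr] are [upd lam mzero]. *)
have z := positive_part_upd lam mzero; have z' := negative_part_upd lam mzero.
have PE : famsum [set j | numin_sign sg j] (numin_meas cp cn l lam w) =
    addm (positive_part lam) cp.
  rewrite (_ : [set _ | _] = Some @` [set j | nu_sign sg j]); last first.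
    by apply/seteqP; split => [[j|//] sj|_ [j sj <-]//]; exists j.
  rewrite famsum_image; last by move=> i j [].
  by rewrite famsum_sum addmC; congr addm; [exact: z|exact: field_positiveE].
have NE : famsum [set j | ~~ numin_sign sg j] (numin_meas cp cn l lam w) =
    addm (addm (negative_rest lam) w) cn.
  rewrite famsum_option// addmAC; congr addm.
  rewrite famsum_sum addmC; congr addm; last exact: field_negativeE.
  by apply: etrans z' _; apply: measure_ext => B; rewrite addmE adde0.
have EN' : E (addm (addm (negative_rest lam) w) cn).
  by apply: (Eplus_addm hX SK) => //; exact: (Eplus_addm hX SK).
have rj j : radon (numin_meas cp cn l lam w j).
  case: j => [[[]|i]|] /=; [by case: Ep|by case: En| |by case: Ew].
  by case: eqP => // _; exact: radon_mzero.
rewrite (kpairE hX SK)// ?PE ?NE//; try by case: EPc; case: EN'.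
by rewrite (enB_self hX SK)// /field_energy positive_part_upd negative_part_upd.
Qed.

Lemma projectionP lam w : candidate lam ->
  is_projection kappa sg (A l) cp cn l lam w <->
  [/\ E w, w (~` A l) = 0%E & forall w' : meas X R, E w' -> w' (~` A l) = 0%E ->
    field_energy (upd lam w) <= field_energy (upd lam w')].
Proof.
move=> cl; split=> [[Ew /concentrated_null wA min]|[Ew wA min]].
  split => // w' Ew' wA'; rewrite -lee_fin -!projection_functionalE//.
  by apply: min => //; exact/concentrated_null.
split => //; first exact/concentrated_null.
by move=> w' Ew' /concentrated_null wA'; rewrite !projection_functionalE// lee_fin min.
Qed.

Lemma minimal_projection lam : minimal lam ->
  is_projection kappa sg (A l) cp cn l lam (lam l).
Proof.
move=> [cl min]; apply/projectionP => //; split; first exact: (candidate_rest cl).2.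
  by case: cl.
by move=> w' Ew' wA'; rewrite upd_id; apply: min; exact: candidate_upd.
Qed.

(** Putting [w] in place of [lam l] does not increase the field energy, so the new family is minimal
    too, and uniqueness on [A l] compares the two. *)
Lemma projection_gint lam w : minimal lam ->
  is_projection kappa sg (A l) cp cn l lam w -> gint l w = gint l (lam l).
Proof.
move=> mlam; have [cl min] := mlam => /(projectionP _ cl)[Ew wA wmin].
have mw : minimal (upd lam w).
  split; first exact: candidate_upd.
  move=> nu /min; apply: le_trans; rewrite -[in leRHS](upd_id lam); apply: wmin.
    exact: (candidate_rest cl).2.
  by case: cl.
by have := minimal_gint mw mlam; rewrite {1}/upd eqxx.
Qed.

Lemma solvable_iff lam mu0 : minimal lam -> subcandidate mu0 ->
  Gauss_solvable kappa sg A cp cn g a <-> ((a l)%:E <= gint l (lam l))%E.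
Proof. by move=> mlam s0; split; [exact: le_of_solvable|exact: solvable_of_le s0]. Qed.

End gauss_problem.

Theorem theorem7p3 (R : realType) (X : ptopologicalType)
  (kappa : X -> X -> \bar R) (h : R)
  (I : countType) (sg : I -> bool) (A : I -> set X)
  (cp cn : meas X R) (g : X -> R) (l : I) (a : I -> R) (lam : I -> meas X R) :
  (* the space X *)
  hausdorff_space X -> locally_compact [set: X] -> ~ compact [set: X] ->
  (* the kernel *)
  standing_kernel kappa h ->
  (* the condenser, external field chi = cp - cn, and g *)
  condenser kappa sg A ->
  external_field kappa sg A cp cn ->
  g_condition kappa A g ->
  (* L = {i : C(A_i) = +oo} = {l}, l in I^-, A_i disjoint from A_l for i <> l *)
  (forall i, capacity kappa (A i) = +oo%E <-> i = l) ->
  ~~ sg l ->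
  (forall i, i <> l -> A i `&` A l = set0) ->
  (* a admissible, lam a solution of the (A, a, g, chi, I \ {l})-problem *)
  admissible kappa sg A cp cn g a ->
  solves kappa sg A cp cn g a [set i | i <> l] lam ->
  (Gauss_solvable kappa sg A cp cn g a <->
     ((a l)%:E <= \int[lam l]_(x in A l) (g x)%:E)%E) /\
  (exists omega, is_projection kappa sg (A l) cp cn l lam omega) /\
  (forall omega, is_projection kappa sg (A l) cp cn l lam omega ->
     (Gauss_solvable kappa sg A cp cn g a <->
        ((a l)%:E <= \int[omega]_(x in A l) (g x)%:E)%E)).
Proof.
move=> hX _ _ SK cond chi [gA [c [c0 cg]] gcond] capl sl Al [a0 afin Gfin] slam.
have mlam := (solvesP l hX SK cond chi gA c0 cg afin a0 lam).1 slam.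
(* Admissibility makes the class nonempty: an infimum below [+oo] comes from a member. *)
have [mu0 s0] : exists mu, subcandidate kappa sg A g l a mu.
  have [_ [mu Emu _] _] := ereal_inf_lt Gfin; exists mu.
  have [cm ml] := (candidate_full l hX SK cond gA c0 cg afin a0 mu).1 Emu.
  by split => //; rewrite ml.
have iff := solvable_iff hX SK cond chi gA c0 cg sl Al afin a0 gcond capl mlam s0.
split => //; split.
  by exists (lam l); exact: (minimal_projection hX SK cond chi gA c0 cg sl afin a0 mlam).
move=> w pw.
by rewrite (projection_gint hX SK cond chi gA c0 cg sl Al afin a0 mlam pw).
Qed.
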